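(* Let $G$ be a discrete group and let $\alpha$ be a decomposable partial action of $G$ on a $C^*$-algebra $A$. Then there are a faithful conditional expectation $E\colon A\to A^G$ and an injective homomorphism $c\colon A^G\to A\rtimes_\alpha G$ whose image is a corner in $A\rtimes_\alpha G$.
   Context: Partial actions: a partial action $\alpha=((A_g)_{g\in G},(\alpha_g)_{g\in G})$ of a discrete group $G$ on a $C^*$-algebra $A$ consists of closed two-sided ideals $A_g$ of $A$ and $*$-isomorphisms $\alpha_g\colon A_{g^{-1}}\to A_g$ such that $A_1=A$, $\alpha_1=\mathrm{id}_A$, and $\alpha_{gh}$ extends $\alpha_g\circ\alpha_h$ wherever the composition is defined. Crossed product: $A\rtimes_\alpha G$ is the full partial crossed product, that is, the enveloping $C^*$-algebra of the $*$-algebra of finite sums $\sum_g a_g\delta_g$ with $a_g\in A_g$, with product $(a\delta_g)(b\delta_h)=\alpha_g(\alpha_{g^{-1}}(a)b)\delta_{gh}$ and involution $(a\delta_g)^*=\alpha_{g^{-1}}(a^* )\delta_{g^{-1}}$. Decomposition property: for $n\in\mathbb{N}=\{1,2,\ldots\}$ let $\mathcal{T}_n(G)=\{\tau\subseteq G\colon 1\in\tau,\ |\tau|=n\}$, and set $A_\tau=\bigcap_{g\in\tau}A_g$. The partial action $\alpha$ has the $n$-decomposition property if (a) $A=\overline{\sum_{\tau\in\mathcal{T}_n(G)}A_\tau}$, and (b) $A_\tau\cap A_g=\{0\}$ for all $\tau\in\mathcal{T}_n(G)$ and all $g\in G\setminus\tau$. It is decomposable if it has the $n$-decomposition property for some $n\in\mathbb{N}$.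 Fixed point algebra: $A^G$ is the $C^*$-subalgebra of $A$ of all $G$-invariant elements, where $a\in A$ is $G$-invariant if $\alpha_{g^{-1}}(ab)=a\,\alpha_{g^{-1}}(b)$ for all $g\in G$ and all $b\in A_g$. A corner in a $C^*$-algebra $B$ is a subalgebra of the form $pBp$ for a projection $p$ in the multiplier algebra $M(B)$. Homomorphisms are $*$-homomorphisms. *)

(* Defs.v *)
(* MathComp-Analysis. *)
From HB Require Import structures.
From mathcomp Require Import all_boot all_order all_algebra.
From mathcomp Require Import all_classical all_reals all_analysis.
From mathcomp Require Import complex.

Set Implicit Arguments.
Unset Strict Implicit.
Unset Printing Implicit Defensive.

Import Order.TTheory GRing.Theory Num.Theory.
Import numFieldNormedType.Exports.

Local Open Scope classical_set_scope.
Local Open Scope ring_scope.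
Local Open Scope complex_scope.

(* C*-algebras are complex and not assumed to be unital, so the product cannot
   come from MathComp's ring structures, which all have a unit. *)
HB.mixin Record CompleteNormedModule_isCStarAlgebra (R : realType) A
    of CompleteNormedModule R[i] A := {
  amul : A -> A -> A;
  star : A -> A;
  amulA : associative amul;
  amulDl : left_distributive amul +%R;
  amulDr : right_distributive amul +%R;
  amulZl : forall (k : R[i]) (x y : A), amul (k *: x) y = k *: amul x y;
  amulZr : forall (k : R[i]) (x y : A), amul x (k *: y) = k *: amul x y;
  starK : involutive star;
  starD : {morph star : x y / x + y};
  starZ : forall (k : R[i]) (x : A), star (k *: x) = k^* *: star x;
  starM : forall x y : A, star (amul x y) = amul (star y) (star x);
  norm_amul : forall x y : A, `|amul x y| <= `|x| * `|y|;
  norm_star_amul : forall x : A, `|amul (star x) x| = `|x| ^+ 2;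
}.

#[short(type="cstarAlgType")]
HB.structure Definition CStarAlgebra (R : realType) :=
  {A of CompleteNormedModule_isCStarAlgebra R A & CompleteNormedModule R[i] A}.

Declare Scope cstar_scope.
Delimit Scope cstar_scope with CS.
Notation "x ** y" := (amul x y) (at level 40, left associativity) : cstar_scope.
Local Open Scope cstar_scope.

(* *-homomorphisms between *-algebras that are only given as subsets of complex
   vector spaces: [f] is a total function, constrained on [S] only. *)
Definition star_hom_on (R : realType) (V W : lmodType R[i])
    (mulV : V -> V -> V) (starV : V -> V)
    (mulW : W -> W -> W) (starW : W -> W) (S : set V) (f : V -> W) : Prop :=
  [/\ forall (k : R[i]) x y, S x -> S y -> f (k *: x + y) = k *: f x + f y,
      forall x y, S x -> S y -> f (mulV x y) = mulW (f x) (f y) &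
      forall x, S x -> f (starV x) = starW (f x)].

Definition cstar_hom_on (R : realType) (A B : cstarAlgType R) (S : set A)
    (f : A -> B) : Prop :=
  star_hom_on (@amul R A) (@star R A) (@amul R B) (@star R B) S f.

Definition closed_ideal (R : realType) (A : cstarAlgType R) (I : set A) : Prop :=
  [/\ closed I,
      I 0,
      forall (k : R[i]) x y, I x -> I y -> I (k *: x + y) &
      forall x a, I x -> I (a ** x) /\ I (x ** a)].

(* [pact alpha g] is a total function; only its restriction to the domain
   [pdom alpha g^-1] is meaningful. *)
Record partial_action (R : realType) (G : groupType) (A : cstarAlgType R) := {
  pdom : G -> set A;
  pact : G -> A -> A;
  pdom_ideal : forall g, closed_ideal (pdom g);
  pact_bij : forall g, set_bij (pdom g^-1%g) (pdom g) (pact g);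
  pact_hom : forall g, cstar_hom_on (pdom g^-1%g) (pact g);
  pdom1 : pdom 1%g = setT;
  pact1 : forall a, pact 1%g a = a;
  pactM : forall g h a, pdom h^-1%g a -> pdom g^-1%g (pact h a) ->
    pdom (g * h)^-1%g a /\ pact (g * h)%g a = pact g (pact h a)
}.

Section PartialActions.
Context (R : realType) (G : groupType) (A : cstarAlgType R).
Variable alpha : partial_action G A.

Definition pT (n : nat) : set (set G) := [set tau | tau 1%g /\ (tau #= `I_n)%card].

Definition pdomI (tau : set G) : set A := \bigcap_(g in tau) pdom alpha g.

Definition pdom_sum (n : nat) : set A :=
  [set a | exists (m : nat) (x : 'I_m -> A),
    (forall i, exists2 tau, pT n tau & pdomI tau (x i)) /\ a = \sum_i x i].

Definition n_decomposition (n : nat) : Prop :=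
  closure (pdom_sum n) = setT /\
  forall tau g, pT n tau -> ~ tau g -> pdomI tau `&` pdom alpha g = [set 0].

Definition decomposable : Prop := exists2 n, (0 < n)%N & n_decomposition n.

Definition fixed_algebra : set A :=
  [set a | forall g b, pdom alpha g b ->
    pact alpha g^-1%g (a ** b) = a ** pact alpha g^-1%g b].

(* A finite sum of terms [a_g delta_g] is encoded by its coefficient function
   [g |-> a_g]. *)
Definition alg_crossed : set (G -> A) :=
  [set f | finite_set [set g | f g != 0] /\ forall g, pdom alpha g (f g)].

(* The coefficient at [k] of [sum_(g, h) (f g delta_g) (f' h delta_h)]: the
   terms with [g h = k] are those with [h = g^-1 k]. *)
Definition crossed_mul (f f' : G -> A) : G -> A := fun k =>
  \sum_(g \in [set: G])
    pact alpha g (pact alpha g^-1%g (f g) ** f' (g^-1 * k)%g).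

(* The coefficient at [k] comes from the term of [f] at [g = k^-1]. *)
Definition crossed_star (f : G -> A) : G -> A := fun k =>
  pact alpha k (star (f k^-1%g)).

End PartialActions.

(* [iota : S -> B] exhibits [B] as the enveloping C*-algebra of the *-algebra
   [(S, mulV, starV)]: [B] is the C*-algebra generated by the image, and every
   *-homomorphism from [S] to a C*-algebra factors through [iota] (uniquely, by
   density).  This determines [(B, iota)] up to a unique isomorphism. *)
Definition is_enveloping_cstar (R : realType) (V : lmodType R[i])
    (mulV : V -> V -> V) (starV : V -> V) (S : set V)
    (B : cstarAlgType R) (iota : V -> B) : Prop :=
  [/\ star_hom_on mulV starV (@amul R B) (@star R B) S iota,
      closure (iota @` S) = setT &
      forall (D : cstarAlgType R) (pi : V -> D),
        star_hom_on mulV starV (@amul R D) (@star R D) S pi ->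
        exists2 pi' : B -> D, cstar_hom_on setT pi' &
          forall x, S x -> pi' (iota x) = pi x].

Definition is_crossed_product (R : realType) (G : groupType)
    (A : cstarAlgType R) (alpha : partial_action G A)
    (B : cstarAlgType R) (iota : (G -> A) -> B) : Prop :=
  is_enveloping_cstar (crossed_mul alpha) (crossed_star alpha)
    (alg_crossed alpha) iota.

(* Multipliers as double centralizers: [mult_l m b] is the product [m b] and
   [mult_r m b] is the product [b m]. *)
Record multiplier (R : realType) (B : cstarAlgType R) := {
  mult_l : B -> B;
  mult_r : B -> B;
  mult_l_linear : forall (k : R[i]) x y,
    mult_l (k *: x + y) = k *: mult_l x + mult_l y;
  mult_r_linear : forall (k : R[i]) x y,
    mult_r (k *: x + y) = k *: mult_r x + mult_r y;
  mult_l_bounded : exists M : R[i], forall x, `|mult_l x| <= M * `|x|;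
  mult_r_bounded : exists M : R[i], forall x, `|mult_r x| <= M * `|x|;
  mult_lM : forall x y, mult_l (x ** y) = mult_l x ** y;
  mult_rM : forall x y, mult_r (x ** y) = x ** mult_r y;
  mult_rl : forall x y, mult_r x ** y = x ** mult_l y
}.

(* [p p = p] and [p^* = p], where the adjoint of the double centralizer
   [(L, R)] is [(x |-> (R x^* )^*, x |-> (L x^* )^* )]. *)
Definition mult_projection (R : realType) (B : cstarAlgType R)
    (p : multiplier B) : Prop :=
  [/\ mult_l p \o mult_l p = mult_l p,
      mult_r p \o mult_r p = mult_r p,
      (fun x => star (mult_r p (star x))) = mult_l p &
      (fun x => star (mult_l p (star x))) = mult_r p].

Definition is_corner (R : realType) (B : cstarAlgType R) (S : set B) : Prop :=
  exists2 p : multiplier B, mult_projection p &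
    S = [set mult_l p (mult_r p b) | b in setT].

Definition cstar_positive (R : realType) (A : cstarAlgType R) (a : A) : Prop :=
  exists x, a = star x ** x.

(* [S] is meant to be a C*-subalgebra of [A]. *)
Record conditional_expectation (R : realType) (A : cstarAlgType R)
    (S : set A) (E : A -> A) : Prop := {
  ce_range : forall a, S (E a);
  ce_id : forall b, S b -> E b = b;
  ce_linear : forall (k : R[i]) x y, E (k *: x + y) = k *: E x + E y;
  ce_contractive : forall a, `|E a| <= `|a|;
  ce_positive : forall a, cstar_positive a -> cstar_positive (E a);
  ce_modl : forall b a, S b -> E (b ** a) = b ** E a;
  ce_modr : forall b a, S b -> E (a ** b) = E a ** b
}.

Definition faithful (R : realType) (A : cstarAlgType R) (E : A -> A) : Prop :=
  forall a, cstar_positive a -> E a = 0 -> a = 0.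

(* Main.v *)
Require Import Defs.
From HB Require Import structures.
From mathcomp Require Import all_boot all_order all_algebra.
From mathcomp Require Import all_classical all_reals all_analysis.
From mathcomp Require Import complex.
From mathcomp Require Import ring lra.

(** The decomposition property cuts [A] into pairwise orthogonal ideals [A_t],
    for the [n]-element sets [t] that contain [1]: two of them have zero
    intersection as soon as some [g] belongs to one set only, and their sum is
    dense. The same orthogonality splits each [A_g] off [A], so that [alpha_g]
    extends by zero to an endomorphism [V_g] of [A]. Among the
    translates [V_(h^-1) a] of an element [a] of [A_t], only the [n] ones with
    [h] in [t] can be nonzero, and [E a] is their mean value. On an ideal [A_t] one has [E a c = n^-1 sum_(g in t) V_g a c]; this
    local formula determines [E a], and the bounds, the invariance, the module
    property and the positivity of [E] follow from it, together with the
    inequality [x^* x <= n E (x^* x)], which gives faithfulness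
    ([expect_local], [expect_cond], [expect_index]).

    In the crossed product [B], let [p] be the multiplier
    [n^-1 sum_g 1_g delta_g], where [1_g] is the unit of the multiplier algebra
    of [A_g]. Since [sum_g 1_g = n], this is a projection, and
    [(a delta_g) p = a p] and [p a p = E a p]. So [p] commutes with [A^G], the
    map [c a = a p] is a homomorphism on [A^G], and [p B p] is the closure of
    its image ([pl_sym], [pr_cross], [pl_fixed_emb]).

    It remains to see that [c] is isometric, which also makes its image closed.
    The crossed product acts on [A], with the [A^G]-valued inner product
    [E (x^* y)], by [(a delta_g) x = a V_g x]. There [p] acts as [E], so that
    [c a] acts on [A^G] as the multiplication by [a]. The adjointable operators
    on this Hilbert module form a C*-algebra, and homomorphisms of C*-algebras
    are contractive, so the norm of [c a] in [B] is at least that of [a]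
    ([rep_hom], [fixed_emb_below]).

    All this rests on a few facts about C*-algebras without unit: the
    positivity of [x^* x] ([pos_star_amul]), the monotonicity of the norm on
    positive elements ([pos_mono]) and the contractivity of homomorphisms
    ([star_hom_contractive]). Instead of spectral theory, their proofs use one
    iteration for square roots ([sqlim_exists]) and the remark that
    [u + i v] is unitary when [u] and [v] are commuting self-adjoint elements
    with [u^2 + v^2 = 1] ([unitary_parts]). *)

Set Implicit Arguments.
Unset Strict Implicit.
Unset Printing Implicit Defensive.

Import Order.TTheory GRing.Theory Num.Theory.
Import numFieldNormedType.Exports.

Local Open Scope classical_set_scope.
Local Open Scope ring_scope.
Local Open Scope complex_scope.
Local Open Scope cstar_scope.

(** * Linear combinations *)

Section LinearCombinations.
Context (K : comNzRingType) (V : lmodType K).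

Inductive lexpr :=
  | LVar of nat
  | LZero
  | LAdd of lexpr & lexpr
  | LOpp of lexpr
  | LScale of K & lexpr.

Fixpoint leval (env : seq V) (e : lexpr) : V :=
  match e with
  | LVar n => nth 0 env n
  | LZero => 0
  | LAdd e1 e2 => leval env e1 + leval env e2
  | LOpp e1 => - leval env e1
  | LScale k e1 => k *: leval env e1
  end.

Fixpoint lcoef (e : lexpr) (n : nat) : K :=
  match e with
  | LVar m => if m == n then 1 else 0
  | LZero => 0
  | LAdd e1 e2 => lcoef e1 n + lcoef e2 n
  | LOpp e1 => - lcoef e1 n
  | LScale k e1 => k * lcoef e1 n
  end.

Lemma lcoefE env e :
  leval env e = \sum_(i < size env) lcoef e i *: nth 0 env i.
Proof.
elim: e => [n||e1 IH1 e2 IH2|e1 IH1|k e1 IH1] /=.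
- case: (ltnP n (size env)) => [ltn|len].
    rewrite (bigD1 (Ordinal ltn)) //= eqxx scale1r big1 ?addr0 // => i ne_in.
    rewrite ifN ?scale0r //; apply: contra ne_in => /eqP eni.
    by apply/eqP/val_inj.
  rewrite nth_default // big1 // => i _.
  by rewrite ifN ?scale0r // neq_ltn (leq_trans (ltn_ord i) len) orbT.
- by rewrite big1 // => i _; rewrite scale0r.
- by rewrite IH1 IH2 -big_split /=; apply: eq_bigr => i _; rewrite scalerDl.
- by rewrite IH1 -sumrN; apply: eq_bigr => i _; rewrite scaleNr.
- by rewrite IH1 scaler_sumr; apply: eq_bigr => i _; rewrite scalerA.
Qed.

Fixpoint lcoef_eq (e1 e2 : lexpr) (n : nat) : Prop :=
  if n is n'.+1 then lcoef e1 n' = lcoef e2 n' /\ lcoef_eq e1 e2 n' else True.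

Lemma lexpr_eq env e1 e2 :
  lcoef_eq e1 e2 (size env) -> leval env e1 = leval env e2.
Proof.
move=> eq12; rewrite !lcoefE; apply: eq_bigr => -[i /= lti] _; congr (_ *: _).
elim: (size env) lti eq12 => //= n IH; rewrite ltnS leq_eqVlt => /orP[/eqP ->|].
  by case.
by move=> /IH h [_] /h.
Qed.

End LinearCombinations.

Ltac lmem x env :=
  lazymatch env with
  | x :: _ => constr:(true)
  | _ :: ?env' => lmem x env'
  | _ => constr:(false)
  end.

Ltac lindex x env :=
  lazymatch env with
  | x :: _ => constr:(O)
  | _ :: ?env' => let n := lindex x env' in constr:(S n)
  end.

Ltac latoms e env :=
  lazymatch e with
  | GRing.add ?e1 ?e2 => let env1 := latoms e1 env in latoms e2 env1
  | GRing.opp ?e1 => latoms e1 env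
  | GRing.scale ?k ?e1 => latoms e1 env
  | GRing.zero => env
  | _ => lazymatch lmem e env with
         | true => env
         | false => constr:(e :: env)
         end
  end.

Ltac lreify K e env :=
  lazymatch e with
  | GRing.add ?e1 ?e2 =>
      let t1 := lreify K e1 env in let t2 := lreify K e2 env in
      constr:(LAdd t1 t2)
  | GRing.opp ?e1 => let t1 := lreify K e1 env in constr:(LOpp t1)
  | GRing.scale ?k ?e1 =>
      let t1 := lreify K e1 env in constr:(@LScale K k t1)
  | GRing.zero => constr:(LZero K)
  | _ => let n := lindex e env in constr:(LVar K n)
  end.

(** Noncommutative identities are proved by expanding all products; the
    resulting monomials are the atoms of a linear combination, and [ring] only
    sees the coefficients. *)
Ltac lincomb :=
  lazymatch goal with
  | R : realType |- @eq ?V ?x ?y =>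
    let K := constr:(complex R : comNzRingType) in
    let env0 := latoms x (@nil V) in
    let env := latoms y env0 in
    let t1 := lreify K x env in
    let t2 := lreify K y env in
    apply: (@lexpr_eq K _ env t1 t2); rewrite /=; repeat split;
    rewrite /=; try ring
  end.


(** * Real-valued norms *)

Section RealNorm.
Context (R : realType) (V : normedModType R[i]).
Implicit Types (x y : V) (r : R).

(** Norms are complex-valued; taking the real part gives access to the order
    of [R]. *)
Definition nrm x : R := complex.Re `|x|.

Lemma nrmE x : `|x| = (nrm x)%:C.
Proof. by rewrite /nrm RRe_real // ger0_real. Qed.

Lemma nrm_ge0 x : 0 <= nrm x.
Proof. by rewrite -ler0c -nrmE. Qed.

Lemma le_nrm x y : (`|x| <= `|y|) = (nrm x <= nrm y).
Proof. by rewrite !nrmE lecR. Qed.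

Lemma nrm0 : nrm 0 = 0.
Proof. by rewrite /nrm normr0. Qed.

Lemma nrm0_eq0 x : nrm x = 0 -> x = 0.
Proof. by move=> x0; apply/eqP; rewrite -normr_eq0 nrmE x0. Qed.

Lemma nrm_le0 x : nrm x <= 0 -> x = 0.
Proof. by move=> x0; apply/nrm0_eq0/le_anti; rewrite x0 nrm_ge0. Qed.

Lemma nrmD x y : nrm (x + y) <= nrm x + nrm y.
Proof. by rewrite -lecR rmorphD /= -!nrmE ler_normD. Qed.

Lemma nrmN x : nrm (- x) = nrm x.
Proof. by rewrite /nrm normrN. Qed.

Lemma nrmBC x y : nrm (x - y) = nrm (y - x).
Proof. by rewrite -nrmN opprB. Qed.

Lemma nrmB x y : nrm (x - y) <= nrm x + nrm y.
Proof. by rewrite -(nrmN y) nrmD. Qed.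

Lemma nrm_dist x y z : nrm (x - z) <= nrm (x - y) + nrm (y - z).
Proof. by apply: le_trans (nrmD _ _); rewrite addrA subrK. Qed.

Lemma nrmZ (k : R[i]) x : nrm (k *: x) = complex.Re `|k| * nrm x.
Proof.
by apply: complexI; rewrite rmorphM /= -!nrmE normrZ.
Qed.

Lemma Re_normR r : complex.Re `|r%:C| = `|r|.
Proof. by rewrite normc_def /= expr0n addr0 sqrtr_sqr. Qed.

Lemma nrmZr r x : nrm (r%:C *: x) = `|r| * nrm x.
Proof. by rewrite nrmZ Re_normR. Qed.

Lemma nrmZr_ge0 r x : 0 <= r -> nrm (r%:C *: x) = r * nrm x.
Proof. by move=> r0; rewrite nrmZr ger0_norm. Qed.

Lemma nrmZr_gt0 r x : 0 < r -> nrm (r%:C *: x) = r * nrm x.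
Proof. by move=> r0; rewrite nrmZr_ge0 // ltW. Qed.

Lemma nrm_sum (I : Type) (s : seq I) (F : I -> V) :
  nrm (\sum_(i <- s) F i) <= \sum_(i <- s) nrm (F i).
Proof.
elim: s => [|i s IH]; first by rewrite !big_nil nrm0.
by rewrite !big_cons; apply: le_trans (nrmD _ _) _; rewrite lerD2l.
Qed.

Lemma nrm_limit0 x : (forall e, 0 < e -> nrm x <= e) -> x = 0.
Proof.
by move=> H; apply/nrm_le0/ler_addgt0Pr => e e0; rewrite add0r H.
Qed.

Definition ndense (S : set V) :=
  forall x e, 0 < e -> exists2 y, S y & nrm (x - y) <= e.

Lemma closure_ndense (S : set V) : closure S = setT -> ndense S.
Proof.
move=> cS x e e0; have : closure S x by rewrite cS.
have e0' : 0 < e%:C by rewrite ltcR.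
move=> /(_ (ball x e%:C)) []; first exact: nbhsx_ballx.
move=> y [Sy]; rewrite -ball_normE /= => xy; exists y => //.
by rewrite ltW // -ltcR -nrmE.
Qed.

Lemma ndense_closure (S : set V) x :
  (forall e, 0 < e -> exists2 y, S y & nrm (x - y) <= e) -> closure S x.
Proof.
move=> dS B /nbhs_ballP[e e0 xB].
have eE : e = (complex.Re e)%:C by rewrite RRe_real // gtr0_real.
have e'0 : 0 < complex.Re e by rewrite -ltcR -eE.
have [y Sy xy] := dS _ (divr_gt0 e'0 (ltr0n _ 2)).
exists y; split=> //; apply: xB; rewrite -ball_normE /= nrmE eE ltcR.
by apply: le_lt_trans xy _; rewrite ltr_pdivrMr // ltr_pMr // ltr1n.
Qed.

Lemma closed_limit (S : set V) x : closed S ->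
  (forall e, 0 < e -> exists2 y, S y & nrm (x - y) <= e) -> S x.
Proof. by move=> cS /ndense_closure; rewrite -(closure_id S).1. Qed.

Lemma closed_of_limit (S : set V) :
  (forall x, (forall e, 0 < e -> exists2 y, S y & nrm (x - y) <= e) -> S x) ->
  closed S.
Proof.
move=> H x cx; apply: H => e e0.
have e0' : 0 < e%:C by rewrite ltcR.
have [|y [Sy]] := cx (ball x e%:C); first exact: nbhsx_ballx.
rewrite -ball_normE /= => xy; exists y => //.
by rewrite ltW // -ltcR -nrmE.
Qed.

End RealNorm.

Lemma ncauchy_limit (R : realType) (V : completeNormedModType R[i])
    (u : nat -> V) (d : nat -> R) :
  (forall e, 0 < e -> exists N, forall n, (N <= n)%N -> d n <= e) ->
  (forall m n, (m <= n)%N -> nrm (u m - u n) <= d m) ->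
  exists l, forall n, nrm (u n - l) <= d n.
Proof.
move=> d0 ud.
have cu : cauchy (u @ \oo).
  apply: cauchy_exP => e e0.
  have eE : e = (complex.Re e)%:C by rewrite RRe_real // gtr0_real.
  have e'0 : 0 < complex.Re e by rewrite -ltcR -eE.
  have [N dN] := d0 _ (divr_gt0 e'0 (ltr0n _ 2)).
  exists (u N), N => // n /= Nn; rewrite -ball_normE /= nrmE eE ltcR.
  apply: le_lt_trans (ud _ _ Nn) _; apply: le_lt_trans (dN _ (leqnn _)) _.
  by rewrite ltr_pdivrMr // ltr_pMr // ltr1n.
have /cauchy_cvgP/cvg_ex[/= l ul] := cu.
exists l => n; apply/ler_addgt0Pr => e e0.
have e0' : 0 < e%:C by rewrite ltcR.
have /cvgrPdist_le/(_ _ e0')[N _ /(_ (maxn N n))] := ul.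
rewrite /= leq_maxl nrmE lecR => /(_ isT); rewrite nrmBC => lN.
by apply: le_trans (nrm_dist _ (u (maxn N n)) _) _; rewrite lerD // ud // leq_maxr.
Qed.

(** * Bounded additive maps *)

Section BoundedAdditive.
Context (R : realType).

(** Additivity instead of linearity covers the involution too. *)
Definition badd (V W : normedModType R[i]) (f : V -> W) :=
  {morph f : x y / x + y} /\ exists M, forall x, nrm (f x) <= M * nrm x.

Lemma nrmD_le (V : normedModType R[i]) (x y : V) a b :
  nrm x <= a -> nrm y <= b -> nrm (x + y) <= a + b.
Proof. by move=> xa yb; apply: le_trans (nrmD _ _) _; apply: lerD. Qed.

Lemma nrmB_le (V : normedModType R[i]) (x y : V) a b :
  nrm x <= a -> nrm y <= b -> nrm (x - y) <= a + b.
Proof. by move=> xa yb; apply: nrmD_le; rewrite ?nrmN. Qed.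

Inductive addspan (V : zmodType) (S : set V) : V -> Prop :=
  | addspan0 : addspan S 0
  | addspanD x y : S x -> addspan S y -> addspan S (x + y).

Lemma addspan1 (V : zmodType) (S : set V) x : S x -> addspan S x.
Proof. by move=> Sx; rewrite -[x]addr0; apply: addspanD => //; apply: addspan0. Qed.

Lemma addspan_add (V : zmodType) (S : set V) x y :
  addspan S x -> addspan S y -> addspan S (x + y).
Proof.
by elim=> [|a b Sa _ IH] Sy; rewrite ?add0r // -addrA; apply/addspanD/IH.
Qed.

Lemma addspan_sub (V : zmodType) (S T : set V) x :
  S `<=` T -> addspan S x -> addspan T x.
Proof.
by move=> ST; elim=> [|a b /ST Ta _ Tb]; [apply: addspan0 | apply: addspanD].
Qed.

Lemma badd_bound (V W : normedModType R[i]) (f : V -> W) : badd f ->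
  exists2 M, 0 < M & forall x, nrm (f x) <= M * nrm x.
Proof.
move=> [_ [M fM]]; exists (Num.max M 1); first by rewrite lt_max ltr01 orbT.
by move=> x; apply: le_trans (fM x) _; rewrite ler_wpM2r ?nrm_ge0 // le_max lexx.
Qed.

Section Morphism.
Context (V W : normedModType R[i]) (f : V -> W) (bf : badd f).

Lemma baddD x y : f (x + y) = f x + f y. Proof. exact: bf.1. Qed.
Lemma badd0 : f 0 = 0.
Proof. by apply: (@addIr _ (f 0)); rewrite -baddD !add0r. Qed.
Lemma baddN x : f (- x) = - f x.
Proof. by apply: (@addIr _ (f x)); rewrite -baddD !addNr badd0. Qed.
Lemma baddB x y : f (x - y) = f x - f y.
Proof. by rewrite baddD baddN. Qed.
Lemma badd_sum (I : Type) (s : seq I) (P : pred I) (F : I -> V) :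
  f (\sum_(i <- s | P i) F i) = \sum_(i <- s | P i) f (F i).
Proof. by apply: (big_morph f baddD badd0). Qed.

Lemma badd_lipschitz x e : 0 < e ->
  exists2 d, 0 < d & forall y, nrm (x - y) <= d -> nrm (f x - f y) <= e.
Proof.
move=> e0; have [M M0 fM] := badd_bound bf.
exists (e / M); first by rewrite divr_gt0.
move=> y xy; rewrite -baddB; apply: le_trans (fM _) _.
by rewrite mulrC -ler_pdivlMr.
Qed.

Lemma badd_preimage_closed (T : set W) : closed T -> closed (f @^-1` T).
Proof.
move=> cT; apply: closed_of_limit => x Hx.
apply: (closed_limit cT) => e e0; have [d d0 fd] := badd_lipschitz x e0.
by have [y Ty xy] := Hx _ d0; exists (f y) => //; apply: fd.
Qed.

End Morphism.

Lemma dense_closed (V : normedModType R[i]) (S T : set V) :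
  ndense S -> closed T -> S `<=` T -> forall x, T x.
Proof.
move=> dS cT ST x; apply: (closed_limit cT) => e e0.
by have [y /ST Ty xy] := dS x e e0; exists y.
Qed.

Lemma badd_closed_eq (V W : normedModType R[i]) (f g : V -> W) :
  badd f -> badd g -> closed [set x | f x = g x].
Proof.
move=> bf bg; apply: closed_of_limit => x Hx.
apply/subr0_eq/nrm_limit0 => e e0.
have e20 : 0 < e / 2 by rewrite divr_gt0.
have [d d0 fd] := badd_lipschitz bf x e20.
have [d' d'0 gd] := badd_lipschitz bg x e20.
have [|y /= fgy xy] := Hx (Num.min d d'); first by rewrite lt_min d0.
move: xy; rewrite le_min => /andP[xd xd'].
apply: le_trans (nrm_dist _ (f y) _) _; rewrite {2}fgy (nrmBC (g y)).
by rewrite [leRHS]splitr lerD ?fd ?gd.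
Qed.

(** Identities between maps built from products, adjoints and the action are
    only checked on generators. *)
Lemma badd_eq (V W : normedModType R[i]) (f g : V -> W) (S : set V) :
  badd f -> badd g -> ndense (addspan S) -> (forall x, S x -> f x = g x) ->
  forall x, f x = g x.
Proof.
move=> bf bg dS fg; apply: (dense_closed dS (badd_closed_eq bf bg)).
move=> x; elim=> [|a b /fg fga _ /= IH] /=; first by rewrite (badd0 bf) (badd0 bg).
by rewrite (baddD bf) (baddD bg) fga IH.
Qed.

Section Combinators.
Context (U V W : normedModType R[i]).

Lemma badd_id : badd (@id V).
Proof. by split => //; exists 1 => x; rewrite mul1r. Qed.

Lemma badd_cst0 : badd (fun _ : V => 0 : W).
Proof. by split => [x y|]; rewrite ?addr0 //; exists 0 => x; rewrite nrm0 mul0r. Qed.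

Lemma badd_comp (g : V -> W) (f : U -> V) :
  badd g -> badd f -> badd (fun x => g (f x)).
Proof.
move=> bg bf; split=> [x y|]; first by rewrite (baddD bf) (baddD bg).
have [M M0 fM] := badd_bound bf; have [N N0 gN] := badd_bound bg.
exists (N * M) => x; apply: le_trans (gN _) _.
by rewrite -mulrA ler_pM2l.
Qed.

Lemma badd_add (f g : V -> W) : badd f -> badd g -> badd (fun x => f x + g x).
Proof.
move=> bf bg; split=> [x y|]; first by rewrite (baddD bf) (baddD bg) addrACA.
have [M M0 fM] := badd_bound bf; have [N N0 gN] := badd_bound bg.
exists (M + N) => x; apply: le_trans (nrmD _ _) _.
by rewrite mulrDl lerD.
Qed.

Lemma badd_scale (k : R[i]) (f : V -> W) : badd f -> badd (fun x => k *: f x).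
Proof.
move=> bf; split=> [x y|]; first by rewrite (baddD bf) scalerDr.
have [M M0 fM] := badd_bound bf; exists (complex.Re `|k| * M) => x.
rewrite nrmZ -mulrA ler_wpM2l //.
by rewrite -ler0c RRe_real // ger0_real.
Qed.

Lemma badd_opp (f : V -> W) : badd f -> badd (fun x => - f x).
Proof.
move=> bf; split=> [x y|]; first by rewrite (baddD bf) opprD.
by have [M M0 fM] := badd_bound bf; exists M => x; rewrite nrmN.
Qed.

Lemma badd_bigsum (I : Type) (s : seq I) (F : I -> V -> W) :
  (forall i, badd (F i)) -> badd (fun x => \sum_(i <- s) F i x).
Proof.
move=> bF; elim: s => [|i s IH].
  by under eq_fun do rewrite big_nil; apply: badd_cst0.
by under eq_fun do rewrite big_cons; apply: badd_add.
Qed.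

Lemma badd_contr (f : V -> W) : {morph f : x y / x + y} ->
  (forall x, nrm (f x) <= nrm x) -> badd f.
Proof. by move=> fD f1; split=> //; exists 1 => x; rewrite mul1r. Qed.

End Combinators.

Section Extension.
Context (V : normedModType R[i]) (W : completeNormedModType R[i]).

Inductive linspan (G : V -> W -> Prop) : V -> W -> Prop :=
  | linspan0 : linspan G 0 0
  | linspanD k v w v' w' : G v w -> linspan G v' w' ->
      linspan G (k *: v + v') (k *: w + w').

Lemma linspan1 G v w : G v w -> linspan G v w.
Proof.
move=> Gvw; rewrite -[v]scale1r -[v in linspan _ v]addr0 -[w]scale1r.
by rewrite -[1 *: w]addr0; apply: linspanD => //; apply: linspan0.
Qed.

Lemma linspan_lin G k v w v' w' : linspan G v w -> linspan G v' w' ->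
  linspan G (k *: v + v') (k *: w + w').
Proof.
elim=> [|l a b a' b' Gab _ IH] H; first by rewrite !scaler0 !add0r.
by rewrite !scalerDr !scalerA -!addrA; apply: linspanD => //; apply: IH.
Qed.

(** Maps are given by their values on generators, as a linear relation.
    Contractivity makes these values consistent, a pair with first component
    [0] having second component [0], and by completeness the map extends to the
    closure of its domain. *)
Lemma contraction_extension (Gr : V -> W -> Prop) :
  (forall k v w v' w', Gr v w -> Gr v' w' ->
     Gr (k *: v + v') (k *: w + w')) ->
  (forall v w, Gr v w -> nrm w <= nrm v) ->
  ndense [set v | exists w, Gr v w] ->
  exists F : V -> W,
    [/\ forall k x y, F (k *: x + y) = k *: F x + F y,
        forall x, nrm (F x) <= nrm x &
        forall v w, Gr v w -> F v = w].
Proof.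
move=> Glin Gcontr Gdense.
have GB v w v' w' : Gr v w -> Gr v' w' -> Gr (v - v') (w - w').
  by move=> G1 G2; have := Glin (-1) _ _ _ _ G2 G1; rewrite !scaleN1r ![- _ + _]addrC.
pose Lim v l := forall e, 0 < e ->
  exists v' w', [/\ Gr v' w', nrm (v - v') <= e & nrm (l - w') <= e].
have small (e : R) : 0 < e -> exists N, forall n, (N <= n)%N -> 2 / n.+1%:R <= e.
  move=> e0; exists (Num.bound (2 / e)) => n Nn.
  rewrite ler_pdivrMr // mulrC -ler_pdivrMr //.
  apply: le_trans (ltW (archi_boundP _)) _; first by rewrite divr_ge0 // ltW.
  by rewrite ler_nat (leq_trans Nn).
have exL v : exists l, Lim v l.
  have /choice[u uP] : forall n : nat, exists p : V * W,
      Gr p.1 p.2 /\ nrm (v - p.1) <= 1 / n.+1%:R.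
    move=> n; have [|v' [w' G'] vv'] := Gdense v (1 / n.+1%:R); first by [].
    by exists (v', w').
  have cu m n : (m <= n)%N -> nrm ((u m).2 - (u n).2) <= 2 / m.+1%:R.
    move=> mn; have [Gm vm] := uP m; have [Gn vn] := uP n.
    apply: le_trans (Gcontr _ _ (GB _ _ _ _ Gm Gn)) _.
    apply: le_trans (nrm_dist _ v _) _; rewrite nrmBC.
    rewrite (_ : 2 / _ = 1 / m.+1%:R + 1 / m.+1%:R); last by rewrite -mulrDl.
    apply: lerD => //; apply: le_trans vn _.
    by rewrite !div1r lef_pV2 ?posrE // ler_nat.
  have [l ul] := ncauchy_limit small cu.
  exists l => e e0; have [N Ne] := small _ e0.
  exists (u N).1, (u N).2; have [GN vN] := uP N; split=> //.
    apply: le_trans vN _; apply: le_trans (Ne N (leqnn _)).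
    by rewrite ler_pM2r // ler1n.
  by rewrite nrmBC; apply: le_trans (ul N) (Ne N (leqnn _)).
have Luniq v l l' : Lim v l -> Lim v l' -> l = l'.
  move=> L L'; apply/subr0_eq/nrm_limit0 => e e0.
  have e40 : 0 < e / 4 by rewrite divr_gt0.
  have [a [b [Gab va lb]]] := L _ e40; have [c [d [Gcd vc ld]]] := L' _ e40.
  have bd := Gcontr _ _ (GB _ _ _ _ Gab Gcd).
  have := nrm_dist l b l'; have := nrm_dist b d l'; have := nrm_dist a v c.
  by rewrite (nrmBC a v) (nrmBC d l'); lra.
have /choice[F FL] := exL.
exists F; split.
- move=> k x y; apply: (Luniq (k *: x + y)) => // e e0.
  set K := complex.Re `|k|.
  have K0 : 0 <= K by rewrite -ler0c RRe_real // ger0_real.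
  have d0 : 0 < e / (K + 1) by rewrite divr_gt0 // ltr_wpDl.
  have [a [b [Gab va lb]]] := FL x _ d0; have [c [d [Gcd vc ld]]] := FL y _ d0.
  exists (k *: a + c), (k *: b + d); split; first exact: Glin.
  + have -> : k *: x + y - (k *: a + c) = k *: (x - a) + (y - c) by lincomb.
    apply: le_trans (nrmD _ _) _; rewrite nrmZ -/K.
    apply: le_trans (lerD (ler_wpM2l K0 va) vc) _.
    by rewrite -[X in _ + X]mul1r -mulrDl mulrC divfK // gt_eqF // ltr_wpDl.
  + have -> : k *: F x + F y - (k *: b + d) = k *: (F x - b) + (F y - d).
      by lincomb.
    apply: le_trans (nrmD _ _) _; rewrite nrmZ -/K.
    apply: le_trans (lerD (ler_wpM2l K0 lb) ld) _.
    by rewrite -[X in _ + X]mul1r -mulrDl mulrC divfK // gt_eqF // ltr_wpDl.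
- move=> x; apply/ler_addgt0Pr => e e0.
  have [a [b [Gab va lb]]] := FL x _ (divr_gt0 e0 (ltr0n _ 2)).
  have := Gcontr _ _ Gab; have := nrm_dist (F x) b 0; have := nrm_dist a x 0.
  by rewrite (nrmBC a x) !subr0; lra.
- move=> v w Gvw; apply: (Luniq v) => // e e0.
  by exists v, w; rewrite !subrr !nrm0 ltW.
Qed.

(** A Cauchy sequence of images lifts to a Cauchy sequence in [S]. *)
Lemma closed_image_below (f : W -> V) (S : set W) : badd f -> closed S ->
  (forall x y, S x -> S y -> S (x - y)) ->
  (forall x, S x -> nrm x <= nrm (f x)) -> closed (f @` S).
Proof.
move=> bf cS SB below; apply: closed_of_limit => y Hy.
have /choice[u uP] : forall m : nat, exists x, S x /\ nrm (y - f x) <= 1 / m.+1%:R.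
  move=> m; have [|_ [x Sx <-] yx] := Hy (1 / m.+1%:R); first by [].
  by exists x.
have [|m k mk|l ul] := @ncauchy_limit R W u (fun m => 2 / m.+1%:R).
- move=> e e0; exists (Num.bound (2 / e)) => m Nm.
  rewrite ler_pdivrMr // mulrC -ler_pdivrMr //.
  apply: le_trans (ltW (archi_boundP _)) _; first by rewrite divr_ge0 // ltW.
  by rewrite ler_nat (leq_trans Nm).
- have [Sm ym] := uP m; have [Sk yk] := uP k.
  apply: le_trans (below _ (SB _ _ Sm Sk)) _; rewrite (baddB bf).
  apply: le_trans (nrm_dist _ y _) _; rewrite nrmBC.
  rewrite (_ : 2 / _ = 1 / m.+1%:R + 1 / m.+1%:R); last by rewrite -mulrDl.
  apply: lerD => //; apply: le_trans yk _.
  by rewrite !div1r lef_pV2 ?posrE // ler_nat.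
have small (e : R) : 0 < e -> exists m : nat, 2 / m.+1%:R <= e.
  move=> e0; exists (Num.bound (2 / e)).
  rewrite ler_pdivrMr // mulrC -ler_pdivrMr //.
  apply: le_trans (ltW (archi_boundP _)) _; first by rewrite divr_ge0 // ltW.
  by rewrite ler_nat.
have Sl : S l.
  apply: (closed_limit cS) => e e0; have [m me] := small e e0.
  exists (u m); first by case: (uP m).
  by rewrite nrmBC; apply: le_trans (ul m) me.
exists l => //; apply/esym/subr0_eq/nrm_limit0 => e e0.
have [M M0 fM] := badd_bound bf.
have [m me] := small (e / (M + 1)) (divr_gt0 e0 (addr_gt0 M0 ltr01)).
apply: le_trans (nrm_dist _ (f (u m)) _) _.
rewrite -(baddB bf); have [_ ym] := uP m.
apply: le_trans (lerD ym (fM _)) _.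
apply: le_trans (lerD (_ : _ <= 2 / m.+1%:R) (ler_wpM2l (ltW M0) (ul m))) _.
  by rewrite ler_pM2r // ler1n.
move: me; rewrite ler_pdivlMr ?addr_gt0 //; set d := 2 / _ => me.
by apply: le_trans me; rewrite mulrDr mulr1 addrC mulrC.
Qed.

End Extension.
End BoundedAdditive.

(** * C*-algebras *)

Section CStarBasics.
Context (R : realType) (A : cstarAlgType R).
Implicit Types (x y z : A) (r : R).

Lemma amul0l x : 0 ** x = 0.
Proof. by apply: (@addIr _ (0 ** x)); rewrite -amulDl !add0r. Qed.
Lemma amul0r x : x ** 0 = 0.
Proof. by apply: (@addIr _ (x ** 0)); rewrite -amulDr !add0r. Qed.
Lemma amulNl x y : (- x) ** y = - (x ** y).
Proof. by apply: (@addIr _ (x ** y)); rewrite -amulDl !addNr amul0l. Qed.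
Lemma amulNr x y : x ** (- y) = - (x ** y).
Proof. by apply: (@addIr _ (x ** y)); rewrite -amulDr !addNr amul0r. Qed.
Lemma star0 : star 0 = 0 :> A.
Proof. by apply: (@addIr _ (star 0)); rewrite -starD !add0r. Qed.
Lemma starN x : star (- x) = - star x.
Proof. by apply: (@addIr _ (star x)); rewrite -starD !addNr star0. Qed.
Lemma starZr r x : star (r%:C *: x) = r%:C *: star x.
Proof. by rewrite starZ conj_Creal // complex_real. Qed.
Lemma starZi x : star ('i%C *: x) = - ('i%C *: star x).
Proof.
rewrite starZ -scaleNr; congr (_ *: _).
by rewrite [LHS](_ : _ = conjc 'i%C) //; apply/eqP; rewrite eq_complex /= oppr0 !eqxx.
Qed.

Definition amulE := (@amulDl R A, @amulDr R A, amulNl, amulNr, @amulZl R A,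
  @amulZr R A, amul0l, amul0r, @amulA R A).
Definition starE := (@starD R A, starN, starZr, starZi, @starM R A, @starK R A, star0).

Lemma nrm_amul x y : nrm (x ** y) <= nrm x * nrm y.
Proof. by rewrite -lecR rmorphM /= -!nrmE norm_amul. Qed.

Lemma nrm_star_amul x : nrm (star x ** x) = nrm x ^+ 2.
Proof. by apply: complexI; rewrite rmorphXn /= -!nrmE norm_star_amul. Qed.

Lemma nrm_star x : nrm (star x) = nrm x.
Proof.
have H y : nrm y <= nrm (star y).
  have [y0|] := boolP (0 < nrm y); last first.
    by rewrite -leNgt => y0; apply: le_trans y0 (nrm_ge0 _).
  by rewrite -(ler_pM2r y0) -expr2 -nrm_star_amul nrm_amul.
by apply/le_anti; rewrite H -{2}[x]starK H.
Qed.

Lemma nrm_amul_star x : nrm (x ** star x) = nrm x ^+ 2.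
Proof. by have := nrm_star_amul (star x); rewrite starK nrm_star. Qed.

Lemma star_amul_eq0 x : star x ** x = 0 -> x = 0.
Proof.
move=> x0; apply: nrm0_eq0; apply/eqP; rewrite -sqrf_eq0 -nrm_star_amul x0.
by rewrite nrm0.
Qed.

Lemma selfadj_sq_eq0 x : star x = x -> x ** x = 0 -> x = 0.
Proof. by move=> sx; rewrite -{1}sx; apply: star_amul_eq0. Qed.

Lemma badd_amull a : badd (fun x => a ** x).
Proof. by split=> [x y|]; [rewrite amulDr | exists (nrm a) => x; rewrite nrm_amul]. Qed.
Lemma badd_amulr a : badd (fun x => x ** a).
Proof.
split=> [x y|]; first by rewrite amulDl.
by exists (nrm a) => x; rewrite mulrC nrm_amul.
Qed.
Lemma badd_star : badd (@star R A).
Proof. by apply: badd_contr => [x y|x]; rewrite ?starD ?nrm_star. Qed.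

Lemma amul_suml (I : Type) (s : seq I) (F : I -> A) x :
  (\sum_(i <- s) F i) ** x = \sum_(i <- s) F i ** x.
Proof. exact: (badd_sum (badd_amulr x)). Qed.
Lemma amul_sumr (I : Type) (s : seq I) (F : I -> A) x :
  x ** (\sum_(i <- s) F i) = \sum_(i <- s) x ** F i.
Proof. exact: (badd_sum (badd_amull x)). Qed.
Lemma star_sum (I : Type) (s : seq I) (F : I -> A) :
  star (\sum_(i <- s) F i) = \sum_(i <- s) star (F i).
Proof. exact: (badd_sum badd_star). Qed.

Lemma nrm_amul_le x y (a b : R) :
  nrm x <= a -> nrm y <= b -> nrm (x ** y) <= a * b.
Proof. by move=> xa yb; apply: le_trans (nrm_amul _ _) _; apply: ler_pM; rewrite ?nrm_ge0. Qed.

(** In an algebra without unit, an inequality between [a] and a scalar is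
    expressed by letting [a] act by left multiplication. *)
Lemma nrm_le_act x M : 0 <= M -> (forall z, nrm (x ** z) <= M * nrm z) ->
  nrm x <= M.
Proof.
move=> M0 /(_ (star x)); rewrite nrm_amul_star nrm_star expr2.
have [x0|] := boolP (0 < nrm x); first by rewrite ler_pM2r.
by rewrite -leNgt => x0 _; apply: le_trans x0 M0.
Qed.

End CStarBasics.

(** * Square roots and positivity *)

Lemma le0_harmonic (R : realType) (x C : R) :
  (forall N : nat, x <= C / N.+2%:R) -> x <= 0.
Proof.
move=> H; rewrite leNgt; apply/negP => x0.
have C0 : 0 <= C.
  by have := le_trans (ltW x0) (H 0); rewrite pmulr_lge0 ?invr_gt0.
have := H (Num.bound (C / x)); rewrite leNgt ltr_pdivrMr // mulrC => /negP; apply.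
rewrite -ltr_pdivrMr //; apply: lt_trans (archi_boundP _) _.
  by rewrite divr_ge0 // ltW.
by rewrite ltr_nat.
Qed.

Lemma zero01 (R : realType) : 0 <= (0 : R) <= 1.
Proof. by rewrite lexx ler01. Qed.

Lemma one01 (R : realType) : 0 <= (1 : R) <= 1.
Proof. by rewrite lexx ler01. Qed.

Section SquareRootIteration.
Context (R : realType) (A : cstarAlgType R).
Implicit Types (x y z a b w : A) (r : R).

(** In terms of [h = 1 - r - w] and [d = 1 - r^2 - a], the equation
    [(r + w)^2 = r^2 + a] in the unitization becomes the fixed point equation
    [h = (d + h^2) / 2], where [d] is assumed to be a contraction. The iterates
    [h_n = s_n - w_n] started at [0] have their scalar part [s_n] given by [sqs]
    and the rest [w_n] by [sqw]. Their increments are dominated by those of the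
    scalar equation with [d = 1], whose iterates [sqs 0 n] converge to [1]; this
    gives convergence even if [d] has norm [1]. The values [r = 0] (square root
    of [a]) and [r = 1] (square root of [1 + a]) are the main cases. *)
Fixpoint sqs r (n : nat) : R :=
  if n is n'.+1 then (1 - r ^+ 2 + sqs r n' ^+ 2) / 2 else 0.

Fixpoint sqw r a (n : nat) : A :=
  if n is n'.+1 then
    2^-1%:C *: (a + (2 * sqs r n')%:C *: sqw r a n' - sqw r a n' ** sqw r a n')
  else 0.

Lemma sqs_ge0 r n : 0 <= r <= 1 -> 0 <= sqs r n.
Proof.
move=> /andP[r0 r1]; case: n => //= n; rewrite divr_ge0 // addr_ge0 ?sqr_ge0 //.
by rewrite subr_ge0 expr_le1.
Qed.

(** The error [d = 1 - r - s_n] satisfies [d' = d (1 - r - d / 2)], and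
    [d (1 - d / 2)] increases with [d] when [0 <= d <= 1]. *)
Lemma sqs_limit r n : 0 <= r <= 1 ->
  0 <= 1 - r - sqs r n <= 2 / n.+2%:R.
Proof.
move=> r01; have /andP[r0 r1] := r01; elim: n => [|n /andP[IH0 IH1]] /=.
  by rewrite subr0 subr_ge0 r1 divff //= gerBl.
have s0 := sqs_ge0 n r01; set s := sqs r n in IH0 IH1 s0 *.
set d := 1 - r - s in IH0 IH1.
have -> : 1 - r - (1 - r ^+ 2 + s ^+ 2) / 2 = d * (1 - r - d / 2).
  by rewrite /d; field.
have d1 : d <= 1 - r by rewrite /d gerBl.
apply/andP; split; first by apply: mulr_ge0 => //; lra.
apply: le_trans (_ : d * (1 - d / 2) <= _).
  by apply: ler_wpM2l => //; lra.
set m : R := n.+2%:R in IH1 *.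
have -> : n.+3%:R = m + 1 by rewrite /m -natr1.
have m2 : 2 <= m by rewrite /m ler_nat.
have m0 : 0 < m by lra.
rewrite ler_pdivlMr; last by lra.
move: IH1; rewrite ler_pdivlMr // => IH1.
have : d * m * (2 - d) <= 2 * (2 - d) by apply: ler_wpM2r => //; lra.
nra.
Qed.

Lemma sqs_step r n : 0 <= r <= 1 ->
  [/\ 0 <= sqs r n <= sqs 0 n, sqs r n <= sqs r n.+1 &
      sqs r n.+1 - sqs r n <= sqs 0 n.+1 - sqs 0 n].
Proof.
move=> r01; have /andP[r0 r1] := r01.
have r2 : 0 <= r ^+ 2 <= 1 by rewrite sqr_ge0 expr_le1.
elim: n => [|n [/andP[s0 sS] s1 s2]].
  by rewrite /= lexx; split=> //; move: r2 => /andP[]; rewrite !expr0n /=; lra.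
have t0 := sqs_ge0 n.+1 r01.
have tS : sqs r n.+1 <= sqs 0 n.+1 by lra.
have E q m : sqs q m.+2 - sqs q m.+1 =
    (sqs q m.+1 + sqs q m) * (sqs q m.+1 - sqs q m) / 2.
  by rewrite /=; field.
split; first by rewrite t0 tS.
- by rewrite -subr_ge0 E divr_ge0 // mulr_ge0 ?subr_ge0 // addr_ge0.
- rewrite !E ler_pM2r ?invr_gt0 //; apply: ler_pM => //; last by lra.
  + by rewrite addr_ge0.
  + by rewrite subr_ge0.
Qed.

(** The rate comes from [1 - sqs 0 n <= 2 / (n + 2)], which bounds both the
    scalar part and the rest. *)
Definition is_sqlim r a w := forall n, nrm (sqw r a n - w) <= 4 / n.+2%:R.

Section Convergence.
Variables (r : R) (a : A).
Hypothesis r01 : 0 <= r <= 1.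
Hypothesis a1 : forall z, nrm ((1 - r ^+ 2)%:C *: z - a ** z) <= nrm z.

Let h n z := (sqs r n)%:C *: z - sqw r a n ** z.

Let hS n z : h n.+1 z = 2^-1%:C *: ((1 - r ^+ 2)%:C *: z - a ** z + h n (h n z)).
Proof. by rewrite /h /= !amulE; lincomb; field. Qed.

Let h_nrm n z : nrm (h n z) <= sqs 0 n * nrm z.
Proof.
elim: n z => [|n IH] z; first by rewrite /h /= amul0l scale0r subrr nrm0 mul0r.
rewrite hS nrmZr_ge0 ?invr_ge0 //=; set S := sqs 0 n in IH *.
have S0 : 0 <= S by exact: sqs_ge0 n (zero01 R).
have := nrmD ((1 - r ^+ 2)%:C *: z - a ** z) (h n (h n z)).
have := a1 z; have := IH (h n z); have := ler_wpM2l S0 (IH z).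
by rewrite expr0n /=; lra.
Qed.

Let h_step n z : nrm (h n.+1 z - h n z) <= (sqs 0 n.+1 - sqs 0 n) * nrm z.
Proof.
elim: n z => [|n IH] z.
  have := h_nrm 1 z; rewrite [h 0 z](_ : _ = 0) ?subr0 //.
  by rewrite /h /= amul0l scale0r subrr.
have hD m x y : h m (x - y) = h m x - h m y.
  by rewrite /h !amulE; lincomb.
have -> : h n.+2 z - h n.+1 z =
    2^-1%:C *: (h n.+1 (h n.+1 z - h n z) + (h n.+1 (h n z) - h n (h n z))).
  by rewrite hD !(hS n.+1) (hS n z); set u := h n z; set v := h n.+1 _; lincomb.
rewrite nrmZr_ge0 ?invr_ge0 //.
have S0 := sqs_ge0 n.+1 (zero01 R).
have [/andP[T0 _] _ _] := sqs_step n r01.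
have := nrmD (h n.+1 (h n.+1 z - h n z)) (h n.+1 (h n z) - h n (h n z)).
have := IH (h n z); have := h_nrm n.+1 (h n.+1 z - h n z).
have := ler_wpM2l S0 (IH z).
have D0 : 0 <= sqs 0 n.+1 - sqs 0 n.
  have [_ + _] := sqs_step n (zero01 R).
  by rewrite subr_ge0.
have := ler_wpM2l D0 (h_nrm n z).
have -> : sqs 0 n.+2 - sqs 0 n.+1 =
    (sqs 0 n.+1 + sqs 0 n) * (sqs 0 n.+1 - sqs 0 n) / 2 by rewrite /=; field.
by lra.
Qed.

Let w_step n : nrm (sqw r a n.+1 - sqw r a n) <= 2 * (sqs 0 n.+1 - sqs 0 n).
Proof.
have [_ s1 s2] := sqs_step n r01.
apply: nrm_le_act => [|z]; first by lra.
have -> : (sqw r a n.+1 - sqw r a n) ** z =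
    (sqs r n.+1 - sqs r n)%:C *: z - (h n.+1 z - h n z).
  by rewrite /h amulDl amulNl; lincomb.
apply: le_trans (nrmB _ _) _; rewrite nrmZr_ge0 ?subr_ge0 //.
have := h_step n z; have := ler_wpM2r (nrm_ge0 z) s2.
by lra.
Qed.

Lemma sqlim_exists : exists w, is_sqlim r a w.
Proof.
apply: (@ncauchy_limit R A (sqw r a) (fun n => 4 / n.+2%:R)).
  move=> e e0; exists (Num.bound (4 / e)) => n Nn.
  rewrite ler_pdivrMr // mulrC -ler_pdivrMr //.
  apply: le_trans (ltW (archi_boundP _)) _; first by rewrite divr_ge0 // ltW.
  by rewrite ler_nat (leq_trans Nn) // -addn2 leq_addr.
move=> m n mn; apply: (@le_trans _ _ (2 * (sqs 0 n - sqs 0 m))).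
  rewrite nrmBC; elim: n mn => [|n IH].
    by rewrite leqn0 => /eqP ->; rewrite !subrr nrm0 mulr0.
  rewrite leq_eqVlt => /orP[/eqP ->|]; first by rewrite !subrr nrm0 mulr0.
  rewrite ltnS => /IH {}IH; apply: le_trans (nrm_dist _ (sqw r a n) _) _.
  apply: le_trans (lerD (w_step n) IH) _.
  by rewrite -mulrDr addrA subrK.
have /andP[] := sqs_limit n (zero01 R); have /andP[] := sqs_limit m (zero01 R).
rewrite !subr0; move: (sqs 0 n) (sqs 0 m) (m.+2%:R^-1) (n.+2%:R^-1) => sn sm im i_n.
by lra.
Qed.

Lemma sqlim_act w : is_sqlim r a w ->
  forall z, nrm ((1 - r)%:C *: z - w ** z) <= nrm z.
Proof.
move=> wl z; rewrite -subr_le0; apply: (@le0_harmonic _ _ (6 * nrm z)) => n.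
have /andP[t0 t1] := sqs_limit n r01.
have /andP[] := sqs_limit n (zero01 R); rewrite subr0 subr_ge0 => S1 _.
have -> : (1 - r)%:C *: z - w ** z =
    h n z + (1 - r - sqs r n)%:C *: z + (sqw r a n - w) ** z.
  by rewrite /h amulDl amulNl; lincomb.
have -> : 6 * nrm z / n.+2%:R = 2 / n.+2%:R * nrm z + 4 / n.+2%:R * nrm z.
  by move: (n.+2%:R^-1) => i; ring.
rewrite lerBlDl addrA; apply: nrmD_le; last exact: nrm_amul_le (wl n) (lexx _).
apply: nrmD_le; last by rewrite nrmZr_ge0 // ler_wpM2r ?nrm_ge0.
by apply: le_trans (h_nrm _ _) _; rewrite -[leRHS]mul1r ler_wpM2r ?nrm_ge0.
Qed.

End Convergence.

Section Limit.
Variables (r : R) (a w : A).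
Hypothesis r01 : 0 <= r <= 1.
Hypothesis wlim : is_sqlim r a w.

(** The iteration only forms squares and real combinations, so [P] can be the
    self-adjoint part, which is not stable under products. *)
Lemma sqlim_in (P : set A) : closed P -> P 0 -> P a ->
  (forall k x y, P x -> P y -> P (k%:C *: x + y)) ->
  (forall x, P x -> P (x ** x)) -> P w.
Proof.
move=> cP P0 Pa Plin Psq.
have Pw n : P (sqw r a n).
  have PZ k x : P x -> P (k%:C *: x).
    by move=> Px; rewrite -[_ *: _]addr0; apply: Plin.
  elim: n => //= n IH; apply: PZ; rewrite -addrA addrC.
  rewrite -[X in P (_ + X)]scale1r.
  have -> : (2 * sqs r n)%:C *: sqw r a n - sqw r a n ** sqw r a n + 1 *: a =
     (2 * sqs r n)%:C *: sqw r a n +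
     ((-1)%:C *: (sqw r a n ** sqw r a n) + a) by lincomb.
  exact: (Plin _ _ _ IH (Plin _ _ _ (Psq _ IH) Pa)).
apply: (closed_limit cP) => e e0; exists (sqw r a (Num.bound (4 / e))) => //.
rewrite nrmBC; apply: le_trans (wlim _) _.
rewrite ler_pdivrMr // mulrC -ler_pdivrMr //.
apply: le_trans (ltW (archi_boundP _)) _; first by rewrite divr_ge0 // ltW.
by rewrite ler_nat ltnW // leqnSn.
Qed.

Lemma sqlim_selfadj : star a = a -> star w = w.
Proof.
move=> sa; apply: (sqlim_in (P := [set x | star x = x])) => //=.
- exact: (badd_closed_eq (badd_star A) (badd_id A)).
- exact: star0.
- by move=> k x y /= sx sy; rewrite !starE sx sy.
- by move=> x /= sx; rewrite !starE sx.
Qed.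

Lemma sqlim_eq : (2 * r)%:C *: w + w ** w = a.
Proof.
apply/subr0_eq/nrm_le0.
apply: (@le0_harmonic _ _ (4 * (6 + 4 * nrm w))) => n.
have /andP[r0 r1] := r01; have /andP[t0 t1] := sqs_limit n r01; set s := sqs r n in t0 t1.
pose d := 4 / (n.+2%:R : R).
have d2 : d <= 2 by rewrite /d ler_pdivrMr // -natrM ler_nat mulnC.
have dE : 2 / n.+2%:R = d / 2 by rewrite /d; field.
have d0 : 0 <= d by rewrite /d divr_ge0.
have -> : 4 * (6 + 4 * nrm w) / n.+2%:R = d * (6 + 4 * nrm w).
  by rewrite /d mulrAC.
have e1 := wlim n.+1; have e0 : nrm (sqw r a n - w) <= d by apply: wlim.
have {}e1 : nrm (sqw r a n.+1 - w) <= d.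
  apply: le_trans e1 _; rewrite /d ler_pM2l // lef_pV2 ?posrE // ler_nat.
  by rewrite ltnS.
pose e := sqw r a n - w.
have we : sqw r a n = w + e by rewrite /e addrC subrK.
have -> : (2 * r)%:C *: w + w ** w - a =
   (-2)%:C *: (sqw r a n.+1 - w) + (2 * s)%:C *: e
   + (2 * (s - (1 - r)))%:C *: w - w ** e - e ** w - e ** e.
  by rewrite /= -/s we !amulE; lincomb; field.
have s1 : 0 <= s by apply: sqs_ge0.
have s2 : s <= 1 by lra.
have -> : d * (6 + 4 * nrm w) = 2 * d + 2 * d + d * nrm w + nrm w * d +
    d * nrm w + 2 * d + d * nrm w by ring.
apply: le_trans (_ : 2 * d + 2 * d + d * nrm w + nrm w * d + d * nrm w + 2 * d <= _).
  apply: nrmB_le; [apply: nrmB_le; [apply: nrmB_le; [apply: nrmD_le;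
    [apply: nrmD_le|]|]|]|].
  - by rewrite nrmZr normrN ger0_norm // ler_pM2l.
  - rewrite nrmZr_ge0 ?mulr_ge0 // -mulrA ler_pM2l //.
    by apply: le_trans (_ : 1 * d <= _); [apply: ler_pM; rewrite ?nrm_ge0|rewrite mul1r].
  - by rewrite dE in t1; rewrite nrmZr ler_wpM2r ?nrm_ge0 // ler0_norm; lra.
  - exact: nrm_amul_le.
  - exact: nrm_amul_le.
  - apply: le_trans (nrm_amul_le e0 e0) _; exact: ler_wpM2r.
by rewrite lerDl mulr_ge0 ?nrm_ge0.
Qed.

Lemma sqlim_intertwine a' w' y : is_sqlim r a' w' -> a ** y = y ** a' ->
  w ** y = y ** w'.
Proof.
move=> wlim' ay.
have wy n : sqw r a n ** y = y ** sqw r a' n.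
  elim: n => [|n IH] /=; first by rewrite amul0l amul0r.
  rewrite !amulE ay IH -!amulA IH; congr (_ *: _).
  by rewrite [X in _ - X = _]amulA IH !amulA.
apply/subr0_eq/nrm_le0.
apply: (@le0_harmonic _ _ (8 * nrm y)) => n.
have -> : w ** y - y ** w' = y ** (sqw r a' n - w') - (sqw r a n - w) ** y.
  by rewrite !amulE wy; lincomb.
have -> : 8 * nrm y / n.+2%:R = nrm y * (4 / n.+2%:R) + (4 / n.+2%:R) * nrm y.
  by move: (n.+2%:R^-1) => i; ring.
apply: nrmB_le; first exact: nrm_amul_le (lexx _) (wlim' n).
exact: nrm_amul_le (wlim n) (lexx _).
Qed.

End Limit.
End SquareRootIteration.

Section Positivity.
Context (R : realType) (A : cstarAlgType R).
Implicit Types (x y z a b w : A) (r M : R).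

(** [u + i v] acts like a unitary when [u^* v] is self-adjoint; the bounds hold
    because [u] and [v] are averages of [u + i v] and [u - i v]. *)
Lemma unitary_parts u v z : star u ** v = star v ** u ->
  star u ** u + star v ** v = star z ** z ->
  nrm u <= nrm z /\ nrm v <= nrm z.
Proof.
move=> uv uu.
have H v' : star u ** v' = star v' ** u -> star v' ** v' = star v ** v ->
    nrm (u + 'i%C *: v') = nrm z.
  move=> uv' vv'; apply/eqP; rewrite -(@eqrXn2 _ 2) ?nrm_ge0 //.
  rewrite -!nrm_star_amul -uu -vv' !starE !amulE uv'; apply/eqP; congr nrm.
  rewrite !scalerA -expr2 sqr_i.
  by lincomb.
have p1 : nrm (u + 'i%C *: v) = nrm z by apply: H.
have p2 : nrm (u - 'i%C *: v) = nrm z.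
  by rewrite -scalerN; apply: H; rewrite !starE !amulE ?opprK // uv.
have := nrmD (u + 'i%C *: v) (u - 'i%C *: v).
have := nrmB (u + 'i%C *: v) (u - 'i%C *: v).
have -> : u + 'i%C *: v + (u - 'i%C *: v) = 2%:C *: u by lincomb.
have -> : u + 'i%C *: v - (u - 'i%C *: v) = 'i%C *: (2%:C *: v) by lincomb.
rewrite p1 p2 nrmZ !nrmZr_ge0 // normc_def /= expr0n expr1n add0r sqrtr1.
by lra.
Qed.

(** The equation says [b^2 + (1 + w)^2 = 1]. *)
Lemma selfadj_circle b w z : star b = b -> star w = w -> b ** w = w ** b ->
  2%:C *: w + w ** w = - (b ** b) ->
  nrm (b ** z) <= nrm z /\ nrm (z + w ** z) <= nrm z.
Proof.
move=> sb sw bw ww; apply: unitary_parts.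
  rewrite !starE !amulE sb sw -[_ ** b ** w]amulA bw !amulA.
  by lincomb.
have {}ww : w ** w = - (b ** b) - 2%:C *: w by rewrite -ww addrC addKr.
rewrite !starE !amulE sb sw -[star z ** w ** w]amulA ww !amulE.
by lincomb.
Qed.

Definition actpos M a := forall z, nrm (M%:C *: z - a ** z) <= M * nrm z.

(** For a self-adjoint [a], positivity means [|M - a| <= M] in the unitization.
    This form makes sums of positive elements positive at once, by the triangle
    inequality; the positivity of [x^* x] is then a theorem. *)
Definition pos a := star a = a /\ exists2 M, 0 < M & actpos M a.

Lemma pos_selfadj a : pos a -> star a = a. Proof. by case. Qed.

Lemma pos0 : pos 0.
Proof.
by rewrite /pos star0; split=> //; exists 1 => // z; rewrite amul0l subr0 nrmZr_ge0.
Qed.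

Lemma posD a b : pos a -> pos b -> pos (a + b).
Proof.
move=> [sa [M M0 aM]] [sb [N N0 bN]]; split; first by rewrite starD sa sb.
exists (M + N) => [|z]; first exact: addr_gt0.
have -> : (M + N)%:C *: z - (a + b) ** z =
    (M%:C *: z - a ** z) + (N%:C *: z - b ** z) by rewrite amulDl; lincomb.
by rewrite mulrDl; apply: nrmD_le.
Qed.

Lemma posZ r a : 0 <= r -> pos a -> pos (r%:C *: a).
Proof.
move=> r0 [sa [M M0 aM]]; split; first by rewrite starZr sa.
move: r0; rewrite le_eqVlt => /orP[/eqP <-|r0].
  by rewrite scale0r; have [] := pos0.
exists (r * M) => [|z]; first exact: mulr_gt0.
have -> : (r * M)%:C *: z - (r%:C *: a) ** z = r%:C *: (M%:C *: z - a ** z).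
  by rewrite amulZl; lincomb.
by rewrite nrmZr_gt0 // -mulrA ler_pM2l.
Qed.

Lemma pos_sum (I : Type) (s : seq I) (F : I -> A) :
  (forall i, pos (F i)) -> pos (\sum_(i <- s) F i).
Proof.
by move=> Fp; elim/big_rec: _ => [|i x _]; [apply: pos0 | apply: posD].
Qed.

(** The square of a self-adjoint contraction [b] is positive: there is [w] with
    [(1 + w)^2 = 1 - b^2], and [b + i (1 + w)] is unitary. *)
Lemma actpos_sq b M : star b = b -> 0 < M -> nrm b ^+ 2 <= M ->
  actpos M (b ** b).
Proof.
move=> sb M0 bM.
pose c := (Num.sqrt M)^-1%:C *: b.
have sM : Num.sqrt M != 0 by rewrite gt_eqF // sqrtr_gt0.
have sM2 : Num.sqrt M * Num.sqrt M = M by rewrite -expr2 sqr_sqrtr // ltW.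
have sc : star c = c by rewrite /c starZr sb.
have bb : b ** b = M%:C *: (c ** c).
  rewrite /c !amulE !scalerA -!rmorphM /= -{1}sM2 -mulrA mulVKf // mulfV //.
  by rewrite scale1r.
have c1 : nrm (c ** c) <= 1.
  by rewrite -(ler_pM2l M0) -nrmZr_gt0 // -bb mulr1 (le_trans (nrm_amul _ _)) // -expr2.
have [|w wl] := @sqlim_exists R A 1 (- (c ** c)) (one01 R).
  move=> z; rewrite expr1n subrr scale0r sub0r amulNl opprK.
  by apply: le_trans (nrm_amul _ _) _; rewrite -[leRHS]mul1r ler_wpM2r ?nrm_ge0.
have sw : star w = w by apply: (sqlim_selfadj wl); rewrite starN starM sc.
have wc : w ** c = c ** w.
  by apply: (sqlim_intertwine wl wl); rewrite amulNl amulNr amulA.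
have ww := sqlim_eq (one01 R) wl; rewrite mulr1 in ww.
move=> z; rewrite bb amulZl -scalerBr nrmZr_gt0 // ler_pM2l //.
have w1 := (selfadj_circle _ sc sw (esym wc) ww).2.
have -> : z - c ** c ** z = (z + w ** z) + w ** (z + w ** z).
  have -> : c ** c = - (2%:C *: w + w ** w) by rewrite ww opprK.
  by rewrite !amulE; lincomb.
exact: le_trans (w1 _) (w1 _).
Qed.

Lemma pos_sq b : star b = b -> pos (b ** b).
Proof.
move=> sb; split; first by rewrite starM sb.
exists (nrm b ^+ 2 + 1); first by rewrite ltr_wpDl // sqr_ge0.
by apply: actpos_sq => //; [rewrite ltr_wpDl // sqr_ge0 | rewrite lerDl].
Qed.

(** The bound [M] only normalizes [a]; two square roots taken with the same
    bound can be compared by [sqrt_intertwine]. *)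
Definition is_sqrt M a w :=
  0 < M /\ exists2 v, is_sqlim 0 (M^-1%:C *: a) v & w = (Num.sqrt M)%:C *: v.

Lemma sqrt_exists M a : 0 < M -> actpos M a -> exists w, is_sqrt M a w.
Proof.
move=> M0 aM.
have [|v vl] := @sqlim_exists R A 0 (M^-1%:C *: a) (zero01 R).
  move=> z; rewrite expr0n subr0 amulZl.
  have -> : 1%:C *: z - M^-1%:C *: (a ** z) = M^-1%:C *: (M%:C *: z - a ** z).
    by rewrite scalerBr scalerA -rmorphM mulVf // gt_eqF.
  by rewrite nrmZr_gt0 ?invr_gt0 // ler_pdivrMl.
by exists ((Num.sqrt M)%:C *: v); split=> //; exists v.
Qed.

Lemma sqrt_selfadj M a w : is_sqrt M a w -> star a = a -> star w = w.
Proof.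
move=> [M0 [v vl ->]] sa; rewrite starZr (sqlim_selfadj vl) //.
by rewrite starZr sa.
Qed.

Lemma sqrt_eq M a w : is_sqrt M a w -> w ** w = a.
Proof.
move=> [M0 [v vl ->]]; have := sqlim_eq (zero01 R) vl.
rewrite mulr0 scale0r add0r !amulE scalerA -rmorphM /= -expr2 sqr_sqrtr ?ltW //.
by move=> ->; rewrite scalerA -rmorphM /= mulfV ?scale1r // gt_eqF.
Qed.

Lemma sqrt_intertwine M a a' w w' y : is_sqrt M a w -> is_sqrt M a' w' ->
  a ** y = y ** a' -> w ** y = y ** w'.
Proof.
move=> [M0 [v vl ->]] [_ [v' vl' ->]] ay; rewrite !amulE; congr (_ *: _).
by apply: (sqlim_intertwine vl vl'); rewrite !amulE ay.
Qed.

Lemma sqrt_commute M a w y : is_sqrt M a w -> a ** y = y ** a -> w ** y = y ** w.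
Proof. by move=> aw; apply: (sqrt_intertwine aw aw). Qed.

Lemma sqrt_pos M a w : is_sqrt M a w -> star a = a -> actpos M a -> pos w.
Proof.
move=> aw sa aM; split; first exact: sqrt_selfadj aw sa.
have [M0 [v vl ->]] := aw.
have sM : 0 < Num.sqrt M by rewrite sqrtr_gt0.
exists (Num.sqrt M) => // z.
rewrite amulZl -scalerBr nrmZr_gt0 // ler_pM2l //.
rewrite -{1}[z]scale1r -[1](rmorph1 (real_complex R)) -[1 in X in nrm X]subr0.
apply: (sqlim_act (zero01 R) _ vl) => {}z; rewrite expr0n subr0 amulZl.
have -> : 1%:C *: z - M^-1%:C *: (a ** z) = M^-1%:C *: (M%:C *: z - a ** z).
  by rewrite scalerBr scalerA -rmorphM mulVf // gt_eqF.
by rewrite nrmZr_gt0 ?invr_gt0 // ler_pdivrMl.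
Qed.

Lemma pos_sqrt a : pos a -> exists M w, is_sqrt M a w /\ pos w.
Proof.
move=> [sa [M M0 aM]]; have [w aw] := sqrt_exists M0 aM.
by exists M, w; split=> //; apply: sqrt_pos aw sa aM.
Qed.

Lemma pos_conj_commute a b : pos a -> star b = b -> a ** b = b ** a ->
  pos (b ** a ** b).
Proof.
move=> pa sb ab; have [M [w [aw [sw _]]]] := pos_sqrt pa.
have wb := sqrt_commute aw ab.
have -> : b ** a ** b = (w ** b) ** (w ** b).
  by rewrite {1}wb -(sqrt_eq aw) !amulA.
by apply: pos_sq; rewrite starM sw sb.
Qed.

(** If [w^2 = a] and [v^2 = - a], then [(w + i v)^* (w + i v) = 0]. *)
Lemma pos_antisym a : pos a -> pos (- a) -> a = 0.
Proof.
move=> pa pna; have [M [w [aw [sw _]]]] := pos_sqrt pa.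
have [N [v [av [sv _]]]] := pos_sqrt pna.
have wv : w ** v = v ** w.
  apply: (sqrt_commute aw); apply/esym/(sqrt_commute av).
  by rewrite amulNl amulNr -(sqrt_eq aw) -amulA.
have [||w0 _] := @unitary_parts w v 0; first by rewrite sw sv.
  by rewrite sw sv (sqrt_eq aw) (sqrt_eq av) subrr amul0r.
by rewrite -(sqrt_eq aw) (nrm_le0 (x := w)) ?amul0l // (le_trans w0) // nrm0.
Qed.

(** The difference [d = a - w] satisfies [d a d + d w d = d (a^2 - w^2) = 0];
    both terms are positive, so both vanish, and [d^3 = 0]. *)
Lemma sqrt_unique M a w : pos a -> is_sqrt M (a ** a) w -> actpos M (a ** a) ->
  w = a.
Proof.
move=> pa aw aM; have sa := pos_selfadj pa.
have pw : pos w by apply: sqrt_pos aw _ aM; rewrite starM sa.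
have sw := pos_selfadj pw.
have wa : w ** a = a ** w by apply: (sqrt_commute aw); rewrite amulA.
have ww := sqrt_eq aw.
pose d := a - w.
have sd : star d = d by rewrite /d !starE sa sw.
have da : a ** d = d ** a by rewrite /d !amulE wa.
have dw : w ** d = d ** w by rewrite /d !amulE wa.
have p1 := pos_conj_commute pa sd da.
have p2 := pos_conj_commute pw sd dw.
have sum0 : d ** a ** d + d ** w ** d = 0.
  have d0 : d ** (a + w) = 0 by rewrite /d !amulE wa ww; lincomb.
  by rewrite -amulDl -amulDr d0 amul0l.
have dad : d ** a ** d = 0.
  by apply: pos_antisym => //; move/eqP: sum0; rewrite addr_eq0 => /eqP ->; rewrite opprK.
have dwd : d ** w ** d = 0 by move: sum0; rewrite dad add0r.
have ddd : d ** d ** d = 0.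
  have -> : d ** d = d ** a - d ** w by rewrite {2}/d amulDr amulNr.
  by rewrite amulDl amulNl dad dwd subrr.
have dd : d ** d = 0.
  by apply: selfadj_sq_eq0; rewrite ?starM ?sd // amulA ddd amul0l.
by apply/esym/subr0_eq/selfadj_sq_eq0.
Qed.

(** If [y^* y] is negative then [y y^*] is positive, because
    [y^* y + y y^*] is twice the sum of the squares of the real and imaginary
    parts; the intertwining [(y y^* ) y = y (y^* y)] then passes to square roots
    of squares, i.e. to absolute values, with opposite signs on the two sides. *)
Lemma neg_star_amul_eq0 y : pos (- (star y ** y)) -> y = 0.
Proof.
move=> pQ; pose P := y ** star y; pose Q := - (star y ** y).
have pP : pos P.
  pose re := y + star y; pose im := 'i%C *: (y - star y).
  have sre : star re = re by rewrite /re !starE addrC.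
  have sim : star im = im by rewrite /im !starE -scalerN opprB.
  have -> : P = (2^-1)%:C *: (re ** re + im ** im) + Q.
    have -> : im ** im = - ((y - star y) ** (y - star y)).
      by rewrite amulZl amulZr scalerA -expr2 sqr_i scaleN1r.
    by rewrite /P /Q /re !amulE; lincomb; field.
  by apply: posD => //; apply: posZ; rewrite ?invr_ge0 //; apply: posD; apply: pos_sq.
have sP := pos_selfadj pP; have sQ : star Q = Q := pos_selfadj pQ.
have PyQ : P ** y = - (y ** Q) by rewrite /P /Q amulNr opprK amulA.
pose M := nrm P ^+ 2 + nrm Q ^+ 2 + 1.
have M0 : 0 < M by rewrite ltr_wpDl // addr_ge0 // sqr_ge0.
have PM : actpos M (P ** P).
  by apply: actpos_sq => //; rewrite /M -addrA lerDl addr_ge0 // sqr_ge0.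
have QM : actpos M (Q ** Q).
  by apply: actpos_sq => //; rewrite /M addrAC lerDr addr_ge0 // sqr_ge0.
have [w Pw] := sqrt_exists M0 PM; have [v Qv] := sqrt_exists M0 QM.
have := sqrt_intertwine (y := y) Pw Qv.
rewrite (sqrt_unique pP Pw PM) (sqrt_unique pQ Qv QM) PyQ => H.
have /eqP yQ : y ** Q = - (y ** Q).
  apply/esym/H; rewrite -amulA PyQ amulNr amulA PyQ amulNl opprK.
  by rewrite amulA.
rewrite -addr_eq0 -mulr2n -scaler_nat scaler_eq0 pnatr_eq0 /= in yQ.
apply: star_amul_eq0; apply: selfadj_sq_eq0; first by rewrite !starE.
have /eqP := yQ; rewrite /Q amulNr => /eqP; rewrite oppr_eq0 => /eqP yyy.
by rewrite -amulA yyy amul0r.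
Qed.

(** Kelley and Vaught.  With [a = x^* x] and [p = |a|], the element
    [y = x (p - a)] satisfies [y^* y = - p (p - a)^2 <= 0], so [y = 0] and
    [a = p]. *)
Theorem pos_star_amul x : pos (star x ** x).
Proof.
have [a aE] : exists a, star x ** x = a by exists (star x ** x).
rewrite aE.
have sa : star a = a by rewrite -aE !starE.
pose M := nrm a ^+ 2 + 1.
have M0 : 0 < M by rewrite ltr_wpDl // sqr_ge0.
have aM : actpos M (a ** a) by apply: actpos_sq => //; rewrite lerDl.
have [p ap] := sqrt_exists M0 aM.
have pp : pos p by apply: sqrt_pos ap _ aM; rewrite starM sa.
have sp := pos_selfadj pp.
have pa : p ** a = a ** p by apply: (sqrt_commute ap); rewrite amulA.
have paa := sqrt_eq ap.
pose b := p - a; have sb : star b = b by rewrite /b starD starN sa sp.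
have ba : a ** b = - (p ** b) by rewrite /b !amulE paa pa opprB.
have pb : p ** b = b ** p by rewrite /b !amulE pa.
have xb : x ** b = 0.
  apply: neg_star_amul_eq0.
  have -> : - (star (x ** b) ** (x ** b)) = b ** p ** b.
    by rewrite starM sb -amulA [star x ** _]amulA aE ba amulNr opprK amulA.
  exact: pos_conj_commute.
have ab : a ** b = 0 by rewrite -aE -amulA xb amul0r.
have bb : b ** b = 0.
  rewrite {1}/b amulDl amulNl ab subr0; apply/eqP.
  by rewrite -oppr_eq0 -ba ab.
by have /subr0_eq <- : b = 0 by apply: selfadj_sq_eq0.
Qed.

Lemma posP a : pos a <-> cstar_positive a.
Proof.
split=> [pa|[x ->]]; last exact: pos_star_amul.
have [M [w [aw [sw _]]]] := pos_sqrt pa.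
by exists w; rewrite sw (sqrt_eq aw).
Qed.

Lemma pos_bound a M : pos a -> 0 < M -> nrm a <= M -> actpos M a.
Proof.
move=> pa M0 aM; have [N [w [aw [sw _]]]] := pos_sqrt pa.
rewrite -(sqrt_eq aw); apply: actpos_sq => //.
by rewrite -nrm_star_amul sw (sqrt_eq aw).
Qed.

(** If [|b| < M], then [1 - a / M = (1 - b / M) + (b - a) / M] is positive in
    the unitization and has a square root there; with the square root of
    [a / M] it forms a unitary. *)
Lemma pos_mono a b : pos a -> pos (b - a) -> nrm a <= nrm b.
Proof.
move=> pa pba; apply/ler_addgt0Pr => e e0; set M := nrm b + e.
have M0 : 0 < M by rewrite ltr_wpDl ?nrm_ge0.
have [N [w [aw [sw _]]]] := pos_sqrt pa.
have [sba [K K0 baK]] := pba.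
(* The factor [L] makes [1 - (1 - a / M) / L] a contraction. *)
pose L := 1 + K / M; pose r := Num.sqrt L^-1.
have KM0 : 0 < K / M by rewrite divr_gt0.
have L1 : 1 <= L by rewrite lerDl ltW.
have L0 : 0 < L by apply: lt_le_trans L1.
have rr : r ^+ 2 = L^-1 by rewrite sqr_sqrtr // invr_ge0 ltW.
have r0 : 0 < r by rewrite sqrtr_gt0 invr_gt0.
have r01 : 0 <= r <= 1.
  by rewrite (ltW r0) /= -(@expr_le1 _ 2) ?(ltW r0) // rr invf_le1.
pose c := - ((L * M)^-1%:C *: a).
have sc : star c = c by rewrite /c !starE (pos_selfadj pa).
have [|v cv] := @sqlim_exists R A r c r01.
  move=> z; rewrite -(ler_pM2l L0) -nrmZr_gt0 // rr.
  have -> : L%:C *: ((1 - L^-1)%:C *: z - c ** z) =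
      (K / M)%:C *: z - M^-1%:C *: ((b - a) ** z) + M^-1%:C *: (b ** z).
    have -> : L%:C *: ((1 - L^-1)%:C *: z - c ** z) =
        (L * (1 - L^-1))%:C *: z + (L * (L * M)^-1)%:C *: (a ** z).
      by rewrite /c amulNl amulZl; lincomb.
    have -> : L * (1 - L^-1) = K / M.
      by rewrite mulrBr mulfV ?gt_eqF // mulr1 /L addrAC subrr add0r.
    have -> : L * (L * M)^-1 = M^-1 by rewrite invfM mulVKf // gt_eqF.
    by rewrite amulDl amulNl; lincomb.
  have -> : L * nrm z = K / M * nrm z + nrm z by rewrite /L; ring.
  apply: nrmD_le.
    have -> : (K / M)%:C *: z - M^-1%:C *: ((b - a) ** z) =
       M^-1%:C *: (K%:C *: z - (b - a) ** z) by lincomb.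
    rewrite nrmZr_gt0 ?invr_gt0 // (mulrC K) -mulrA.
    by rewrite ler_pM2l ?invr_gt0.
  rewrite nrmZr_gt0 ?invr_gt0 // ler_pdivrMl //.
  apply: le_trans (nrm_amul _ _) _; rewrite ler_wpM2r ?nrm_ge0 //.
  by rewrite lerDl ltW.
have sv := sqlim_selfadj cv sc.
have vw : w ** v = v ** w.
  apply/esym/(sqlim_intertwine cv cv); rewrite /c amulNl amulNr amulZl amulZr.
  by rewrite -(sqrt_eq aw) !amulA.
have vv := sqlim_eq r01 cv.
have sM0 : 0 < Num.sqrt M by rewrite sqrtr_gt0.
have sM2 : Num.sqrt M * Num.sqrt M = M by rewrite -expr2 sqr_sqrtr // ltW.
have H z : nrm (((Num.sqrt M)^-1%:C *: w) ** z) <= nrm z.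
  apply: (@selfadj_circle _ (r^-1%:C *: v) z _ _ _ _).1.
  - by rewrite starZr sw.
  - by rewrite starZr sv.
  - by rewrite !amulE vw; lincomb.
  - rewrite !amulE !scalerA -!rmorphM -!invfM sM2 -expr2 rr invrK (sqrt_eq aw).
    have -> : v ** v = c - (2 * r)%:C *: v by rewrite -vv addrC addKr.
    have -> : 2 * r^-1 = L * (2 * r).
      by rewrite -[L]invrK -rr expr2; field; rewrite gt_eqF.
    rewrite scalerBr scalerA -rmorphM addrC subrK /c scalerN scalerA -rmorphM.
    by rewrite invfM mulVKf // gt_eqF.
have wM : nrm w <= Num.sqrt M.
  apply: nrm_le_act => [|z]; first exact: ltW.
  by have := H z; rewrite amulZl nrmZr_gt0 ?invr_gt0 // ler_pdivrMl.
by rewrite -(sqrt_eq aw) -sM2; apply: nrm_amul_le.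
Qed.

Lemma pos_dominated (x b : A) : pos (b - star x ** x) -> nrm x ^+ 2 <= nrm b.
Proof. by move=> /(pos_mono (pos_star_amul x)); rewrite nrm_star_amul. Qed.

End Positivity.

(** * Automatic contractivity *)

(** A *-homomorphism [f] on a closed *-subalgebra carries the relation
    [b^2 + (1 + w)^2 = 1], solvable for every self-adjoint contraction [b], to
    its target, where it forces [|f b| <= 1]. *)
Lemma star_hom_contractive (R : realType) (A B : cstarAlgType R) (S : set A)
    (f : A -> B) : cstar_hom_on S f -> closed S -> S 0 ->
  (forall k x y, S x -> S y -> S (k *: x + y)) ->
  (forall x y, S x -> S y -> S (x ** y)) ->
  (forall x, S x -> S (star x)) ->
  forall x, S x -> nrm (f x) <= nrm x.
Proof.
move=> [flin fM fS] cS S0 Slin SM SS x Sx.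
have f0 : f 0 = 0.
  have := flin (-1) 0 0 S0 S0.
  by rewrite !scaleN1r !addNr => ->.
have SZ k y : S y -> S (k *: y) by move=> Sy; rewrite -[_ *: _]addr0; apply: Slin.
have fZ k y : S y -> f (k *: y) = k *: f y.
  by move=> Sy; rewrite -[k *: y]addr0 flin // f0 addr0.
have fD y z : S y -> S z -> f (y + z) = f y + f z.
  by move=> Sy Sz; rewrite -[y]scale1r flin // !scale1r.
suff H b : S b -> star b = b -> nrm (f b) <= nrm b.
  rewrite -(@ler_pXn2r _ 2) ?nnegrE ?nrm_ge0 // -!nrm_star_amul -fS // -fM //.
    by apply: H; [apply: SM => //; apply: SS | rewrite !starE].
  exact: SS.
move=> Sb sb; apply/ler_addgt0Pr => e e0; set m := nrm b + e.
have m0 : 0 < m by rewrite ltr_wpDl ?nrm_ge0.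
pose c := m^-1%:C *: b.
have Sc : S c by apply: SZ.
have sc : star c = c by rewrite /c starZr sb.
have c1 : nrm c <= 1.
  by rewrite nrmZr_gt0 ?invr_gt0 // ler_pdivrMl // mulr1 lerDl ltW.
have -> : b = m%:C *: c by rewrite scalerA -rmorphM mulfV ?scale1r // gt_eqF.
rewrite fZ // nrmZr_gt0 // -[leRHS]mulr1 ler_pM2l //.
clearbody c.
have [|w wl] := @sqlim_exists R A 1 (- (c ** c)) (one01 R).
  move=> z; rewrite expr1n subrr scale0r sub0r amulNl opprK.
  rewrite -[leRHS]mul1r -[1]mulr1; apply: nrm_amul_le (lexx _).
  exact: nrm_amul_le.
have sw : star w = w by apply: (sqlim_selfadj wl); rewrite starN starM sc.
have wc : w ** c = c ** w.
  by apply: (sqlim_intertwine wl wl); rewrite amulNl amulNr amulA.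
have ww := sqlim_eq (one01 R) wl; rewrite mulr1 in ww.
have Sw : S w.
  apply: (sqlim_in wl) => //; last by move=> y Sy; apply: SM.
  - by rewrite -scaleN1r; apply: SZ; apply: SM.
  - by move=> k y z; apply: Slin.
apply: nrm_le_act => // z; rewrite mul1r.
apply: (@selfadj_circle _ _ _ (f w) z _ _ _ _).1.
- by rewrite -fS // sc.
- by rewrite -fS // sw.
- by rewrite -!fM // wc.
- rewrite -!fM // -fZ // -fD; [|exact: SZ|exact: SM].
  by rewrite ww -scaleN1r fZ ?scaleN1r //; apply: SM.
Qed.

(** * Decomposable partial actions *)

Lemma eq_sum_support (V : nmodType) (I : eqType) (s t : seq I) (F : I -> V) :
  uniq s -> uniq t -> (forall i, i \in s -> i \notin t -> F i = 0) ->
  (forall i, i \in t -> i \notin s -> F i = 0) ->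
  \sum_(i <- s) F i = \sum_(i <- t) F i.
Proof.
move=> us ut st ts.
rewrite (bigID (fun i => i \in t)) /= [X in _ + X]big1_seq; last first.
  by move=> i /andP[it si]; apply: st.
rewrite [RHS](bigID (fun i => i \in s)) /= [X in _ = _ + X]big1_seq; last first.
  by move=> i /andP[it si]; apply: ts.
rewrite !addr0 -[LHS]big_filter -[RHS]big_filter; apply: perm_big.
apply: uniq_perm; rewrite ?filter_uniq // => i.
by rewrite !mem_filter andbC.
Qed.

Lemma card_uniq_seq (T : eqType) (s : seq T) :
  uniq s -> ([set` s] #= `I_(size s))%card.
Proof.
move=> us; apply/card_set_bijP; exists (fun x => index x s); split.
- by move=> x /= xs; rewrite index_mem.
- by move=> x y; rewrite !inE => xs ys; apply: index_inj.
- move=> i /= lti; case: s us lti => // x0 s us lti.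
  by exists (nth x0 (x0 :: s) i); [exact: mem_nth | exact: index_uniq].
Qed.

Section Decomposition.
Context (R : realType) (G : groupType) (A : cstarAlgType R).
Variables (alpha : partial_action G A) (n : nat).
Hypothesis nd : n_decomposition alpha n.
Implicit Types (g h : G) (s t : seq G) (a b x y : A).

Local Notation D := (pdom alpha).
Local Notation act := (pact alpha).

Lemma pdom0 g : D g 0. Proof. by have [] := pdom_ideal alpha g. Qed.
Lemma pdom_lin g k x y : D g x -> D g y -> D g (k *: x + y).
Proof. by have [_ _ H _] := pdom_ideal alpha g; apply: H. Qed.
Lemma pdom_closed g : closed (D g).
Proof. by have [] := pdom_ideal alpha g. Qed.
Lemma pdom_mull g x a : D g x -> D g (a ** x).
Proof. by have [_ _ _ H] := pdom_ideal alpha g; move=> /(H _ a)[]. Qed.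
Lemma pdom_mulr g x a : D g x -> D g (x ** a).
Proof. by have [_ _ _ H] := pdom_ideal alpha g; move=> /(H _ a)[]. Qed.
Lemma pdomD g x y : D g x -> D g y -> D g (x + y).
Proof. by move=> Dx Dy; rewrite -[x]scale1r; apply: pdom_lin. Qed.

(** The sets of [T_n(G)] are enumerated by duplicate-free sequences, over which
    sums can be taken and reindexed. *)
Definition valid s := [&& uniq s, size s == n & 1%g \in s].
Definition dom s : set A := [set a | forall g, g \in s -> D g a].
Definition gens : set A := [set a | exists2 s, valid s & dom s a].

Lemma pT_valid tau : pT n tau -> exists2 s, valid s & tau = [set` s].
Proof.
move=> [tau1 ctau].
have /finite_seqP[s0 tauE] : finite_set tau by apply/finite_setP; exists n.
have tau_s : tau = [set` undup s0].
  by rewrite tauE; apply/seteqP; split=> g /=; rewrite mem_undup.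
exists (undup s0) => //; rewrite /valid undup_uniq /=.
apply/andP; split; last by move: tau1; rewrite tau_s.
apply/eqP/card_eq_II; apply: card_eq_trans ctau; rewrite tau_s card_eq_sym.
exact: (card_uniq_seq (undup_uniq _)).
Qed.

Lemma valid_pT s : valid s -> pT n [set` s].
Proof.
by move=> /and3P[us /eqP <- s1]; split=> //; apply: (card_uniq_seq us).
Qed.

Lemma gens_dense : ndense (addspan gens).
Proof.
have [cl _] := nd; move=> x e e0.
have [y [m [u [ugen ->]]] xy] := closure_ndense cl x e0.
exists (\sum_i u i) => //.
elim/big_ind: _ => [|a b|i _]; first exact: addspan0.
  exact: addspan_add.
apply: addspan1; have [tau /pT_valid[s vs ->] ui] := ugen i.
by exists s.
Qed.

Lemma dom_meet s g a : valid s -> dom s a -> D g a -> g \notin s -> a = 0.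
Proof.
move=> vs sa ga gs; have [_ dis] := nd.
have : (pdomI alpha [set` s] `&` D g) a by split.
by rewrite dis //; [apply: valid_pT | apply/negP].
Qed.

Lemma dom_mull s a x : dom s x -> dom s (a ** x).
Proof. by move=> sx g /sx; apply: pdom_mull. Qed.
Lemma dom_mulr s a x : dom s x -> dom s (x ** a).
Proof. by move=> sx g /sx; apply: pdom_mulr. Qed.
Lemma dom_mul_pdom s g x y : valid s -> g \notin s -> dom s x -> D g y ->
  x ** y = 0.
Proof.
move=> vs gs sx gy; apply: dom_meet gs => //; first exact: dom_mulr.
exact: pdom_mull.
Qed.

Lemma pdom_mul_dom s g x y : valid s -> g \notin s -> dom s x -> D g y ->
  y ** x = 0.
Proof.
move=> vs gs sx gy; apply: dom_meet gs => //; first exact: dom_mull.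
exact: pdom_mulr.
Qed.

(** ** Projection onto the ideals of the action *)

Definition ann g y := forall i, D g i -> i ** y = 0 /\ y ** i = 0.

(** Although [i^*] is not yet known to lie in [A_g], the product [i i^*] does. *)
Lemma ann_starl g i y : D g i -> ann g y -> star i ** y = 0.
Proof.
move=> Di ay; apply: star_amul_eq0.
rewrite starM starK amulA -[star y ** i ** _]amulA -amulA.
have [-> _] := ay _ (pdom_mulr (star i) Di).
by rewrite amul0r.
Qed.

Lemma ann_lin g k x y : ann g x -> ann g y -> ann g (k *: x + y).
Proof.
move=> ax ay i Di; have [x1 x2] := ax _ Di; have [y1 y2] := ay _ Di.
by rewrite amulDr amulDl amulZr amulZl x1 x2 y1 y2 scaler0 addr0.
Qed.

Lemma ann_mull g a y : ann g y -> ann g (a ** y).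
Proof.
move=> ay i Di; have [y1 y2] := ay _ Di; have [y3 _] := ay _ (pdom_mulr a Di).
by rewrite amulA y3 -amulA y2 amul0r.
Qed.

Lemma ann_mulr g a y : ann g y -> ann g (y ** a).
Proof.
move=> ay i Di; have [y1 y2] := ay _ Di; have [_ y3] := ay _ (pdom_mull a Di).
by rewrite amulA y1 -amulA y3 amul0l.
Qed.

(** The components of [A] outside [A_g] annihilate [A_g], so every element
    splits, contractively, as a sum of an element of [A_g] and an annihilator. *)
Lemma proj_exists g : exists P : A -> A,
  [/\ forall k x y, P (k *: x + y) = k *: P x + P y,
      forall x, nrm (P x) <= nrm x,
      forall x i, D g i -> ann g (x - i) -> P x = i &
      forall x, D g (P x) /\ ann g (x - P x)].
Proof.
have ann0 : ann g 0 by move=> i Di; rewrite amul0l amul0r.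
have [] := @contraction_extension R A A (fun x i => D g i /\ ann g (x - i)).
- move=> k v w v' w' [Dw aw] [Dw' aw']; split; first exact: pdom_lin.
  have -> : k *: v + v' - (k *: w + w') = k *: (v - w) + (v' - w') by lincomb.
  exact: ann_lin.
- move=> x i [Di ai].
  have [i0|] := boolP (0 < nrm i); last first.
    by rewrite -leNgt => i0; apply: le_trans i0 (nrm_ge0 _).
  rewrite -(ler_pM2l i0) -expr2 -nrm_star_amul.
  have -> : star i ** i = star i ** x.
    by apply/esym/subr0_eq; rewrite -amulNr -amulDr (ann_starl Di ai).
  by have := nrm_amul (star i) x; rewrite nrm_star.
- move=> x e e0; have [y yspan xy] := gens_dense x e0; exists y => //.
  elim: yspan => [|a b [s vs sa] _ [i [Di ai]]].
    by exists 0; rewrite subr0; split=> //; apply: pdom0.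
  have [gs|gs] := boolP (g \in s).
    exists (a + i); split; first by apply: pdomD => //; apply: sa.
    by have -> : a + b - (a + i) = b - i by lincomb.
  exists i; split=> //; rewrite -addrA -[a]scale1r; apply: ann_lin => // j Dj.
  by rewrite (dom_mul_pdom vs gs sa Dj) (pdom_mul_dom vs gs sa Dj).
move=> P [Plin Pcontr Pgr]; exists P.
have PE x i : D g i -> ann g (x - i) -> P x = i by move=> Di ai; apply: Pgr.
have bP : badd P.
  by apply: badd_contr => // x y; rewrite -[x]scale1r Plin !scale1r.
have bPc : badd (fun x => x - P x).
  by apply: badd_add (badd_id A) (badd_opp bP).
split=> // x.
have dP : ndense (addspan [set x | D g x \/ ann g x]).
  move=> y e e0; have [z zs yz] := gens_dense y e0; exists z => //.
  apply: addspan_sub zs => a [s vs sa] /=.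
  have [gs|gs] := boolP (g \in s); [by left; apply: sa | right=> j Dj].
  by rewrite (dom_mul_pdom vs gs sa Dj) (pdom_mul_dom vs gs sa Dj).
split.
  apply: (dense_closed dP (badd_preimage_closed bP (@pdom_closed g))) => {}x /=.
  elim=> [|a b aD _ IH]; first by rewrite (badd0 bP); exact (pdom0 g).
  rewrite (baddD bP); apply: pdomD => //.
  case: aD => [Da|aa]; first by rewrite (PE a a) // subrr.
  by rewrite (PE a 0) ?subr0 //; apply: pdom0.
move=> i Di; split.
  apply: (badd_eq (badd_comp (badd_amull i) bPc) (badd_cst0 A A) dP) => a [Da|aa].
    by rewrite (PE a a) ?subrr ?amul0r.
  by rewrite (PE a 0) ?subr0 //; [case: (aa _ Di) | apply: pdom0].
apply: (badd_eq (badd_comp (badd_amulr i) bPc) (badd_cst0 A A) dP) => a [Da|aa].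
  by rewrite (PE a a) ?subrr ?amul0l.
by rewrite (PE a 0) ?subr0 //; [case: (aa _ Di) | apply: pdom0].
Qed.

Definition proj g : A -> A := projT1 (cid (proj_exists g)).

Lemma proj_lin g k x y : proj g (k *: x + y) = k *: proj g x + proj g y.
Proof. by rewrite /proj; case: cid => P []. Qed.
Lemma proj_contr g x : nrm (proj g x) <= nrm x.
Proof. by rewrite /proj; case: cid => P []. Qed.
Lemma projE g x i : D g i -> ann g (x - i) -> proj g x = i.
Proof. by rewrite /proj; case: cid => P [_ _ H _] /=; apply: H. Qed.
Lemma proj_pdom g x : D g (proj g x).
Proof. by rewrite /proj; case: cid => P /= [_ _ _ H]; have [] := H x. Qed.
Lemma proj_ann g x : ann g (x - proj g x).
Proof. by rewrite /proj; case: cid => P /= [_ _ _ H]; have [] := H x. Qed.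

Lemma badd_proj g : badd (proj g).
Proof.
apply: badd_contr (proj_contr g) => x y.
by rewrite -[x]scale1r proj_lin !scale1r.
Qed.

Lemma ann0 g : ann g 0.
Proof. by move=> i Di; rewrite amul0l amul0r. Qed.

Lemma proj_id g x : D g x -> proj g x = x.
Proof. by move=> Dx; apply: projE; rewrite ?subrr //; apply: ann0. Qed.

Lemma proj0 g x : ann g x -> proj g x = 0.
Proof. by move=> ax; apply: projE; rewrite ?subr0 //; apply: pdom0. Qed.

Lemma dom_ann s g a : valid s -> g \notin s -> dom s a -> ann g a.
Proof.
by move=> vs gs sa i Di; rewrite (dom_mul_pdom vs gs sa Di) (pdom_mul_dom vs gs sa Di).
Qed.

Lemma proj_dom s g a : valid s -> dom s a ->
  proj g a = if g \in s then a else 0.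
Proof.
move=> vs sa; case: ifPn => gs; first by apply/proj_id/sa.
exact/proj0/(dom_ann vs).
Qed.

(** Split [x^* = i + j] with [i] in [A_g] and [j] annihilating [A_g]; then
    [j^* j = (x j)^* - (i^* j)^* = 0]. *)
Lemma pdom_star g x : D g x -> D g (star x).
Proof.
move=> Dx; set i := proj g (star x); have aj := @proj_ann g (star x).
have Di := proj_pdom g (star x).
suff /subr0_eq -> : star x - i = 0 by [].
apply: star_amul_eq0; rewrite amulDr amulNr -starM.
have [-> _] := aj _ Dx; rewrite star0 sub0r.
by rewrite -[star _ ** i]starK starM starK (ann_starl Di aj) star0 oppr0.
Qed.

Lemma ann_star g x : ann g x -> ann g (star x).
Proof.
move=> ax j /pdom_star Dj; have [x1 x2] := ax _ Dj.
by rewrite -[j]starK -!starM x1 x2 star0.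
Qed.

Lemma dom_star s x : dom s x -> dom s (star x).
Proof. by move=> sx g /sx; apply: pdom_star. Qed.

Lemma proj_star g x : proj g (star x) = star (proj g x).
Proof.
apply: projE; first exact/pdom_star/proj_pdom.
by rewrite -starN -starD; apply/ann_star/proj_ann.
Qed.

Lemma proj_mull g x y : proj g (x ** y) = proj g x ** y.
Proof.
apply: projE; first exact/pdom_mulr/proj_pdom.
by rewrite -amulNl -amulDl; apply/ann_mulr/proj_ann.
Qed.

Lemma proj_mulr g x y : proj g (x ** y) = x ** proj g y.
Proof.
apply: projE; first exact/pdom_mull/proj_pdom.
by rewrite -amulNr -amulDr; apply/ann_mull/proj_ann.
Qed.

Lemma projK g x : proj g (proj g x) = proj g x.
Proof. exact/proj_id/proj_pdom. Qed.

Lemma mul_proj g x y : x ** proj g y = proj g x ** y.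
Proof. by rewrite -proj_mulr proj_mull. Qed.

(** ** Total extensions of the partial automorphisms *)

(** Extended by zero, [alpha_g] becomes a *-endomorphism of [A], and no domain
    condition remains in computations. *)
Definition tact g x := act g (proj g^-1%g x).

Lemma act_pdom g x : D g^-1%g x -> D g (act g x).
Proof. by have [H _ _] := pact_bij alpha g; apply: H. Qed.

Lemma act_surj g y : D g y -> exists2 x, D g^-1%g x & act g x = y.
Proof. by have [_ _ H] := pact_bij alpha g; move=> /H[x]; exists x. Qed.

Lemma act_lin g k x y : D g^-1%g x -> D g^-1%g y ->
  act g (k *: x + y) = k *: act g x + act g y.
Proof. by have [H _ _] := pact_hom alpha g; apply: H. Qed.

Lemma act_contr g x : D g^-1%g x -> nrm (act g x) <= nrm x.
Proof.
apply: (star_hom_contractive (pact_hom alpha g)).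
- exact: pdom_closed.
- exact: pdom0.
- exact: pdom_lin.
- by move=> y z Dy _; apply: pdom_mulr.
- exact: pdom_star.
Qed.

Lemma tact_pdom g x : D g (tact g x).
Proof. exact/act_pdom/proj_pdom. Qed.

Lemma tact_pdomE g x : D g^-1%g x -> tact g x = act g x.
Proof. by move=> Dx; rewrite /tact proj_id. Qed.

Lemma tact_lin g k x y : tact g (k *: x + y) = k *: tact g x + tact g y.
Proof. by rewrite /tact proj_lin act_lin //; apply: proj_pdom. Qed.

Lemma tact_contr g x : nrm (tact g x) <= nrm x.
Proof. exact: le_trans (act_contr (proj_pdom _ _)) (proj_contr _ _). Qed.

Lemma badd_tact g : badd (tact g).
Proof.
apply: badd_contr (tact_contr g) => x y.
by rewrite -[x]scale1r tact_lin !scale1r.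
Qed.

Lemma tactZ g k x : tact g (k *: x) = k *: tact g x.
Proof. by rewrite -[k *: x]addr0 tact_lin (badd0 (badd_tact g)) addr0. Qed.

Lemma tact_star g x : tact g (star x) = star (tact g x).
Proof.
by have [_ _ H] := pact_hom alpha g; rewrite /tact proj_star H //; apply: proj_pdom.
Qed.

Lemma tactM g x y : tact g (x ** y) = tact g x ** tact g y.
Proof.
have [_ H _] := pact_hom alpha g.
rewrite /tact -H; [|exact: proj_pdom..].
by rewrite proj_mull -proj_mulr proj_mull projK.
Qed.

Lemma tact1 x : tact 1%g x = x.
Proof. by rewrite /tact pact1 proj_id // invg1 pdom1. Qed.

Lemma tact_proj g x : tact g (proj g^-1%g x) = tact g x.
Proof. by rewrite /tact projK. Qed.

Definition shift g s := [seq (g * h)%g | h <- s].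

Lemma mem_shift g s h : (h \in shift g s) = ((g^-1 * h)%g \in s).
Proof.
apply/mapP/idP => [[k ks ->]|]; first by rewrite mulKg.
by move=> hs; exists (g^-1 * h)%g; rewrite // mulVKg.
Qed.

Lemma valid_shift g s : valid s -> g^-1%g \in s -> valid (shift g s).
Proof.
move=> /and3P[us ss _] gs; apply/and3P; split.
- by rewrite map_inj_uniq //; apply: mulgI.
- by rewrite size_map.
- by rewrite mem_shift mulg1.
Qed.

Lemma tact_dom g s a : g^-1%g \in s -> dom s a -> dom (shift g s) (tact g a).
Proof.
move=> gs sa k /mapP[h hs ->]; rewrite tact_pdomE; last exact: sa.
have [x Dx xa] := act_surj (sa _ hs).
have [|Dgh actE] := @pactM _ _ _ alpha g h x Dx; first by rewrite xa; apply: sa.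
by rewrite -xa -actE; apply: act_pdom.
Qed.

Lemma tact_dom0 g s a : valid s -> g^-1%g \notin s -> dom s a -> tact g a = 0.
Proof.
move=> vs gs sa; rewrite -tact_proj (proj_dom _ vs sa) ifN //.
exact: badd0 (badd_tact g).
Qed.

(** Both sides agree on [A_s]: they are [alpha_(g h) x] if [s] contains [h^-1]
    and [(g h)^-1], and [0] otherwise. *)
Lemma tact_comp g h x : tact g (tact h x) = proj g (tact (g * h)%g x).
Proof.
apply: (badd_eq (badd_comp (badd_tact g) (badd_tact h))
  (badd_comp (badd_proj g) (badd_tact _)) gens_dense) => a [s vs sa].
have [hs|hs] := boolP (h^-1%g \in s); last first.
  rewrite (tact_dom0 vs hs sa) (badd0 (badd_tact g)).
  have [ghs|ghs] := boolP ((g * h)^-1%g \in s); last first.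
    by rewrite (tact_dom0 vs ghs sa) (badd0 (badd_proj g)).
  rewrite (proj_dom g (valid_shift vs ghs) (tact_dom ghs sa)).
  by rewrite mem_shift invgM mulgVK (negbTE hs).
have := tact_dom hs sa; have vhs := valid_shift vs hs => sha.
have gE : (g^-1%g \in shift h s) = ((g * h)^-1%g \in s) by rewrite mem_shift invgM.
have [ghs|ghs] := boolP ((g * h)^-1%g \in s); last first.
  by rewrite (tact_dom0 vhs _ sha) ?gE // (tact_dom0 vs ghs sa) (badd0 (badd_proj g)).
rewrite proj_id; last by apply: (tact_dom ghs sa); rewrite mem_shift invgM mulgVK.
have Da := sa _ hs.
have Dha : D g^-1%g (act h a).
  by rewrite -(tact_pdomE Da); apply: sha; rewrite gE.
rewrite (tact_pdomE Da) (tact_pdomE Dha) tact_pdomE; last exact: sa.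
by have [_ ->] := @pactM _ _ _ alpha g h a Da Dha.
Qed.

Lemma tactK g x : tact g (tact g^-1%g x) = proj g x.
Proof. by rewrite tact_comp mulgV tact1. Qed.

Lemma tactKV g x : tact g^-1%g (tact g x) = proj g^-1%g x.
Proof. by rewrite tact_comp mulVg tact1. Qed.

Lemma proj_comm g h x : proj g (proj h x) = proj h (proj g x).
Proof.
apply: (badd_eq (badd_comp (badd_proj g) (badd_proj h))
  (badd_comp (badd_proj h) (badd_proj g)) gens_dense) => a [s vs sa].
rewrite !(proj_dom _ vs sa).
by case: ifP => gs; case: ifP => hs;
  rewrite ?(badd0 (badd_proj _)) // ?(proj_dom _ vs sa) ?gs ?hs.
Qed.

Lemma proj_tact g h x : proj g (tact h x) = tact h (proj (h^-1 * g)%g x).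
Proof.
rewrite -(tactK (h^-1 * g)%g) tact_comp mulVKg tact_comp.
rewrite invgM invgK mulVKg proj_comm; congr proj.
exact/esym/proj_id/tact_pdom.
Qed.

End Decomposition.

(** * Norms tested on the pieces of the decomposition *)

Lemma pow_bounded_le1 (R : realType) (q M : R) :
  0 <= q -> (forall k, q ^+ (2 ^ k) <= M) -> q <= 1.
Proof.
move=> q0 qM; rewrite leNgt; apply/negP => q1.
have bern m : 1 + m%:R * (q - 1) <= q ^+ m.
  elim: m => [|m IH]; first by rewrite mul0r addr0 expr0.
  rewrite exprS; apply: le_trans (ler_wpM2l q0 IH).
  by rewrite -natr1; have := mulr_ge0 (ler0n R m) (sqr_ge0 (q - 1)); rewrite expr2; lra.
have M0 : 0 <= M by apply: le_trans (qM 0); rewrite exprn_ge0.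
have := archi_boundP (divr_ge0 M0 (_ : 0 <= q - 1)).
rewrite subr_ge0 ltW // => /(_ isT); set k := Num.bound _.
rewrite ltr_pdivrMr ?subr_gt0 // => kM.
have := le_trans (bern _) (qM k).
have : k%:R * (q - 1) <= (2 ^ k)%:R * (q - 1).
  by rewrite ler_wpM2r ?subr_ge0 ?(ltW q1) // ler_nat ltnW // ltn_expl.
by lra.
Qed.

Section LocalNorm.
Context (R : realType) (G : groupType) (A : cstarAlgType R).
Variables (alpha : partial_action G A) (n : nat).
Hypothesis nd : n_decomposition alpha n.
Implicit Types (g h : G) (s t : seq G) (a b c x y : A).

(** Since [|T z|^(2^k) <= |z|^(2^k - 1) |T^(2^k) z|], the norm of [T z] only
    depends on the growth of the iterates, which can be estimated piecewise. *)
Lemma local_bound (T : A -> A) (C : R) : 0 <= C -> badd T ->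
  (forall x y, star (T x) ** y = star x ** T y) ->
  (forall s c, valid n s -> dom alpha s c ->
     dom alpha s (T c) /\ nrm (T c) <= C * nrm c) ->
  forall z, nrm (T z) <= C * nrm z.
Proof.
move=> C0 bT Tsym Tloc.
have closedT : closed [set z | nrm (T z) <= C * nrm z].
  apply: closed_of_limit => z Hz; apply/ler_addgt0Pr => e e0.
  have e20 : 0 < e / 2 by rewrite divr_gt0.
  have [d d0 Td] := badd_lipschitz bT z e20.
  have C1 : 0 < C + 1 by rewrite ltr_wpDl.
  have [|y /= Ty zy] := Hz (Num.min d (e / 2 / (C + 1))).
    by rewrite lt_min d0 divr_gt0.
  move: zy; rewrite le_min => /andP[/Td zd]; rewrite ler_pdivlMr // => ze.
  have := nrm_dist (T z) (T y) 0; have := nrm_dist y z 0.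
  rewrite !subr0 (nrmBC y z) => yz.
  have := ler_wpM2l C0 yz; have := nrm_ge0 (z - y).
  by nra.
apply: (dense_closed (gens_dense nd) closedT) => z zspan /=.
have [M zM] : exists M, forall N, nrm (iter N T z) <= M * C ^+ N.
  elim: zspan => [|a b [s vs sa] _ [M IH]].
    exists 0 => N; rewrite mul0r; elim: N => [|N IH] /=; first by rewrite nrm0.
    suff -> : iter N T 0 = 0 by rewrite (badd0 bT) nrm0.
    by elim: N {IH} => //= N ->; rewrite (badd0 bT).
  have aN N : dom alpha s (iter N T a) /\ nrm (iter N T a) <= nrm a * C ^+ N.
    elim: N => [|N [dN nN]] /=; first by rewrite expr0 mulr1.
    have [dT nT] := Tloc _ _ vs dN; split=> //.
    apply: le_trans nT _; rewrite exprS mulrCA; exact: ler_wpM2l.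
  exists (nrm a + M) => N.
  have -> : iter N T (a + b) = iter N T a + iter N T b.
    by elim: N => //= N ->; rewrite (baddD bT).
  by rewrite mulrDl; apply: nrmD_le => //; have [] := aN N.
have [z0|] := boolP (0 < nrm z); last first.
  rewrite -leNgt => /nrm_le0 ->.
  by rewrite (badd0 bT) nrm0 mulr0.
have sym m x y : star (iter m T x) ** y = star x ** iter m T y.
  by elim: m x y => //= m IH x y; rewrite Tsym IH -iterSr.
have sq m : nrm (iter m T z) ^+ 2 <= nrm z * nrm (iter (m + m) T z).
  rewrite -nrm_star_amul sym -iterD -[nrm z]nrm_star; exact: nrm_amul.
have pw k : (nrm (T z) / nrm z) ^+ (2 ^ k) <= nrm (iter (2 ^ k) T z) / nrm z.
  elim: k => [|k IH]; first by rewrite expr1.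
  rewrite expnSr exprM; apply: le_trans (_ : (nrm (iter (2 ^ k) T z) / nrm z) ^+ 2 <= _).
    by apply: lerXn2r => //; rewrite nnegrE ?exprn_ge0 ?mulr_ge0 ?invr_ge0 ?nrm_ge0.
  rewrite expr_div_n ler_pdivrMr ?exprn_gt0 // mulnC mul2n -addnn.
  apply: le_trans (sq _) _; rewrite expr2 mulrA divfK ?gt_eqF //.
  by rewrite mulrC.
apply/ler_addgt0Pr => e e0; set C' := C + e / nrm z.
have C'0 : 0 < C' by rewrite ltr_wpDl // divr_gt0.
have CC' : C <= C' by rewrite lerDl ltW // divr_gt0.
have -> : C * nrm z + e = C' * nrm z by rewrite mulrDl divfK // gt_eqF.
rewrite -ler_pdivrMr // -[leRHS]mulr1 -ler_pdivrMl //.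
apply: (@pow_bounded_le1 _ _ (M / nrm z)).
  by rewrite !(mulr_ge0, invr_ge0, nrm_ge0, ltW C'0).
move=> k; rewrite exprMn exprVn ler_pdivrMl ?exprn_gt0 //.
apply: le_trans (pw k) _; rewrite mulrA ler_pM2r ?invr_gt0 // mulrC.
apply: le_trans (zM _) _.
have M0 : 0 <= M by have := zM 0; rewrite expr0 mulr1; apply: le_trans; apply: nrm_ge0.
by apply: ler_wpM2l => //; apply: lerXn2r; rewrite ?nnegrE // ltW.
Qed.

Lemma local_nrm x C : 0 <= C ->
  (forall s c, valid n s -> dom alpha s c -> nrm (x ** c) <= C * nrm c) ->
  nrm x <= C.
Proof.
move=> C0 xloc.
have xsloc s c : valid n s -> dom alpha s c -> nrm (star x ** c) <= C * nrm c.
  move=> vs sc; set m := star x ** c.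
  have [m0|] := boolP (0 < nrm m); last first.
    by rewrite -leNgt => m0; apply: le_trans m0 _; rewrite mulr_ge0 ?nrm_ge0.
  rewrite -(ler_pM2r m0) -expr2 -nrm_star_amul {1}/m starM starK -amulA.
  rewrite mulrAC mulrC -[in leRHS](nrm_star c); apply: nrm_amul_le => //.
  by apply: (xloc s) => //; apply: dom_mull.
apply: nrm_le_act => // z.
rewrite -(@ler_pXn2r _ 2) ?nnegrE ?mulr_ge0 ?nrm_ge0 // -nrm_star_amul.
rewrite starM amulA -[star z ** _ ** _]amulA -amulA exprMn.
have -> : C ^+ 2 * nrm z ^+ 2 = nrm (star z) * (C ^+ 2 * nrm z).
  by rewrite nrm_star; ring.
apply: nrm_amul_le => //.
apply: (@local_bound (fun y => star x ** x ** y)); first exact: exprn_ge0.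
- exact: badd_amull.
- by move=> y y'; rewrite !starE !amulA.
- move=> s c vs sc; split; first exact: dom_mull.
  rewrite -amulA expr2 -mulrA; apply: le_trans (xsloc _ _ vs (dom_mull x sc)) _.
  by apply: ler_wpM2l => //; apply: xloc vs sc.
Qed.

Lemma local_eq x y :
  (forall s c, valid n s -> dom alpha s c -> x ** c = y ** c) -> x = y.
Proof.
move=> H; apply/subr0_eq/nrm_le0/local_nrm => // s c vs sc.
by rewrite amulDl amulNl (H s) // subrr nrm0 mul0r.
Qed.

End LocalNorm.

(** * The conditional expectation *)

Section Expectation.
Context (R : realType) (G : groupType) (A : cstarAlgType R).
Variables (alpha : partial_action G A) (n : nat).
Hypothesis nd : n_decomposition alpha n.
Implicit Types (g h : G) (s t : seq G) (a b c x y : A).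

Local Notation D := (pdom alpha).
Local Notation V := (tact nd).
Local Notation P := (proj nd).
Local Notation nu := ((n%:R^-1 : R)%:C).

Lemma valid_n_gt0 s : valid n s -> (0 < n)%N.
Proof. by case/and3P => _ /eqP <-; case: s. Qed.

Lemma nu_avg s (x : A) : valid n s -> nu *: \sum_(g <- s) x = x.
Proof.
move=> vs; rewrite big_const_seq count_predT iter_addr_0.
case/and3P: (vs) => _ /eqP -> _.
have -> : x *+ n = (n%:R)%:C *: x by rewrite rmorph_nat scaler_nat.
by rewrite scalerA -rmorphM mulVf ?scale1r // pnatr_eq0 -lt0n (valid_n_gt0 vs).
Qed.

Lemma nrm_avg s (F : G -> A) (M : R) : valid n s ->
  (forall g, g \in s -> nrm (F g) <= M) -> nrm (nu *: \sum_(g <- s) F g) <= M.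
Proof.
move=> vs FM; have n0 := valid_n_gt0 vs.
rewrite nrmZr_ge0 ?invr_ge0 ?ler0n // ler_pdivrMl ?ltr0n //.
apply: le_trans (nrm_sum _ _) _.
apply: le_trans (_ : \sum_(g <- s) M <= _).
  by rewrite !big_seq; apply: ler_sum.
rewrite big_const_seq count_predT iter_addr_0.
by case/and3P: vs => _ /eqP -> _; rewrite mulr_natl lexx.
Qed.

(** The [V_(h^-1) a] with [h] in [s] are the only translates of [a] that do not
    vanish. *)
Definition expect_gen a e := exists s, [/\ valid n s, dom alpha s a &
  e = nu *: \sum_(h <- s) V h^-1%g a].

Lemma tact_mul_eq0 t g a c : valid n t -> dom alpha t c -> g \notin t ->
  V g a ** c = 0.
Proof. by move=> vt tc gt; apply: (pdom_mul_dom nd vt gt tc); apply: tact_pdom. Qed.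

(** For [a] in [A_s] and [c] in [A_t], both sides are sums over the [g] in [t]
    such that [g^-1] belongs to [s]. *)
Lemma expect_gen_local a e : linspan expect_gen a e ->
  forall t c, valid n t -> dom alpha t c ->
  e ** c = nu *: \sum_(g <- t) V g a ** c.
Proof.
elim=> [|k v w v' w' [s [vs sv ->]] _ IH] t c vt tc.
  rewrite amul0l big1 ?scaler0 // => g _.
  by rewrite (badd0 (badd_tact _ _)) amul0l.
rewrite amulDl !amulZl (IH t c vt tc) scalerA mulrC -scalerA -scalerDr; congr (_ *: _).
rewrite amul_suml.
have -> : \sum_(h <- s) V h^-1%g v ** c = \sum_(g <- t) V g v ** c.
  transitivity (\sum_(g <- [seq h^-1%g | h <- s]) V g v ** c).
    by rewrite big_map.
  case/and3P: (vs) => us _ _; case/and3P: (vt) => ut _ _.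
  apply: eq_sum_support => //.
  - by rewrite map_inj_uniq //; apply: invg_inj.
  - by move=> g _ gt; apply: tact_mul_eq0 gt.
  - move=> g _ gs; rewrite (tact_dom0 nd vs _ sv) ?amul0l //.
    by apply: contra gs => gs; apply/mapP; exists g^-1%g; rewrite ?invgK.
rewrite scaler_sumr -big_split; apply: eq_bigr => g _.
by rewrite tact_lin amulDl amulZl.
Qed.

Lemma expect_exists : exists E : A -> A,
  [/\ forall k x y, E (k *: x + y) = k *: E x + E y,
      forall x, nrm (E x) <= nrm x &
      forall a e, linspan expect_gen a e -> E a = e].
Proof.
apply: contraction_extension.
- by move=> k v w v' w'; apply: linspan_lin.
- move=> a e ae; apply: (local_nrm nd); first exact: nrm_ge0.
  move=> t c vt tc; rewrite (expect_gen_local ae vt tc).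
  apply: nrm_avg => // g _; apply: nrm_amul_le => //; exact: tact_contr.
- move=> x e e0; have [y yspan xy] := gens_dense nd x e0; exists y => //.
  elim: yspan => [|a b [s vs sa] _ [w bw]]; first by exists 0; apply: linspan0.
  exists (1 *: (nu *: \sum_(h <- s) V h^-1%g a) + w).
  by rewrite -[a]scale1r; apply: linspanD => //; exists s; rewrite scale1r.
Qed.

Definition expect : A -> A := projT1 (cid expect_exists).
Local Notation E := expect.

Lemma expect_lin k x y : E (k *: x + y) = k *: E x + E y.
Proof. by rewrite /expect; case: cid => F []. Qed.
Lemma expect_contr x : nrm (E x) <= nrm x.
Proof. by rewrite /expect; case: cid => F []. Qed.
Lemma expect_dom s a : valid n s -> dom alpha s a ->
  E a = nu *: \sum_(h <- s) V h^-1%g a.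
Proof.
move=> vs sa; rewrite /expect; case: cid => F [_ _ H] /=.
by apply: H; apply: linspan1; exists s.
Qed.

Lemma badd_expect : badd E.
Proof.
apply: badd_contr expect_contr => x y.
by rewrite -[x]scale1r expect_lin !scale1r.
Qed.

Lemma expect_local a t c : valid n t -> dom alpha t c ->
  E a ** c = nu *: \sum_(g <- t) V g a ** c.
Proof.
move=> vt tc.
apply: (badd_eq (badd_comp (badd_amulr c) badd_expect)
  (badd_scale _ (badd_bigsum _ (fun g => badd_comp (badd_amulr c) (badd_tact nd g))))
  (gens_dense nd)) => {}a [s vs sa].
rewrite (expect_dom vs sa); apply: expect_gen_local vt tc.
by apply: linspan1; exists s.
Qed.

(** Invariance in terms of the total maps [V_g], with the factor on the side
    where the local formula for [E] puts it. *)
Lemma fixedP a : fixed_algebra alpha a <-> forall g y, D g y -> V g a ** y = a ** y.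
Proof.
split=> [fa g y Dy|H g b Db].
  have Dx : D g^-1%g (V g^-1%g y) by apply: tact_pdom.
  have := fa g^-1%g _ Dx; rewrite invgK -!(tact_pdomE nd) //; last exact: pdom_mull.
  by rewrite tactM tactK proj_id.
have Db' : D (g^-1)^-1%g b by rewrite invgK.
rewrite -!(tact_pdomE nd) //; last exact: pdom_mull.
by rewrite tactM H //; apply: tact_pdom.
Qed.

(** Both sides of [V_g (E a) y = (E a) y], for [y] in [A_g] and [a] in [A_s],
    are sums over the [k] such that [k^-1] and [k^-1 g] belong to [s]. *)
Lemma expect_fixed a : fixed_algebra alpha (E a).
Proof.
apply/fixedP => g y Dy.
apply: (badd_eq (badd_comp (badd_amulr y) (badd_comp (badd_tact nd g) badd_expect))
  (badd_comp (badd_amulr y) badd_expect) (gens_dense nd)) => {}a [s vs sa].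
rewrite (expect_dom vs sa) tactZ !amulZl; congr (_ *: _).
rewrite (badd_sum (badd_tact nd g)) !amul_suml.
transitivity (\sum_(h <- s) V (g * h^-1)%g a ** y).
  apply: eq_bigr => h _; rewrite tact_comp -mul_proj proj_id //.
transitivity (\sum_(k <- [seq (g * h^-1)%g | h <- s]) V k a ** y).
  by rewrite big_map.
transitivity (\sum_(k <- [seq h^-1%g | h <- s]) V k a ** y); last by rewrite big_map.
case/and3P: (vs) => us _ _.
apply: eq_sum_support.
- by rewrite map_inj_uniq // => h h' /mulgI/invg_inj.
- by rewrite map_inj_uniq //; apply: invg_inj.
- move=> k _ ks; rewrite (tact_dom0 nd vs _ sa) ?amul0l //.
  by apply: contra ks => ks; apply/mapP; exists k^-1%g; rewrite ?invgK.
- move=> k /mapP[h hs ->] ks.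
  have hs' : (h^-1)^-1%g \in s by rewrite invgK.
  apply: (dom_mul_pdom nd (valid_shift vs hs') _ (tact_dom nd hs' sa) Dy).
  rewrite mem_shift; apply: contra ks => ks; apply/mapP.
  by exists ((h^-1)^-1 * g)%g => //; rewrite invgM mulVKg invgK.
Qed.

Lemma expect_id b : fixed_algebra alpha b -> E b = b.
Proof.
move=> /fixedP fb; apply: (local_eq nd) => t c vt tc.
rewrite (expect_local _ vt tc) -[RHS](nu_avg _ vt); congr (_ *: _).
by rewrite !big_seq; apply: eq_bigr => g gt; apply: fb; apply: tc.
Qed.

Lemma expect_star a : E (star a) = star (E a).
Proof.
apply: (badd_eq (badd_comp badd_expect (badd_star A))
  (badd_comp (badd_star A) badd_expect) (gens_dense nd)) => {}a [s vs sa].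
rewrite (expect_dom vs (dom_star nd sa)) (expect_dom vs sa) starZr star_sum.
by congr (_ *: _); apply: eq_bigr => h _; rewrite tact_star.
Qed.

Lemma fixed_star a : fixed_algebra alpha a -> fixed_algebra alpha (star a).
Proof. by move=> /expect_id <-; rewrite -expect_star; apply: expect_fixed. Qed.

Lemma expect_modl b a : fixed_algebra alpha b -> E (b ** a) = b ** E a.
Proof.
move=> /fixedP fb; apply: (local_eq nd) => t c vt tc.
rewrite -amulA !(expect_local _ vt tc) amulZr amul_sumr; congr (_ *: _).
apply: eq_bigr => g _; rewrite tactM -amulA fb //.
by apply: pdom_mulr; apply: tact_pdom.
Qed.

Lemma expect_modr b a : fixed_algebra alpha b -> E (a ** b) = E a ** b.
Proof.
move=> fb; rewrite -[LHS]starK -expect_star starM expect_modl; last exact: fixed_star.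
by rewrite starM starK -expect_star starK.
Qed.

Lemma fixed_mul a b : fixed_algebra alpha a -> fixed_algebra alpha b ->
  fixed_algebra alpha (a ** b).
Proof.
by move=> fa fb; rewrite -(expect_id fb) -expect_modl //; apply: expect_fixed.
Qed.

(** On [A_t], the operator [M - E (x^* x)] is the mean of the operators
    [M - (V_g x)^* (V_g x)], whose norms are at most [M]. *)
Lemma expect_pos x : pos (E (star x ** x)).
Proof.
set e := E _; have se : star e = e by rewrite /e -expect_star starM starK.
split=> //; pose M := nrm x ^+ 2 + 1.
have M0 : 0 < M by rewrite ltr_wpDl // sqr_ge0.
exists M => // z.
apply: (local_bound nd (T := fun z => M%:C *: z - e ** z)).
- exact: ltW.
- exact: badd_add (badd_scale _ (badd_id A)) (badd_opp (badd_amull e)).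
- by move=> y y'; rewrite !starE se !amulE.
- move=> t c vt tc; split.
    move=> g gt; rewrite -amulNl; apply: pdom_lin; first exact: tc.
    by apply: pdom_mull; apply: tc.
  rewrite (expect_local _ vt tc) -(nu_avg (M%:C *: c) vt) -scalerBr -sumrB.
  apply: nrm_avg => // g _; rewrite tactM tact_star.
  apply: pos_bound => //; first exact: pos_star_amul.
  rewrite nrm_star_amul (le_trans (_ : _ <= nrm x ^+ 2)) ?lerDl //.
  by rewrite lerXn2r ?nnegrE ?nrm_ge0 // tact_contr.
Qed.

(** [n E (x^* x)] acts on [A_t] as a sum of positive terms, among which [x^* x]
    is the one of index [1]. *)
Lemma expect_dominates x t c : valid n t -> dom alpha t c ->
  pos (star c ** ((n%:R)%:C *: E (star x ** x)) ** c - star (x ** c) ** (x ** c)).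
Proof.
move=> vt tc; have n0 : (n%:R : R) != 0.
  by rewrite pnatr_eq0 -lt0n (valid_n_gt0 vt).
rewrite -amulA amulZl (expect_local _ vt tc) scalerA -rmorphM mulfV // scale1r.
case/and3P: (vt) => _ _ t1; rewrite (big_rem 1%g t1) /= tact1 amulDr.
rewrite starM !amulA addrAC subrr add0r amul_sumr; apply: pos_sum => g.
have := pos_star_amul (V g x ** c).
by rewrite starM -tact_star !amulA -[star c ** _ ** V g x]amulA -tactM.
Qed.

Lemma expect_index x : nrm x ^+ 2 <= n%:R * nrm (E (star x ** x)).
Proof.
have b0 : 0 <= n%:R * nrm (E (star x ** x)) by rewrite mulr_ge0 ?nrm_ge0.
rewrite -(sqr_sqrtr b0) lerXn2r ?nnegrE ?sqrtr_ge0 ?nrm_ge0 //.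
apply: (local_nrm nd); first exact: sqrtr_ge0.
move=> t c vt tc.
rewrite -(@ler_pXn2r _ 2) ?nnegrE ?mulr_ge0 ?sqrtr_ge0 ?nrm_ge0 // exprMn sqr_sqrtr //.
apply: le_trans (pos_dominated (expect_dominates x vt tc)) _.
have -> : n%:R * nrm (E (star x ** x)) * nrm c ^+ 2 =
    nrm (star c) * (n%:R * nrm (E (star x ** x))) * nrm c.
  by rewrite nrm_star; ring.
apply: nrm_amul_le => //; apply: nrm_amul_le => //.
by rewrite nrmZr_ge0 ?ler0n.
Qed.

Lemma expect_faithful : faithful E.
Proof.
move=> a [x ->] Ex0; suff -> : x = 0 by rewrite amul0r.
apply/nrm0_eq0/eqP; rewrite -sqrf_eq0 eq_le sqr_ge0 andbT.
by have := expect_index x; rewrite Ex0 nrm0 mulr0.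
Qed.

Lemma expect_cond : conditional_expectation (fixed_algebra alpha) E.
Proof.
split.
- exact: expect_fixed.
- exact: expect_id.
- exact: expect_lin.
- by move=> a; rewrite le_nrm expect_contr.
- by move=> a [x ->]; apply/posP/expect_pos.
- by move=> b a; apply: expect_modl.
- by move=> b a; apply: expect_modr.
Qed.

Lemma expect_tact g x : E (V g x) = E (P g^-1%g x).
Proof.
apply: (badd_eq (badd_comp badd_expect (badd_tact nd g))
  (badd_comp badd_expect (badd_proj nd _)) (gens_dense nd)) => {}x [s vs sx].
have [gs|gs] := boolP (g^-1%g \in s); last first.
  by rewrite (tact_dom0 nd vs gs sx) (proj_dom nd _ vs sx) ifN.
rewrite (proj_dom nd _ vs sx) gs (expect_dom (valid_shift vs gs) (tact_dom nd gs sx)).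
rewrite (expect_dom vs sx) big_map; congr (_ *: _); rewrite !big_seq.
apply: eq_bigr => h hs; rewrite invgM tact_comp mulgVK.
have hs' : (h^-1)^-1%g \in s by rewrite invgK.
by apply: proj_id; apply: (tact_dom nd hs' sx); rewrite mem_shift invgK mulVKg.
Qed.

(** The adjoint of [x |-> a V_g x] for the inner product [E (x^* y)]. *)
Lemma expect_act_adjoint g a x y :
  E (star (a ** V g x) ** y) = E (star x ** V g^-1%g (star a ** y)).
Proof.
have -> : star x ** V g^-1%g (star a ** y) =
    V g^-1%g (V g (star x) ** (star a ** y)).
  by rewrite [RHS]tactM tactKV -mul_proj proj_id //; apply: tact_pdom.
rewrite expect_tact invgK proj_mull proj_id; last exact: tact_pdom.
by rewrite starM tact_star !amulA.
Qed.

(** Cauchy-Schwarz for the [A^G]-valued inner product [E (x^* y)]: with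
    [M = |E (x^* x)|] and [c = E (x^* y)], expand [E (v^* v)] for
    [v = x c - M y] and use [c^* E (x^* x) c <= M c^* c]. *)
Lemma expect_cauchy_schwarz x y :
  nrm (E (star x ** y)) ^+ 2 <= nrm (E (star x ** x)) * nrm (E (star y ** y)).
Proof.
set c := E (star x ** y); set X := E (star x ** x); set M := nrm X.
have fc : fixed_algebra alpha c by apply: expect_fixed.
have fsc := fixed_star fc.
have cE : star c = E (star y ** x) by rewrite /c -expect_star starM starK.
have [M0|] := boolP (0 < M); last first.
  rewrite -leNgt => /nrm_le0 X0; have x0 : star x ** x = 0.
    by apply: expect_faithful => //; exists x.
  by rewrite /c (star_amul_eq0 x0) star0 amul0l (badd0 badd_expect) nrm0 expr0n mulr_ge0 ?nrm_ge0.
have pX : pos X by apply: expect_pos.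
have sX := pos_selfadj pX.
have p1 : pos (M%:C *: (star c ** c) - star c ** X ** c).
  have [|w wl] := @sqlim_exists R A 1 (- (M^-1%:C *: X)) (one01 R).
    move=> z; rewrite expr1n subrr scale0r sub0r amulNl opprK amulZl.
    by rewrite nrmZr_gt0 ?invr_gt0 // ler_pdivrMl // nrm_amul.
  have sw : star w = w by apply: (sqlim_selfadj wl); rewrite starN starZr sX.
  have := sqlim_eq (one01 R) wl; rewrite mulr1 => ww.
  have -> : M%:C *: (star c ** c) - star c ** X ** c =
      M%:C *: (star (c + w ** c) ** (c + w ** c)).
    have {}ww : X = - (M%:C *: (2%:C *: w + w ** w)).
      by rewrite ww scalerN opprK scalerA -rmorphM mulfV ?scale1r // gt_eqF.
    by rewrite ww starD starM sw !amulE; lincomb.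
  by apply: posZ; [apply: ltW | apply: pos_star_amul].
pose v := x ** c - M%:C *: y.
have vv : E (star v ** v) = star c ** X ** c - (2 * M)%:C *: (star c ** c)
    + (M * M)%:C *: E (star y ** y).
  have -> : star v ** v = star c ** (star x ** x) ** c
     - M%:C *: (star c ** (star x ** y)) - M%:C *: (star y ** x ** c)
     + (M * M)%:C *: (star y ** y).
    by rewrite /v starD starN starZr starM !amulE; lincomb.
  rewrite !(baddD badd_expect) !(baddN badd_expect).
  have EZ k z : E (k *: z) = k *: E z.
    by rewrite -[k *: z]addr0 expect_lin (badd0 badd_expect) addr0.
  rewrite !EZ !(expect_modr _ fc) !(expect_modl _ fsc) -/c -/X -cE.
  by lincomb.
have : pos ((M%:C *: E (star y ** y)) - star c ** c).
  have := posZ (ltW (_ : 0 < M^-1)) (posD p1 (expect_pos v)).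
  rewrite vv invr_gt0 => /(_ M0).
  set Y := E _; set cc := star c ** c; set cXc := _ ** X ** c.
  have -> : M%:C *: cc - cXc + (cXc - (2 * M)%:C *: cc + (M * M)%:C *: Y) =
      M%:C *: (M%:C *: Y - cc) by lincomb.
  by rewrite scalerA -rmorphM mulVf ?scale1r // gt_eqF.
by move=> /pos_dominated; rewrite nrmZr_gt0.
Qed.

Lemma fixed_closed : closed (fixed_algebra alpha).
Proof.
have -> : fixed_algebra alpha = [set a | E a = a].
  apply/seteqP; split=> a /=; first exact: expect_id.
  by move=> <-; apply: expect_fixed.
exact: badd_closed_eq badd_expect (badd_id A).
Qed.

End Expectation.

(** * Adjointable operators *)

(** A Hilbert C*-module whose inner product induces a norm equivalent to the
    given one. The action of the coefficients enters only through the
    Cauchy-Schwarz inequality, so it does not appear. *)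
Record hilbert_form (R : realType) (H : completeNormedModType R[i])
    (C : cstarAlgType R) := HilbertForm {
  ip : H -> H -> C;
  ip_lin : forall x k y z, ip x (k *: y + z) = k *: ip x y + ip x z;
  ip_star : forall x y, star (ip x y) = ip y x;
  ip_le : forall x, nrm (ip x x) <= nrm x ^+ 2;
  ip_ge : exists K, forall x, nrm x ^+ 2 <= K * nrm (ip x x);
  ip_CS : forall x y, nrm (ip x y) ^+ 2 <= nrm (ip x x) * nrm (ip y y)
}.

Section HilbertForm.
Context (R : realType) (H : completeNormedModType R[i]) (C : cstarAlgType R).
Variable F : hilbert_form H C.
Implicit Types x y z : H.

Definition inrm x : R := Num.sqrt (nrm (ip F x x)).

Lemma inrm_ge0 x : 0 <= inrm x. Proof. exact: sqrtr_ge0. Qed.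

Lemma inrm_sq x : inrm x ^+ 2 = nrm (ip F x x).
Proof. by rewrite sqr_sqrtr ?nrm_ge0. Qed.

Lemma inrm_le x : inrm x <= nrm x.
Proof.
by rewrite -(@ler_pXn2r _ 2) ?nnegrE ?nrm_ge0 ?inrm_ge0 // inrm_sq ip_le.
Qed.

Lemma inrm_equiv : exists2 K, 0 < K & forall x, nrm x <= K * inrm x.
Proof.
have [K KH] := ip_ge F; exists (Num.sqrt (Num.max K 1)).
  by rewrite sqrtr_gt0 lt_max ltr01 orbT.
move=> x; rewrite -(@ler_pXn2r _ 2) ?nnegrE ?mulr_ge0 ?nrm_ge0 ?inrm_ge0 ?sqrtr_ge0 //.
rewrite exprMn inrm_sq sqr_sqrtr; last by rewrite le_max ler01 orbT.
by apply: le_trans (KH x) _; rewrite ler_wpM2r ?nrm_ge0 // le_max lexx.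
Qed.

Lemma inrm_CS x y : nrm (ip F x y) <= inrm x * inrm y.
Proof.
rewrite -(@ler_pXn2r _ 2) ?nnegrE ?mulr_ge0 ?nrm_ge0 ?inrm_ge0 //.
by rewrite exprMn !inrm_sq ip_CS.
Qed.

Lemma ipDr x y z : ip F x (y + z) = ip F x y + ip F x z.
Proof. by rewrite -[y]scale1r ip_lin !scale1r. Qed.
Lemma ip0r x : ip F x 0 = 0.
Proof. by apply: (@addIr _ (ip F x 0)); rewrite -ipDr !add0r. Qed.
Lemma ipZr x k y : ip F x (k *: y) = k *: ip F x y.
Proof. by rewrite -[k *: y]addr0 ip_lin ip0r addr0. Qed.
Lemma ipNr x y : ip F x (- y) = - ip F x y.
Proof. by rewrite -scaleN1r ipZr scaleN1r. Qed.
Lemma ipDl x y z : ip F (x + y) z = ip F x z + ip F y z.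
Proof. by rewrite -!(ip_star F z) ipDr starD. Qed.
Lemma ipZl k x z : ip F (k *: x) z = k^* *: ip F x z.
Proof. by rewrite -!(ip_star F z) ipZr starZ. Qed.
Lemma ipNl x z : ip F (- x) z = - ip F x z.
Proof. by rewrite -!(ip_star F z) ipNr starN. Qed.

Lemma inrm0 : inrm 0 = 0.
Proof. by rewrite /inrm ip0r nrm0 sqrtr0. Qed.

Lemma inrm_eq0 x : inrm x = 0 -> x = 0.
Proof.
by move=> x0; have [K _ KH] := inrm_equiv; apply: nrm_le0; rewrite -(mulr0 K) -x0.
Qed.

Lemma ip_eq0 x : (forall y, ip F x y = 0) -> x = 0.
Proof. by move=> /(_ x) x0; apply: inrm_eq0; rewrite /inrm x0 nrm0 sqrtr0. Qed.

Lemma inrmN x : inrm (- x) = inrm x.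
Proof. by rewrite /inrm ipNl ipNr opprK. Qed.

Lemma inrmZ k x : inrm (k *: x) = complex.Re `|k| * inrm x.
Proof.
have k0 : 0 <= complex.Re `|k| by rewrite -ler0c RRe_real // ger0_real.
apply/eqP; rewrite -(@eqrXn2 _ 2) ?mulr_ge0 ?inrm_ge0 //.
rewrite exprMn !inrm_sq ipZl ipZr !nrmZ norm_conjC mulrA expr2; exact/eqP.
Qed.

Lemma inrmD x y : inrm (x + y) <= inrm x + inrm y.
Proof.
rewrite -(@ler_pXn2r _ 2) ?nnegrE ?addr_ge0 ?inrm_ge0 //.
rewrite inrm_sq sqrrD !inrm_sq ipDl !ipDr.
have -> : nrm (ip F x x) + inrm x * inrm y *+ 2 + nrm (ip F y y) =
  (nrm (ip F x x) + inrm x * inrm y) + (inrm y * inrm x + nrm (ip F y y)).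
  by rewrite mulr2n [inrm y * _]mulrC !addrA.
by do 2?apply: nrmD_le; rewrite ?inrm_CS.
Qed.

Lemma inrm_dist x y z : inrm (x - z) <= inrm (x - y) + inrm (y - z).
Proof. by apply: le_trans (inrmD _ _); rewrite addrA subrK. Qed.

Record adjointable := Adjointable {
  afun : H -> H;
  aadj : H -> H;
  aadjP : forall x y, ip F (afun x) y = ip F x (aadj y);
  abound : exists M, forall x, inrm (afun x) <= M * inrm x
}.
Implicit Types S T : adjointable.

Lemma aadjP' T x y : ip F (aadj T x) y = ip F x (afun T y).
Proof. by rewrite -ip_star -aadjP ip_star. Qed.

Lemma afun_lin T k x y : afun T (k *: x + y) = k *: afun T x + afun T y.
Proof.
apply/subr0_eq/ip_eq0 => z.
rewrite ipDl ipNl !ipDl ipZl !aadjP !ipDl ipZl; lincomb.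
Qed.

(** Adjoints are unique because the form is nondegenerate. *)
Lemma adjointable_eq S T : (forall x, afun S x = afun T x) -> S = T.
Proof.
case: S T => [f f' fP fb] [h h' hP hb] /= /funext fh; subst h.
have e : f' = h'.
  apply/funext => x; apply/subr0_eq/ip_eq0 => z.
  by rewrite -ip_star ipDr ipNr -fP -hP subrr star0.
by subst h'; congr Adjointable; apply: Prop_irrelevance.
Qed.

Definition opnrm T : R := inf [set M | 0 <= M /\ forall x, inrm (afun T x) <= M * inrm x].

Lemma opnrm_has_inf T :
  has_inf [set M | 0 <= M /\ forall x, inrm (afun T x) <= M * inrm x].
Proof.
split; last by exists 0 => M [].
have [M TM] := abound T; exists (Num.max M 0); split; first by rewrite le_max lexx orbT.
move=> x; apply: le_trans (TM x) _.
by rewrite ler_wpM2r ?inrm_ge0 // le_max lexx.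
Qed.

Lemma opnrm_ge0 T : 0 <= opnrm T.
Proof. by apply: lb_le_inf => [|M []//]; have [] := opnrm_has_inf T. Qed.

Lemma opnrm_le T M : 0 <= M -> (forall x, inrm (afun T x) <= M * inrm x) ->
  opnrm T <= M.
Proof.
by move=> M0 TM; apply: ge_inf; [have [] := opnrm_has_inf T | split].
Qed.

Lemma opnrmP T x : inrm (afun T x) <= opnrm T * inrm x.
Proof.
have [x0|] := boolP (0 < inrm x); last first.
  rewrite -leNgt => x0.
  have {}x0 : inrm x = 0 by apply/le_anti; rewrite x0 inrm_ge0.
  by have [M] := abound T; move=> /(_ x); rewrite x0 !mulr0.
rewrite -ler_pdivrMr //; apply: lb_le_inf.
  by have [] := opnrm_has_inf T.
by move=> M [_ TM]; rewrite ler_pdivrMr.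
Qed.

Lemma aadj_opnrm T x : inrm (aadj T x) <= opnrm T * inrm x.
Proof.
have [x0|] := boolP (0 < inrm (aadj T x)); last first.
  rewrite -leNgt => x0; apply: le_trans x0 _.
  by rewrite mulr_ge0 ?inrm_ge0 ?opnrm_ge0.
rewrite -(ler_pM2l x0) -expr2 inrm_sq aadjP'.
apply: le_trans (inrm_CS _ _) _.
apply: le_trans (ler_wpM2l (inrm_ge0 _) (opnrmP _ _)) _.
by rewrite [leLHS](_ : _ = inrm (aadj T x) * (opnrm T * inrm x)) //; ring.
Qed.

Program Definition adj0 := @Adjointable (fun=> 0) (fun=> 0) _ _.
Next Obligation. by move=> x y; rewrite ip0r -ip_star ip0r star0. Qed.
Next Obligation. by exists 0 => x; rewrite inrm0 mul0r. Qed.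

Program Definition adjD S T := @Adjointable
  (fun x => afun S x + afun T x) (fun x => aadj S x + aadj T x) _ _.
Next Obligation. by move=> S T x y; rewrite ipDl ipDr !aadjP. Qed.
Next Obligation.
move=> S T; exists (opnrm S + opnrm T) => x.
by rewrite mulrDl; apply: le_trans (inrmD _ _) _; apply: lerD; apply: opnrmP.
Qed.

Program Definition adjN T := @Adjointable
  (fun x => - afun T x) (fun x => - aadj T x) _ _.
Next Obligation. by move=> T x y; rewrite ipNl ipNr !aadjP. Qed.
Next Obligation. by move=> T; exists (opnrm T) => x; rewrite inrmN opnrmP. Qed.

Program Definition adjZ (k : R[i]) T := @Adjointable
  (fun x => k *: afun T x) (fun x => k^* *: aadj T x) _ _.
Next Obligation. by move=> k T x y; rewrite ipZl ipZr !aadjP. Qed.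
Next Obligation.
move=> k T; exists (complex.Re `|k| * opnrm T) => x.
rewrite inrmZ -mulrA ler_wpM2l ?opnrmP //.
by rewrite -ler0c RRe_real // ger0_real.
Qed.

Program Definition adjM S T := @Adjointable
  (fun x => afun S (afun T x)) (fun x => aadj T (aadj S x)) _ _.
Next Obligation. by move=> S T x y; rewrite !aadjP. Qed.
Next Obligation.
move=> S T; exists (opnrm S * opnrm T) => x.
apply: le_trans (opnrmP _ _) _.
by rewrite -mulrA; apply: ler_wpM2l; rewrite ?opnrm_ge0 ?opnrmP.
Qed.

Program Definition adjS T := @Adjointable (aadj T) (afun T) _ _.
Next Obligation. by move=> T x y; rewrite aadjP'. Qed.
Next Obligation. by move=> T; exists (opnrm T); apply: aadj_opnrm. Qed.

End HilbertForm.

HB.instance Definition _ (R : realType) (H : completeNormedModType R[i])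
    (C : cstarAlgType R) (F : hilbert_form H C) := gen_eqMixin (adjointable F).
HB.instance Definition _ (R : realType) (H : completeNormedModType R[i])
    (C : cstarAlgType R) (F : hilbert_form H C) := gen_choiceMixin (adjointable F).

Section AdjointableStructure.
Context (R : realType) (H : completeNormedModType R[i]) (C : cstarAlgType R).
Variable F : hilbert_form H C.
Local Notation L := (adjointable F).
Implicit Types S T : L.

Fact adjDA : associative (@adjD R H C F).
Proof. by move=> S T U; apply: adjointable_eq => x /=; rewrite addrA. Qed.
Fact adjDC : commutative (@adjD R H C F).
Proof. by move=> S T; apply: adjointable_eq => x /=; rewrite addrC. Qed.
Fact adj0D : left_id (adj0 F) (@adjD R H C F).
Proof. by move=> S; apply: adjointable_eq => x /=; rewrite add0r. Qed.
Fact adjND : left_inverse (adj0 F) (@adjN R H C F) (@adjD R H C F).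
Proof. by move=> S; apply: adjointable_eq => x /=; rewrite addNr. Qed.

HB.instance Definition _ := GRing.isZmodule.Build L adjDA adjDC adj0D adjND.

Fact adjZA k l T : adjZ k (adjZ l T) = adjZ (k * l) T.
Proof. by apply: adjointable_eq => x /=; rewrite scalerA. Qed.
Fact adjZ1 : left_id 1 (@adjZ R H C F).
Proof. by move=> T; apply: adjointable_eq => x /=; rewrite scale1r. Qed.
Fact adjZDr : right_distributive (@adjZ R H C F) +%R.
Proof. by move=> k S T; apply: adjointable_eq => x /=; rewrite scalerDr. Qed.
Fact adjZDl T : {morph (@adjZ R H C F)^~ T : k l / k + l}.
Proof. by move=> k l; apply: adjointable_eq => x /=; rewrite scalerDl. Qed.

HB.instance Definition _ := GRing.Zmodule_isLmodule.Build R[i] L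
  adjZA adjZ1 adjZDr adjZDl.

Lemma opnrmD S T : opnrm (S + T) <= opnrm S + opnrm T.
Proof.
apply: opnrm_le => [|x]; first by rewrite addr_ge0 ?opnrm_ge0.
by rewrite mulrDl; apply: le_trans (inrmD _ _ _) _; apply: lerD; apply: opnrmP.
Qed.

Lemma opnrmZ_le k T : opnrm (k *: T) <= complex.Re `|k| * opnrm T.
Proof.
have k0 : 0 <= complex.Re `|k| by rewrite -ler0c RRe_real // ger0_real.
apply: opnrm_le => [|x]; first by rewrite mulr_ge0 ?opnrm_ge0.
by rewrite inrmZ -mulrA ler_wpM2l ?opnrmP.
Qed.

Lemma opnrm0_eq0 T : opnrm T = 0 -> T = 0.
Proof.
move=> T0; apply: adjointable_eq => x /=; apply: (inrm_eq0 (F := F)).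
by apply/le_anti; rewrite inrm_ge0 andbT; have := opnrmP T x; rewrite T0 mul0r.
Qed.

Lemma opnrmZ k T : opnrm (k *: T) = complex.Re `|k| * opnrm T.
Proof.
apply/le_anti; rewrite opnrmZ_le andTb.
have [->|k0] := eqVneq k 0; first by rewrite normr0 mul0r opnrm_ge0.
have nk : 0 < complex.Re `|k| by rewrite -ltcR RRe_real ?normr_gt0 // ger0_real.
rewrite -ler_pdivlMl //.
have -> : (complex.Re `|k|)^-1 = complex.Re `|k^-1|.
  apply: complexI; rewrite fmorphV !RRe_real ?normfV //; exact: ger0_real.
by apply: le_trans (opnrmZ_le _ _); rewrite scalerA mulVf // scale1r.
Qed.

Definition opnorm T : R[i] := (opnrm T)%:C.

Fact opnormD S T : opnorm (S + T) <= opnorm S + opnorm T.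
Proof. by rewrite -rmorphD lecR opnrmD. Qed.
Fact opnormZ k T : opnorm (k *: T) = `|k| * opnorm T.
Proof.
have kE : (complex.Re `|k|)%:C = `|k| by rewrite RRe_real // ger0_real.
by rewrite /opnorm opnrmZ -[in RHS]kE -rmorphM.
Qed.
Fact opnorm0_eq0 T : opnorm T = 0 -> T = 0.
Proof. by move=> /complexI; apply: opnrm0_eq0. Qed.

HB.instance Definition _ := @Lmodule_isNormed.Build R[i] L
  opnorm opnormD opnormZ opnorm0_eq0.

(** The limit is pointwise; adjoints converge along with the operators because
    they have the same norm. *)
Lemma adjointable_seq_complete (u : nat -> L) :
  (forall m k, (m <= k)%N -> opnrm (u m - u k) <= 2 / m.+1%:R) ->
  exists T, forall m, opnrm (u m - T) <= 2 / m.+1%:R.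
Proof.
move=> cu; have [K K0 KH] := inrm_equiv F.
have lim (f : L -> H -> H) :
    (forall T x, inrm F (f T x) <= opnrm T * inrm F x) ->
    (forall S T x, f (S - T) x = f S x - f T x) ->
    forall x, exists l, forall e, 0 < e -> exists N, forall m, (N <= m)%N ->
      nrm (f (u m) x - l) <= e.
  move=> fle fB x.
  pose d m := K * (2 / m.+1%:R * inrm F x).
  have d0 e : 0 < e -> exists N, forall m, (N <= m)%N -> d m <= e.
    move=> e0; exists (Num.bound (K * 2 * inrm F x / e)) => m Nm.
    rewrite /d !mulrA mulrAC ler_pdivrMr // [e * _]mulrC -ler_pdivrMr //.
    apply: le_trans (ltW (archi_boundP _)) _.
      by rewrite divr_ge0 ?(ltW e0) // !mulr_ge0 ?inrm_ge0 // ltW.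
    by rewrite ler_nat (leq_trans Nm).
  have [|l ul] := ncauchy_limit (u := fun m => f (u m) x) d0.
    move=> m k mk; rewrite -fB; apply: le_trans (KH _) _; rewrite ler_pM2l //.
    by apply: le_trans (fle _ _) _; rewrite ler_wpM2r ?inrm_ge0 ?cu.
  exists l => e e0; have [N Ne] := d0 e e0.
  by exists N => m Nm; apply: le_trans (ul m) (Ne m Nm).
have [|//|f fL] := choice (lim (@afun R H C F) _ _); first exact: opnrmP.
have [|//|h hL] := choice (lim (@aadj R H C F) _ _); first exact: aadj_opnrm.
have fle m x : inrm F (afun (u m) x - f x) <= 2 / m.+1%:R * inrm F x.
  apply/ler_addgt0Pr => e e0; have [N Ne] := fL x e e0.
  apply: le_trans (inrm_dist F _ (afun (u (maxn m N)) x) _) _; apply: lerD.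
    apply: le_trans (opnrmP (u m - u (maxn m N)) x) _.
    by rewrite ler_wpM2r ?inrm_ge0 // cu // leq_maxl.
  by apply: le_trans (inrm_le _ _) _; apply: Ne; rewrite leq_maxr.
have fP x y : ip F (f x) y = ip F x (h y).
  apply/subr0_eq/nrm_limit0 => e e0.
  have c0 : 0 < inrm F x + inrm F y + 1.
    by rewrite ltr_wpDl // addr_ge0 ?inrm_ge0.
  have e'0 := divr_gt0 e0 c0.
  have [N1 H1] := fL x _ e'0; have [N2 H2] := hL y _ e'0.
  have := H1 (maxn N1 N2) (leq_maxl _ _); have := H2 (maxn N1 N2) (leq_maxr _ _).
  set v := u _ => hv fv.
  have -> : ip F (f x) y - ip F x (h y) =
      ip F x (aadj v y - h y) - ip F (afun v x - f x) y.
    by rewrite ipDr ipDl ipNr ipNl -aadjP; lincomb.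
  apply: le_trans (nrmB_le (inrm_CS _ _ _) (inrm_CS _ _ _)) _.
  have A1 := ler_wpM2l (inrm_ge0 F x) (le_trans (inrm_le F _) hv).
  have A2 := ler_wpM2r (inrm_ge0 F y) (le_trans (inrm_le F _) fv).
  apply: le_trans (lerD A1 A2) _.
  rewrite [_ / _ * _]mulrC -mulrDl mulrCA ger_pMr // ler_pdivrMr // mul1r.
  by rewrite lerDl.
have fb : exists M, forall x, inrm F (f x) <= M * inrm F x.
  exists (opnrm (u 0) + 2 / 1%:R) => x.
  rewrite mulrDl; have := inrm_dist F (f x) (afun (u 0) x) 0.
  rewrite !subr0 => /le_trans; apply; rewrite addrC lerD ?opnrmP //.
  by rewrite -inrmN opprB fle.
exists (Adjointable fP fb) => m; apply: opnrm_le => [|x]; first by rewrite divr_ge0.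
exact: fle.
Qed.

Lemma adjointable_complete (X : set_system L) :
  ProperFilter X -> cauchy X -> cvg X.
Proof.
move=> PX cX.
have cX' (e : R) : 0 < e -> exists T, X [set S | opnrm (T - S) <= e].
  move=> e0; have e0' : 0 < e%:C by rewrite ltcR.
  have /cauchyP/(_ _ e0')[T XT] := cX.
  exists T; apply: filterS XT => S; rewrite -ball_normE /= => TS.
  by rewrite -lecR; apply: ltW.
have /choice[u uX] : forall m : nat, exists T, X [set S | opnrm (T - S) <= 1 / m.+1%:R].
  by move=> m; apply: cX'.
have oB S T : opnrm (S - T) = opnrm (T - S) := nrmBC S T.
have [|T uT] := adjointable_seq_complete (u := u).
  move=> m k mk; have [S [/= mS kS]] := filter_ex (filterI (uX m) (uX k)).
  have -> : u m - u k = (u m - S) + (S - u k) by rewrite addrA subrK.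
  apply: le_trans (opnrmD _ _) _.
  rewrite (_ : 2 / _ = 1 / m.+1%:R + 1 / m.+1%:R); last by rewrite -mulrDl.
  apply: lerD => //; rewrite oB; apply: le_trans kS _.
  by rewrite !div1r lef_pV2 ?posrE // ler_nat.
apply/cvg_ex; exists T; apply/cvg_ballP => e e0.
have eE : e = (complex.Re e)%:C by rewrite RRe_real // gtr0_real.
have e'0 : 0 < complex.Re e by rewrite -ltcR -eE.
set m := Num.bound (3 / complex.Re e).
apply: filterS (uX m) => S /= mS; rewrite -ball_normE /= eE ltcR.
have -> : T - S = (T - u m) + (u m - S) by rewrite addrA subrK.
apply: le_lt_trans (opnrmD _ _) _; rewrite oB.
apply: le_lt_trans (lerD (uT m) mS) _.
rewrite -mulrDl ltr_pdivrMr // mulrC -ltr_pdivrMr //.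
rewrite (_ : 2 + 1 = 3) ?natr1 //; apply: lt_le_trans (archi_boundP _) _.
  by rewrite divr_ge0 // ltW.
by rewrite ler_nat leqnSn.
Qed.

HB.instance Definition _ := Uniform_isComplete.Build L adjointable_complete.

Fact adjMA : associative (@adjM R H C F).
Proof. by move=> S T U; apply: adjointable_eq. Qed.
Fact adjMDl : left_distributive (@adjM R H C F) +%R.
Proof. by move=> S T U; apply: adjointable_eq. Qed.
Fact adjMDr : right_distributive (@adjM R H C F) +%R.
Proof.
move=> S T U; apply: adjointable_eq => x /=.
by have := afun_lin S 1 (afun T x) (afun U x); rewrite !scale1r.
Qed.
Fact adjMZl k S T : adjM (k *: S) T = k *: adjM S T.
Proof. exact: adjointable_eq. Qed.
Lemma afunZ S k x : afun S (k *: x) = k *: afun S x.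
Proof.
have := afun_lin S k x 0; rewrite addr0 => ->.
by have := afun_lin S (-1) 0 0; rewrite !scaleN1r !addNr => ->; rewrite addr0.
Qed.
Fact adjMZr k S T : adjM S (k *: T) = k *: adjM S T.
Proof. by apply: adjointable_eq => x /=; apply: afunZ. Qed.
Fact adjSK : involutive (@adjS R H C F).
Proof. by move=> S; apply: adjointable_eq. Qed.
Fact adjSD : {morph @adjS R H C F : S T / S + T}.
Proof. by move=> S T; apply: adjointable_eq. Qed.
Fact adjSZ k S : adjS (k *: S) = k^* *: adjS S.
Proof. exact: adjointable_eq. Qed.
Fact adjSM S T : adjS (adjM S T) = adjM (adjS T) (adjS S).
Proof. exact: adjointable_eq. Qed.

Lemma opnrm_adjM S T : opnrm (adjM S T) <= opnrm S * opnrm T.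
Proof.
apply: opnrm_le => [|x]; first by rewrite mulr_ge0 ?opnrm_ge0.
apply: le_trans (opnrmP S (afun T x)) _.
by rewrite -mulrA; apply: ler_wpM2l; rewrite ?opnrm_ge0 ?opnrmP.
Qed.

Fact norm_adjM S T : `|adjM S T| <= `|S| * `|T|.
Proof. by rewrite -[leRHS](rmorphM (real_complex R)) lecR opnrm_adjM. Qed.

Fact norm_adjSM S : `|adjM (adjS S) S| = `|S| ^+ 2.
Proof.
rewrite -[RHS](rmorphXn (real_complex R)); congr (_%:C); apply/le_anti.
apply/andP; split.
  rewrite expr2; apply: le_trans (opnrm_adjM _ _) _.
  rewrite ler_wpM2r ?opnrm_ge0 //.
  exact: (@opnrm_le _ _ _ F (adjS S) (opnrm S) (opnrm_ge0 S) (aadj_opnrm S)).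
have o0 := opnrm_ge0 (adjM (adjS S) S).
rewrite -(sqr_sqrtr o0) lerXn2r ?nnegrE ?sqrtr_ge0 ?opnrm_ge0 //.
apply: opnrm_le => [|x]; first exact: sqrtr_ge0.
rewrite -(@ler_pXn2r _ 2) ?nnegrE ?mulr_ge0 ?sqrtr_ge0 ?inrm_ge0 //.
rewrite exprMn (sqr_sqrtr o0) inrm_sq aadjP.
apply: le_trans (inrm_CS _ _ _) _; rewrite expr2 mulrCA ler_wpM2l ?inrm_ge0 //.
exact: (opnrmP (adjM (adjS S) S)).
Qed.

HB.instance Definition _ := @CompleteNormedModule_isCStarAlgebra.Build R L
  (@adjM R H C F) (@adjS R H C F) adjMA adjMDl adjMDr adjMZl adjMZr
  adjSK adjSD adjSZ adjSM norm_adjM norm_adjSM.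

End AdjointableStructure.

(** * Crossed products *)

Lemma fsum_seq (V : zmodType) (I : choiceType) (s : seq I) (F : I -> V) :
  uniq s -> (forall i, i \notin s -> F i = 0) ->
  \sum_(i \in [set: I]) F i = \sum_(i <- s) F i.
Proof.
move=> us F0; rewrite [RHS]fsbig_seq //; apply/esym.
by apply: fsbig_widen => // i [_ /= /negP si]; apply: F0.
Qed.

Section CrossedProduct.
Context (R : realType) (G : groupType) (A : cstarAlgType R).
Variables (alpha : partial_action G A) (n : nat).
Hypothesis nd : n_decomposition alpha n.
Implicit Types (g h k : G) (s t : seq G) (a b c x y : A) (f : G -> A).

Local Notation D := (pdom alpha).
Local Notation V := (tact nd).
Local Notation P := (proj nd).
Local Notation alg := (alg_crossed alpha).

Lemma alg_support f : alg f -> exists2 s, uniq s & forall g, g \notin s -> f g = 0.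
Proof.
move=> [/finite_seqP[s fs] _]; exists (undup s); first exact: undup_uniq.
move=> g; rewrite mem_undup => gs; apply: contrapT => /eqP fg.
by have : [set` s] g; [rewrite -fs | move=> /= gs'; rewrite gs' in gs].
Qed.

Lemma alg_of_support f s : (forall g, g \notin s -> f g = 0) ->
  (forall g, D g (f g)) -> alg f.
Proof.
move=> f0 Df; split=> //; apply: (@sub_finite_set _ _ [set` s]); last exact: finite_seq.
by move=> g /= /eqP fg; apply: contrapT => /negP/f0.
Qed.

Lemma act_mul g a y : D g a ->
  pact alpha g (pact alpha g^-1%g a ** y) = a ** V g y.
Proof.
move=> Da; have Da' : D (g^-1)^-1%g a by rewrite invgK.
rewrite -(tact_pdomE nd Da') -(tact_pdomE nd); last exact/pdom_mulr/tact_pdom.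
by rewrite tactM tactK proj_id.
Qed.

Lemma crossed_mulE f f' s k : alg f -> uniq s -> (forall g, g \notin s -> f g = 0) ->
  crossed_mul alpha f f' k = \sum_(g <- s) f g ** V g (f' (g^-1 * k)%g).
Proof.
move=> [_ Df] us f0; rewrite -(fsum_seq us) => [|g /f0 ->]; last exact: amul0l.
by apply: eq_fsbigr => g _; apply: act_mul.
Qed.

Lemma crossed_starE f k : alg f ->
  crossed_star alpha f k = V k (star (f k^-1%g)).
Proof. by move=> [_ Df]; rewrite tact_pdomE //; apply: (pdom_star nd). Qed.

Definition delta g a : G -> A := fun k => if k == g then a else 0.

Lemma delta_support g a h : h \notin [:: g] -> delta g a h = 0.
Proof. by rewrite inE /delta => /negbTE ->. Qed.

Lemma alg_delta g a : D g a -> alg (delta g a).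
Proof.
move=> Da; apply: (alg_of_support (@delta_support g a)) => h.
by rewrite /delta; case: eqP => [->|_] //; apply: pdom0.
Qed.

Variables (B : cstarAlgType R) (iota : (G -> A) -> B).
Hypothesis cp : is_crossed_product alpha iota.
Implicit Types (u v w : B).

(** The element [a delta_g] of the crossed product, for [a] cut down to [A_g]. *)
Definition cross g a : B := iota (delta g (P g a)).
Local Notation U := cross.

Lemma cross_lin g z a b : U g (z *: a + b) = z *: U g a + U g b.
Proof.
have [[iota_lin _ _] _ _] := cp.
rewrite /U -iota_lin; [|exact/alg_delta/proj_pdom..].
congr iota; apply/funext => k; rewrite [RHS](_ : _ =
  z *: delta g (P g a) k + delta g (P g b) k) // /delta proj_lin.
by case: eqP => // _; rewrite scaler0 addr0.
Qed.

Lemma crossD g a b : U g (a + b) = U g a + U g b.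
Proof. by rewrite -[a]scale1r cross_lin !scale1r. Qed.

Lemma cross0 g : U g 0 = 0.
Proof. by apply: (@addIr _ (U g 0)); rewrite -crossD !add0r. Qed.

Lemma crossZ g z a : U g (z *: a) = z *: U g a.
Proof. by rewrite -[z *: a]addr0 cross_lin cross0 addr0. Qed.

Lemma cross_proj g a : U g (P g a) = U g a.
Proof. by rewrite /U projK. Qed.

Lemma cross_mul g h a b : U g a ** U h b = U (g * h)%g (a ** V g b).
Proof.
have [[_ iotaM _] _ _] := cp.
rewrite /U -iotaM; [|exact/alg_delta/proj_pdom..].
congr iota; apply/funext => k.
rewrite (crossed_mulE _ _ (alg_delta (proj_pdom nd g a)) _ (@delta_support g _)) //.
rewrite big_seq1 /delta eqxx -(inj_eq (mulgI g)) mulVKg.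
case: eqP => _; last by rewrite (badd0 (badd_tact nd g)) amul0r.
have := proj_tact nd (g * h)%g g b; rewrite mulKg => <-.
by rewrite -proj_mulr -mul_proj [P g (V g b)]proj_id //; apply: tact_pdom.
Qed.

Lemma cross_star g a : star (U g a) = U g^-1%g (V g^-1%g (star a)).
Proof.
have [[_ _ iotaS] _ _] := cp.
rewrite /U -iotaS; last exact/alg_delta/proj_pdom.
congr iota; apply/funext => k.
rewrite crossed_starE; last exact/alg_delta/proj_pdom.
rewrite /delta -(inj_eq invg_inj) invgK; case: eqP => [->|_]; last first.
  by rewrite star0 (badd0 (badd_tact nd k)).
rewrite -proj_star [P _ (V _ _)]proj_id; last exact: tact_pdom.
by rewrite -[X in proj nd X]invgK tact_proj.
Qed.

Lemma cross1_contr a : nrm (U 1%g a) <= nrm a.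
Proof.
apply: (@star_hom_contractive R A B setT) => //.
split=> [z x y _ _|x y _ _|x _]; first exact: cross_lin.
  by rewrite cross_mul mulg1 tact1.
by rewrite cross_star invg1 tact1.
Qed.

Lemma cross_contr g a : nrm (U g a) <= nrm a.
Proof.
rewrite -(@ler_pXn2r _ 2) ?nnegrE ?nrm_ge0 // -nrm_amul_star cross_star cross_mul.
rewrite mulgV tactK; apply: le_trans (cross1_contr _) _.
by rewrite expr2; apply: nrm_amul_le => //; rewrite -[leRHS]nrm_star proj_contr.
Qed.

Lemma badd_cross g : badd (U g).
Proof. by apply: badd_contr (cross_contr g); apply: crossD. Qed.

Lemma iota_sum f s : alg f -> uniq s -> (forall g, g \notin s -> f g = 0) ->
  iota f = \sum_(g <- s) U g (f g).
Proof.
have [[iota_lin _ _] _ _] := cp.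
elim: s f => [|g s IH] f af /=.
  move=> _ f0; rewrite big_nil; have -> : f = delta 1%g (P 1%g 0).
    by apply/funext => h; rewrite f0 // /delta (badd0 (badd_proj nd _)); case: eqP.
  exact: cross0.
move=> /andP[gs us] f0; rewrite big_cons.
pose f' k := if k == g then 0 else f k.
have af' : alg f'.
  apply: (@alg_of_support _ s) => k; rewrite /f'; case: eqP => // kg.
  - by move=> ks; apply: f0; rewrite inE negb_or ks andbT; apply/eqP.
  - exact: pdom0.
  - by case: af.
have Dg : D g (f g) by case: af.
have -> : \sum_(k <- s) U k (f k) = \sum_(k <- s) U k (f' k).
  rewrite !big_seq; apply: eq_bigr => k ks; rewrite /f'.
  by case: eqP => // kg; rewrite -kg ks in gs.
rewrite -IH // => [|k ks]; last first.
  by rewrite /f'; case: eqP => // /eqP kg; apply: f0; rewrite inE negb_or kg.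
rewrite /U proj_id // -[iota (delta _ _)]scale1r -iota_lin //; last exact: alg_delta.
congr iota; apply/funext => k.
rewrite [RHS](_ : _ = 1 *: delta g (f g) k + f' k) // scale1r /delta /f'.
by case: eqP => [->|_]; rewrite ?addr0 ?add0r.
Qed.

Definition cross_gens : set B :=
  [set u | exists s g a, [/\ valid n s, g \in s, dom alpha s a & u = U g a]].

Lemma cross_gens_dense : ndense (addspan cross_gens).
Proof.
pose T u := forall e, 0 < e -> exists2 v, addspan cross_gens v & nrm (u - v) <= e.
have TD u v : T u -> T v -> T (u + v).
  move=> Tu Tv e e0; have e20 : 0 < e / 2 by rewrite divr_gt0.
  have [u' su uu'] := Tu _ e20; have [v' sv vv'] := Tv _ e20.
  exists (u' + v'); first exact: addspan_add.
  by rewrite opprD addrACA [leRHS]splitr; apply: nrmD_le.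
have T0 : T 0 by move=> e e0; exists 0; [exact: addspan0 | rewrite subrr nrm0 ltW].
have TU g a : T (U g a).
  move=> e e0; have [y sy ay] := gens_dense nd a e0.
  exists (U g y); last first.
    by rewrite -(baddB (badd_cross g)); apply: le_trans (cross_contr _ _) _.
  elim: sy => [|b y' [s vs sb] _ IH]; first by rewrite cross0; apply: addspan0.
  rewrite crossD; apply: addspan_add => //.
  have [gs|gs] := boolP (g \in s); first by apply: addspan1; exists s, g, b.
  by rewrite -cross_proj (proj_dom nd _ vs sb) (negbTE gs) cross0; apply: addspan0.
have [_ clB _] := cp.
move=> u e e0; have e20 : 0 < e / 2 by rewrite divr_gt0.
have [v [f af <-] uv] := closure_ndense clB u e20.
have Tf : T (iota f).
  have [s us f0] := alg_support af; rewrite (iota_sum af us f0).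
  by elim/big_rec: _ => // g w _; apply: TD.
have [w sw vw] := Tf _ e20; exists w => //.
by apply: le_trans (nrm_dist _ (iota f) _) _; rewrite [leRHS]splitr; apply: lerD.
Qed.

(** ** The projection [p = n^-1 sum_g 1_g delta_g] *)

Local Notation nu := ((n%:R^-1 : R)%:C).

(** The product [p (a delta_g)] for [a] in [A_s]: the term of index [h^-1]
    vanishes unless [h] belongs to [s]. *)
Definition lproj s g a : B := nu *: \sum_(h <- s) U (h^-1 * g)%g (V h^-1%g a).

Definition lproj_gen u v := exists s g a,
  [/\ valid n s, g \in s, dom alpha s a, u = U g a & v = lproj s g a].

Lemma tact_comp_dom s a h k : valid n s -> dom alpha s a -> h \in s -> k \in s ->
  V (k^-1 * h)%g (V h^-1%g a) = V k^-1%g a.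
Proof.
move=> vs sa hs ks; rewrite tact_comp mulgK; apply: proj_id.
have ks' : (k^-1)^-1%g \in s by rewrite invgK.
by apply: (tact_dom nd ks' sa); rewrite mem_shift invgK mulVKg.
Qed.

(** [p] is self-adjoint: both products are sums over the [h] in [s] whose
    inverse belongs to [t]. *)
Lemma lproj_sym_gen u v u' v' : lproj_gen u v -> lproj_gen u' v' ->
  star v ** u' = star u ** v'.
Proof.
move=> [s [g [a [vs gs sa -> ->]]]] [t [k [b [vt kt tb -> ->]]]].
rewrite starZr star_sum amulZl amul_suml amulZr amul_sumr; congr (_ *: _).
pose Phi h := U (g^-1 * (h * k))%g (V g^-1%g (star a ** V h b)).
have sa' := dom_star nd sa.
transitivity (\sum_(h <- s) Phi h).
  rewrite !big_seq; apply: eq_bigr => h hs; rewrite cross_star cross_mul /Phi.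
  rewrite invgM invgK -tact_star -tactM mulgA; congr (U _ _).
  have hs' : (h^-1)^-1%g \in s by rewrite invgK.
  have := tact_comp nd g^-1%g h (V h^-1%g (star a) ** b).
  rewrite tactM tactK (proj_id nd (sa' _ hs)) => ->.
  apply/esym/proj_id; set y := _ ** b.
  have ys : dom alpha (shift h^-1%g s) y by apply/dom_mulr/tact_dom.
  have gh : ((g^-1 * h)^-1)%g \in shift h^-1%g s.
    by rewrite mem_shift invgM !invgK mulVKg.
  apply: (tact_dom nd gh ys); rewrite mem_shift mem_shift invgM !invgK.
  by rewrite mulgK mulgV; case/and3P: vs.
transitivity (\sum_(h <- [seq h^-1%g | h <- t]) Phi h).
  case/and3P: (vs) => us _ _; case/and3P: (vt) => ut _ _.
  apply: eq_sum_support => //.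
  - by rewrite map_inj_uniq //; apply: invg_inj.
  - move=> h _ ht; rewrite /Phi (tact_dom0 nd vt _ tb) ?amul0r.
      by rewrite (badd0 (badd_tact _ _)) cross0.
    by apply: contra ht => ht; apply/mapP; exists h^-1%g; rewrite ?invgK.
  - move=> h _ hs; rewrite /Phi (dom_mul_pdom nd vs hs sa' (tact_pdom nd h b)).
    by rewrite (badd0 (badd_tact _ _)) cross0.
rewrite big_map; apply: eq_bigr => h _.
by rewrite cross_star cross_mul /Phi tactM.
Qed.

Lemma lproj_sym u v u' v' : linspan lproj_gen u v -> linspan lproj_gen u' v' ->
  star v ** u' = star u ** v'.
Proof.
move=> uv; elim=> [|z u1 v1 u2 v2 uv1 _ IH]; first by rewrite !amul0r.
rewrite !amulDr !amulZr IH; congr (_ *: _ + _).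
elim: uv => [|z' u3 v3 u4 v4 uv3 _ IH']; first by rewrite star0 !amul0l.
rewrite !starD !starZ !amulDl !amulZl IH'; congr (_ *: _ + _).
exact: lproj_sym_gen.
Qed.

Lemma linspan_sum (I : eqType) (r : seq I) (F F' : I -> B) Gn :
  (forall i, i \in r -> linspan Gn (F i) (F' i)) ->
  linspan Gn (\sum_(i <- r) F i) (\sum_(i <- r) F' i).
Proof.
elim: r => [|i r IH] H; first by rewrite !big_nil; apply: linspan0.
rewrite !big_cons -[F i]scale1r -[F' i]scale1r; apply: linspan_lin.
  by apply: H; rewrite mem_head.
by apply: IH => j jr; apply: H; rewrite inE jr orbT.
Qed.

(** The translates of [a], moved to [B], all have the same image under [p];
    this makes [p] idempotent. *)
Lemma lproj_shift s g a h : valid n s -> dom alpha s a -> h \in s ->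
  lproj (shift h^-1%g s) (h^-1 * g)%g (V h^-1%g a) = lproj s g a.
Proof.
move=> vs sa hs; rewrite /lproj big_map; congr (_ *: _).
rewrite !big_seq; apply: eq_bigr => k ks.
by rewrite invgM invgK (tact_comp_dom vs) // mulgA mulgK.
Qed.

Lemma shift_gen s g a h : valid n s -> g \in s -> dom alpha s a -> h \in s ->
  lproj_gen (U (h^-1 * g)%g (V h^-1%g a)) (lproj s g a).
Proof.
move=> vs gs sa hs; have hs' : (h^-1)^-1%g \in s by rewrite invgK.
exists (shift h^-1%g s), (h^-1 * g)%g, (V h^-1%g a); split=> //.
- exact: valid_shift.
- by rewrite mem_shift mulKg.
- exact: tact_dom.
- by rewrite lproj_shift.
Qed.

Lemma lproj_idem u v : linspan lproj_gen u v -> linspan lproj_gen v v.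
Proof.
elim=> [|z u1 v1 u2 v2 [s [g [a [vs gs sa _ ->]]]] _ IH]; first exact: linspan0.
apply: linspan_lin => //.
rewrite {1}/lproj -[X in linspan _ _ X](nu_avg _ vs).
rewrite -[nu *: \sum_(h <- s) U _ _]addr0 -[nu *: \sum_(h <- s) lproj _ _ _]addr0.
apply: linspan_lin; last exact: linspan0.
by apply: linspan_sum => h hs; apply: linspan1; apply: shift_gen.
Qed.

(** For a self-adjoint idempotent, [|p u|^2 = |u^* p u| <= |u| |p u|]; this is
    the contractivity that makes [p] well defined. *)
Lemma pl_exists : exists pl : B -> B,
  [/\ forall z u v, pl (z *: u + v) = z *: pl u + pl v,
      forall u, nrm (pl u) <= nrm u &
      forall u v, linspan lproj_gen u v -> pl u = v].
Proof.
apply: contraction_extension.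
- by move=> z u v u' v'; apply: linspan_lin.
- move=> u v uv; have [v0|] := boolP (0 < nrm v); last first.
    by rewrite -leNgt => v0; apply: le_trans v0 (nrm_ge0 _).
  rewrite -(ler_pM2r v0) -expr2 -nrm_star_amul (lproj_sym uv (lproj_idem uv)).
  by have := nrm_amul (star u) v; rewrite nrm_star.
- move=> u e e0; have [v vspan uv] := cross_gens_dense u e0; exists v => //.
  elim: vspan => [|w1 w2 [s [g [a [vs gs sa ->]]]] _ [w' ww']].
    by exists 0; apply: linspan0.
  exists (1 *: lproj s g a + w'); rewrite -[U g a]scale1r.
  by apply: linspanD => //; exists s, g, a.
Qed.

Definition pl : B -> B := projT1 (cid pl_exists).

Lemma pl_lin z u v : pl (z *: u + v) = z *: pl u + pl v.
Proof. by rewrite /pl; case: cid => F []. Qed.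
Lemma pl_contr u : nrm (pl u) <= nrm u.
Proof. by rewrite /pl; case: cid => F []. Qed.
Lemma pl_cross s g a : valid n s -> g \in s -> dom alpha s a ->
  pl (U g a) = lproj s g a.
Proof.
move=> vs gs sa; rewrite /pl; case: cid => F [_ _ H] /=.
by apply: H; apply: linspan1; exists s, g, a.
Qed.

Lemma badd_pl : badd pl.
Proof.
apply: badd_contr pl_contr => x y.
by rewrite -[x]scale1r pl_lin !scale1r.
Qed.

Lemma plZ z u : pl (z *: u) = z *: pl u.
Proof. by rewrite -[z *: u]addr0 pl_lin (badd0 badd_pl) addr0. Qed.

Lemma pl_sym u v : star (pl u) ** v = star u ** pl v.
Proof.
apply: (badd_eq (badd_comp (badd_amulr v) (badd_comp (badd_star B) badd_pl))
  (badd_comp (badd_amulr (pl v)) (badd_star B)) cross_gens_dense) => {}u.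
move=> [s [g [a [vs gs sa ->]]]].
apply: (badd_eq (badd_amull _) (badd_comp (badd_amull _) badd_pl)
  cross_gens_dense) => {}v [t [k [b [vt kt tb ->]]]].
rewrite (pl_cross vs gs sa) (pl_cross vt kt tb); apply: lproj_sym_gen.
  by exists s, g, a.
by exists t, k, b.
Qed.

Lemma plK u : pl (pl u) = pl u.
Proof.
apply: (badd_eq (badd_comp badd_pl badd_pl) badd_pl cross_gens_dense) => {}u.
move=> [s [g [a [vs gs sa ->]]]]; rewrite (pl_cross vs gs sa).
rewrite {1}/lproj plZ (badd_sum badd_pl) -[RHS](nu_avg _ vs); congr (_ *: _).
rewrite !big_seq; apply: eq_bigr => h hs.
have [t [k [b [vt kt tb -> ->]]]] := shift_gen vs gs sa hs.
exact: pl_cross.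
Qed.

Lemma amul_injl u v : (forall w, star w ** u = star w ** v) -> u = v.
Proof.
move=> H; apply/subr0_eq/star_amul_eq0.
by rewrite amulDr amulNr H subrr.
Qed.

Lemma plM u v : pl (u ** v) = pl u ** v.
Proof.
apply: amul_injl => w.
by rewrite -pl_sym !amulA pl_sym.
Qed.

(** Right multiplication by [p]. *)
Definition pr u := star (pl (star u)).

Lemma badd_pr : badd pr.
Proof. exact: badd_comp (badd_star B) (badd_comp badd_pl (badd_star B)). Qed.

Lemma pr_lin z u v : pr (z *: u + v) = z *: pr u + pr v.
Proof. by rewrite /pr starD starZ pl_lin starD starZ conjCK. Qed.

Lemma prZ z u : pr (z *: u) = z *: pr u.
Proof. by rewrite -[z *: u]addr0 pr_lin (badd0 badd_pr) addr0. Qed.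

Lemma prM u v : pr (u ** v) = u ** pr v.
Proof. by rewrite /pr starM plM starM starK. Qed.

Lemma prl u v : pr u ** v = u ** pl v.
Proof. by rewrite /pr pl_sym starK. Qed.

Lemma prK u : pr (pr u) = pr u.
Proof. by rewrite /pr starK plK. Qed.

Lemma pl_pr u : pl (pr u) = pr (pl u).
Proof. by apply: amul_injl => w; rewrite -pl_sym -!prM pl_sym. Qed.

Program Definition proj_mult : multiplier B :=
  @Build_multiplier R B pl pr pl_lin pr_lin _ _ plM prM prl.
Next Obligation. by exists 1 => u; rewrite mul1r le_nrm pl_contr. Qed.
Next Obligation.
by exists 1 => u; rewrite mul1r le_nrm /pr nrm_star -[leRHS]nrm_star pl_contr.
Qed.

Lemma proj_mult_projection : mult_projection proj_mult.
Proof.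
split; apply/funext => u /=; [exact: plK | exact: prK | | by []].
by rewrite /pr !starK.
Qed.

(** ** The embedding of the fixed point algebra *)

(** The product [a p]. *)
Definition fixed_emb a : B := pr (U 1%g a).
Local Notation c := fixed_emb.
Local Notation E := (expect nd).

Lemma badd_fixed_emb : badd c.
Proof. exact: badd_comp badd_pr (badd_cross 1%g). Qed.

Lemma fixed_embZ z a : c (z *: a) = z *: c a.
Proof. by rewrite /c crossZ prZ. Qed.

(** [(a delta_g) p = a p] for [a] in [A_g]: up to adjoints, both are the image
    under [p] of translates of the same element. *)
Lemma pr_cross g a : pr (U g a) = c (P g a).
Proof.
apply: (badd_eq (badd_comp badd_pr (badd_cross g))
  (badd_comp badd_fixed_emb (badd_proj nd g)) (gens_dense nd)) => {}a [s vs sa].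
rewrite (proj_dom nd g vs sa); case: ifPn => gs; last first.
  rewrite -cross_proj (proj_dom nd g vs sa) (negbTE gs) cross0.
  by rewrite (badd0 badd_pr) (badd0 badd_fixed_emb).
rewrite /c /pr !cross_star invg1 tact1; congr star.
have s1 : 1%g \in s by case/and3P: vs.
have [t [k [b [vt kt tb e1 e2]]]] := shift_gen vs s1 (dom_star nd sa) gs.
rewrite (pl_cross vs s1 (dom_star nd sa)) e2 -(pl_cross vt kt tb) -e1.
by rewrite mulg1.
Qed.

(** [p a p = E a p], since [p a] is the mean of the [V_(h^-1) a delta_(h^-1)]. *)
Lemma pl_fixed_emb a : pl (c a) = c (E a).
Proof.
rewrite /c pl_pr.
apply: (badd_eq (badd_comp badd_pr (badd_comp badd_pl (badd_cross 1%g)))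
  (badd_comp badd_fixed_emb (badd_expect nd)) (gens_dense nd)) => {}a [s vs sa].
have s1 : 1%g \in s by case/and3P: vs.
rewrite (pl_cross vs s1 sa) (expect_dom nd vs sa) fixed_embZ prZ; congr (_ *: _).
rewrite (badd_sum badd_pr) (badd_sum badd_fixed_emb); apply: eq_bigr => h _.
by rewrite mulg1 pr_cross proj_id //; apply: tact_pdom.
Qed.

(** [p] commutes with [A^G]: both [a p] and [p a] are equal to [p a p], the
    second by passing to adjoints. *)
Lemma fixed_embE a : fixed_algebra alpha a -> c a = pl (U 1%g a).
Proof.
move=> fa; have fsa := fixed_star nd fa.
have := pl_fixed_emb (star a); rewrite (expect_id nd fsa) => H.
have := congr1 star H; rewrite /c /pr cross_star invg1 tact1 !starK => <-.
by rewrite -[RHS]/(pr (pl (U 1%g a))) -pl_pr -/(c a) pl_fixed_emb expect_id.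
Qed.

Lemma fixed_emb_hom : cstar_hom_on (fixed_algebra alpha) c.
Proof.
split=> [z a b _ _|a b fa fb|a fa].
- by rewrite /c cross_lin pr_lin.
- rewrite (fixed_embE fb) {2}/c prl plK -fixed_embE //.
  by rewrite {2}/c -prM cross_mul mulg1 tact1.
- by rewrite [in RHS](fixed_embE fa) /c /pr cross_star invg1 tact1 starK.
Qed.

Lemma fixed_emb_dom s a : valid n s -> dom alpha s a ->
  c a = nu *: \sum_(h <- s) U h a.
Proof.
move=> vs sa; have s1 : 1%g \in s by case/and3P: vs.
rewrite /c /pr cross_star invg1 tact1 (pl_cross vs s1 (dom_star nd sa)).
rewrite starZr star_sum; congr (_ *: _); rewrite !big_seq; apply: eq_bigr => h hs.
rewrite mulg1 cross_star invgK -tact_star starK tactK cross_proj //.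
Qed.

Lemma fixed_emb_image :
  (forall a, fixed_algebra alpha a -> nrm a <= nrm (c a)) ->
  c @` fixed_algebra alpha = [set pl (pr u) | u in setT].
Proof.
move=> cbelow; have bc := badd_fixed_emb.
apply/seteqP; split=> [_ [a fa <-]|_ [u _ <-]].
  by exists (U 1%g a) => //; rewrite -/(c a) pl_fixed_emb expect_id.
have FB a b : fixed_algebra alpha a -> fixed_algebra alpha b ->
    fixed_algebra alpha (a - b).
  move=> fa fb; rewrite -(expect_id nd fa) -(expect_id nd fb).
  by rewrite -(baddB (badd_expect nd)); apply: expect_fixed.
have clc := closed_image_below bc (fixed_closed nd) FB cbelow.
apply: (dense_closed cross_gens_dense
  (badd_preimage_closed (badd_comp badd_pl badd_pr) clc)) => {}u.
elim=> [|v w [s [g [a [_ _ _ ->]]]] _ [b fb bw]] /=.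
  exists 0; first by rewrite -(badd0 (badd_expect nd)); apply: expect_fixed.
  by rewrite (badd0 bc) (badd0 badd_pr) (badd0 badd_pl).
exists (E (P g a) + b); last first.
  by rewrite (baddD bc) bw -pl_fixed_emb -pr_cross (baddD badd_pr) (baddD badd_pl).
by rewrite -(expect_id nd fb) -(baddD (badd_expect nd)); apply: expect_fixed.
Qed.

End CrossedProduct.

(** * The representation on [A] over [A^G] *)

Section Representation.
Context (R : realType) (G : groupType) (A : cstarAlgType R).
Variables (alpha : partial_action G A) (n : nat).
Hypothesis nd : n_decomposition alpha n.
Implicit Types (g h k : G) (s t : seq G) (a b x y : A) (f : G -> A).

Local Notation D := (pdom alpha).
Local Notation V := (tact nd).
Local Notation P := (proj nd).
Local Notation E := (expect nd).
Local Notation alg := (alg_crossed alpha).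

(** [A] as a Hilbert module over [A^G], viewed inside [A]. *)
Definition expect_form : hilbert_form A A.
Proof.
apply: (@HilbertForm R A A (fun x y => E (star x ** y))).
- by move=> x k y z; rewrite amulDr amulZr expect_lin.
- by move=> x y; rewrite -expect_star starM starK.
- by move=> x; rewrite -nrm_star_amul expect_contr.
- by exists n%:R; apply: expect_index.
- exact: expect_cauchy_schwarz.
Defined.

Local Notation L := (adjointable expect_form).

Lemma op_bound (T : A -> A) : badd T ->
  exists M, forall x, inrm expect_form (T x) <= M * inrm expect_form x.
Proof.
move=> bT; have [M M0 TM] := badd_bound bT.
have [K K0 KH] := inrm_equiv expect_form.
exists (M * K) => x; apply: le_trans (inrm_le _ _) _.
by apply: le_trans (TM x) _; rewrite -mulrA ler_pM2l.
Qed.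

Definition op g a : L := @Adjointable _ _ _ expect_form
  (fun x => a ** V g x) (fun y => V g^-1%g (star a ** y))
  (expect_act_adjoint nd g a)
  (op_bound (badd_comp (badd_amull a) (badd_tact nd g))).

Lemma op_lin g (z : R[i]) a b : op g (z *: a + b) = z *: op g a + op g b.
Proof. by apply: adjointable_eq => x /=; rewrite amulDl amulZl. Qed.

Lemma opD g a b : op g (a + b) = op g a + op g b.
Proof. by rewrite -[a]scale1r op_lin !scale1r. Qed.

Lemma op0 g : op g 0 = 0.
Proof. by apply: (@addIr _ (op g 0)); rewrite -opD !add0r. Qed.

Lemma op_sum (I : Type) (r : seq I) g (F : I -> A) :
  op g (\sum_(i <- r) F i) = \sum_(i <- r) op g (F i).
Proof. by apply: (big_morph (op g)); [exact: opD | exact: op0]. Qed.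

Lemma op_mul g h a b : op g a ** op h b = op (g * h)%g (a ** V g b).
Proof.
apply: adjointable_eq => x /=; rewrite tactM tact_comp mul_proj.
by rewrite proj_id ?amulA //; apply: tact_pdom.
Qed.

Lemma op_star g a : star (op g a) = op g^-1%g (V g^-1%g (star a)).
Proof. by apply: adjointable_eq => x /=; rewrite tactM. Qed.

Definition rep f : L := \sum_(g \in [set: G]) op g (f g).

Lemma repE f s : uniq s -> (forall g, g \notin s -> f g = 0) ->
  rep f = \sum_(g <- s) op g (f g).
Proof. by move=> us f0; apply: fsum_seq => // g /f0 ->; apply: op0. Qed.

Lemma rep_hom : star_hom_on (crossed_mul alpha) (crossed_star alpha)
  (@amul R L) (@star R L) alg rep.
Proof.
split=> [z f f' af af'|f f' af af'|f af].
- have [s us f0] := alg_support af; have [s' us' f'0] := alg_support af'.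
  have ut := undup_uniq (s ++ s').
  have f0t g : g \notin undup (s ++ s') -> f g = 0 /\ f' g = 0.
    by rewrite mem_undup mem_cat negb_or => /andP[/f0 -> /f'0 ->].
  rewrite !(repE ut); last 3 first.
  + by move=> g /f0t[].
  + by move=> g /f0t[].
  + move=> g /f0t[fg f'g]; rewrite [LHS](_ : _ = z *: f g + f' g) //.
    by rewrite fg f'g scaler0 addr0.
  rewrite scaler_sumr -big_split; apply: eq_bigr => g _ /=.
  by rewrite [X in op g X](_ : _ = z *: f g + f' g) // op_lin.
- have [s us f0] := alg_support af; have [s' us' f'0] := alg_support af'.
  pose r := undup [seq (g * h)%g | g <- s, h <- s'].
  have ff' g k : g \in s -> k \notin r -> f' (g^-1 * k)%g = 0.
    move=> gs; rewrite mem_undup => kr; apply: f'0; apply: contra kr => ks.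
    by apply/allpairsP; exists (g, (g^-1 * k)%g); rewrite /= mulVKg.
  have mulE k := @crossed_mulE _ _ _ _ _ nd f f' s k af us f0.
  rewrite (@repE _ r (undup_uniq _)) => [|k kr]; last first.
    rewrite mulE big_seq big1 // => g gs.
    by rewrite ff' // (badd0 (badd_tact nd g)) amul0r.
  rewrite (repE us f0) (repE us' f'0) amul_suml.
  under eq_bigr => k _ do rewrite mulE op_sum.
  rewrite exchange_big /= big_seq [RHS]big_seq; apply: eq_bigr => g gs.
  rewrite amul_sumr.
  transitivity (\sum_(k <- [seq (g * h)%g | h <- s'])
      op k (f g ** V g (f' (g^-1 * k)%g))).
    apply: eq_sum_support; first exact: undup_uniq.
    + by rewrite map_inj_uniq //; apply: mulgI.
    + move=> k _ ks; rewrite f'0 ?(badd0 (badd_tact nd g)) ?amul0r ?op0 //.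
      by apply: contra ks => ks; apply/mapP; exists (g^-1 * k)%g; rewrite ?mulVKg.
    + by move=> k _ kr; rewrite ff' // (badd0 (badd_tact nd g)) amul0r op0.
  by rewrite big_map; apply: eq_bigr => h _; rewrite mulKg op_mul.
- have [s us f0] := alg_support af.
  have starfE k := crossed_starE nd k af.
  rewrite (@repE _ [seq g^-1%g | g <- s]); last 2 first.
  + by rewrite map_inj_uniq //; apply: invg_inj.
  + move=> k ks; rewrite starfE f0 ?star0 ?(badd0 (badd_tact nd k)) //.
    by apply: contra ks => ks; apply/mapP; exists k^-1%g; rewrite ?invgK.
  rewrite (repE us f0) star_sum big_map; apply: eq_bigr => g _.
  by rewrite starfE invgK op_star.
Qed.

Lemma badd_afun x : badd (fun T : L => afun T x).
Proof.
split=> //; have [K K0 KH] := inrm_equiv expect_form.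
exists (K * inrm expect_form x) => T; apply: le_trans (KH _) _.
by rewrite -mulrA ler_pM2l // mulrC; apply: opnrmP.
Qed.

Lemma inrm_fixed a : fixed_algebra alpha a -> inrm expect_form a = nrm a.
Proof.
move=> fa; rewrite /inrm /= expect_id; last exact: (fixed_mul nd (fixed_star nd fa) fa).
by rewrite nrm_star_amul sqrtr_sqr ger0_norm ?nrm_ge0.
Qed.

Variables (B : cstarAlgType R) (iota : (G -> A) -> B).
Hypothesis cp : is_crossed_product alpha iota.

(** In the representation, [p] acts as [E], hence [a p] as [a E]. *)
Lemma fixed_emb_below a : fixed_algebra alpha a ->
  nrm a <= nrm (fixed_emb nd cp a).
Proof.
have [_ _ univ] := cp; have [pi' pihom piE] := univ _ rep rep_hom.
have pi_contr u : nrm (pi' u) <= nrm u.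
  by apply: (star_hom_contractive pihom).
have bpi : badd pi'.
  apply: badd_contr pi_contr => u v; have [lin _ _] := pihom.
  by rewrite -[u]scale1r lin // !scale1r.
have piZ z u : pi' (z *: u) = z *: pi' u.
  have [lin _ _] := pihom.
  by rewrite -[z *: u]addr0 lin // (badd0 bpi) addr0.
have pi_cross g b : pi' (cross nd iota g b) = op g (P g b).
  rewrite /cross piE; last exact/alg_delta/proj_pdom.
  rewrite (@repE _ [:: g]) //; last exact: delta_support.
  by rewrite big_seq1 /delta eqxx.
have emb_act b x : afun (pi' (fixed_emb nd cp b)) x = b ** E x.
  apply: (badd_eq (badd_comp (badd_afun x) (badd_comp bpi (badd_fixed_emb nd cp)))
    (badd_amulr (E x)) (gens_dense nd)) => {}b [s vs sb].
  rewrite (fixed_emb_dom nd cp vs sb) piZ (badd_sum bpi).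
  transitivity ((n%:R^-1)%:C *: \sum_(h <- s) b ** V h x); last first.
    have := congr1 star (expect_local nd (star x) vs (dom_star nd sb)).
    rewrite starM starK -expect_star starK => ->.
    rewrite starZr star_sum; congr (_ *: _); apply: eq_bigr => h _.
    by rewrite tact_star starM !starK.
  rewrite [LHS](_ : _ = (n%:R^-1)%:C *:
    afun (\sum_(h <- s) pi' (cross nd iota h b)) x) //; congr (_ *: _).
  rewrite (badd_sum (badd_afun x)) !big_seq; apply: eq_bigr => h hs.
  by rewrite pi_cross (proj_dom nd h vs sb) hs.
move=> fa; have fsa := fixed_star nd fa.
have [a0|] := boolP (0 < nrm a); last first.
  by rewrite -leNgt => a0; apply: le_trans a0 (nrm_ge0 _).
rewrite -(ler_pM2r a0) -expr2 -nrm_amul_star -(inrm_fixed (fixed_mul nd fa fsa)).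
rewrite -{1}(expect_id nd fsa) -emb_act -(nrm_star a) -(inrm_fixed fsa).
apply: le_trans (opnrmP _ _) _; rewrite ler_wpM2r ?inrm_ge0 //.
exact: pi_contr.
Qed.

End Representation.

Theorem theoremD (R : realType) (G : groupType) (A : cstarAlgType R)
    (alpha : partial_action G A) (dec : decomposable alpha)
    (B : cstarAlgType R) (iota : (G -> A) -> B)
    (cp : is_crossed_product alpha iota) :
  (exists E : A -> A,
     conditional_expectation (fixed_algebra alpha) E /\ faithful E) /\
  (exists c : A -> B,
     [/\ cstar_hom_on (fixed_algebra alpha) c,
         set_inj (fixed_algebra alpha) c &
         is_corner (c @` fixed_algebra alpha)]).
Proof.
have [n _ nd] := dec; split.
  by exists (expect nd); split; [exact: expect_cond | exact: expect_faithful].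
have below := fixed_emb_below nd cp.
exists (fixed_emb nd cp); split; first exact: fixed_emb_hom.
- move=> a b; rewrite !inE => fa fb ab.
  apply/subr0_eq/nrm_le0; apply: le_trans (below _ _) _.
    rewrite -(expect_id nd fa) -(expect_id nd fb) -(baddB (badd_expect nd)).
    exact: expect_fixed.
  by rewrite (baddB (badd_fixed_emb nd cp)) ab subrr nrm0.
- exists (proj_mult nd cp); first exact: proj_mult_projection.
  exact: fixed_emb_image.
Qed.
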